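(* Up to projective equivalence (under $\mathrm{P\Gamma L}(12,2)$) there are exactly three $4$-dimensional pseudo-ovals in $\mathrm{PG}(11,2)$, and each of them is elementary: they arise, respectively, from a conic $\mathcal C$, a pointed conic $\mathcal{PC}$, and a Lunelli–Sce oval $\mathcal K$ of $\mathrm{PG}(2,16)$.
   Context: A $4$-dimensional pseudo-oval in $\mathrm{PG}(11,2)$ is a set of $17$ projective $3$-dimensional subspaces any three of which span $\mathrm{PG}(11,2)$. Identifying $\mathrm{GF}(2)^{12}$ with $\mathrm{GF}(16)^3$ as $\mathrm{GF}(2)$-vector spaces, each point of $\mathrm{PG}(2,16)$ becomes a $3$-dimensional subspace of $\mathrm{PG}(11,2)$, and an oval of $\mathrm{PG}(2,16)$ (17 points, no three collinear) becomes a $4$-dimensional pseudo-oval, called elementary and said to arise from that oval. A conic is a nondegenerate conic of $\mathrm{PG}(2,16)$; a pointed conic is obtained from a conic by deleting one point and adding the nucleus of the conic; a Lunelli–Sce oval is an oval of $\mathrm{PG}(2,16)$ that is neither a conic nor a pointed conic (all such ovals are projectively equivalent). *)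

(* Defs.v *)
From HB Require Import structures.
From mathcomp Require Import all_boot all_order all_algebra all_fingroup all_field.
Set Implicit Arguments. Unset Strict Implicit. Unset Printing Implicit Defensive.
Import GRing.Theory.
Local Open Scope ring_scope.

(* The ambient space PG(11,2): projective subspaces of dimension d are
   GF(2)-subspaces of dimension d+1 of V2 := GF(2)^12. *)
Notation V2 := 'rV['F_2]_12.

(* Image of an F-subspace U of F^3 (F = GF(16)) under a map phi into V2,
   taken as the GF(2)-subspace spanned by the image set (for additive phi
   the image set itself is already a GF(2)-subspace). *)
Definition vimg (F : finFieldType) (phi : 'rV[F]_3 -> V2) (U : {vspace 'rV[F]_3})
  : {vspace V2} :=
  <<map phi (filter (fun x => x \in U) (enum 'rV[F]_3))>>%VS.

Definition vimg2 (g : V2 -> V2) (U : {vspace V2}) : {vspace V2} :=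
  <<map g (filter (fun x => x \in U) (enum V2))>>%VS.

Definition additive_map (A B : zmodType) (f : A -> B) :=
  forall x y, f (x + y) = f x + f y.

Definition is_pseudo_oval (P : 'I_17 -> {vspace V2}) : Prop :=
  [/\ injective P,
      (forall i, \dim (P i) = 4%N) &
      (forall i j k, i != j -> j != k -> i != k -> (P i + P j + P k)%VS = fullv)].

(* Projective equivalence under PGammaL(12,2): an additive (= semilinear,
   since GF(2) has trivial automorphism group) bijection of V2 mapping the
   set of 17 subspaces onto the other one. *)
Definition pequiv (P Q : 'I_17 -> {vspace V2}) : Prop :=
  exists g : V2 -> V2, [/\ additive_map g, bijective g &
    exists s : {perm 'I_17}, forall i, vimg2 g (P i) = Q (s i)].

Section Plane.
Variable F : finFieldType.

(* points of PG(2,F): 1-dimensional subspaces of F^3; lines: 2-dimensional *)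
Definition in_range (O : 'I_17 -> {vspace 'rV[F]_3}) (U : {vspace 'rV[F]_3}) :=
  exists i, O i = U.

Definition is_oval (O : 'I_17 -> {vspace 'rV[F]_3}) : Prop :=
  [/\ injective O,
      (forall i, \dim (O i) = 1%N) &
      (forall i j k, i != j -> j != k -> i != k -> (O i + O j + O k)%VS = fullv)].

Definition qform (M : 'M[F]_3) (x : 'rV[F]_3) : F := (x *m M *m x^T) 0 0.
Definition polar (M : 'M[F]_3) (x y : 'rV[F]_3) : F :=
  qform M (x + y) - qform M x - qform M y.
Definition nonsingular_qf (M : 'M[F]_3) : Prop :=
  forall x, x != 0 -> qform M x = 0 -> exists y, polar M x y != 0.

Definition is_conic (O : 'I_17 -> {vspace 'rV[F]_3}) : Prop :=
  exists M, nonsingular_qf M /\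
    forall U : {vspace 'rV[F]_3}, \dim U = 1%N ->
      (in_range O U <-> forall x, x \in U -> qform M x = 0).

Definition is_nucleus (O : 'I_17 -> {vspace 'rV[F]_3}) (N : {vspace 'rV[F]_3}) :=
  [/\ \dim N = 1%N, ~ in_range O N &
      forall i (L : {vspace 'rV[F]_3}), \dim L = 2%N -> (O i <= L)%VS ->
        (forall j, (O j <= L)%VS -> j = i) -> (N <= L)%VS].

Definition is_pointed_conic (O : 'I_17 -> {vspace 'rV[F]_3}) : Prop :=
  exists C, is_conic C /\ exists i0 N, is_nucleus C N /\
    forall U, in_range O U <-> ((in_range C U /\ U <> C i0) \/ U = N).

Definition is_LS_oval (O : 'I_17 -> {vspace 'rV[F]_3}) : Prop :=
  [/\ is_oval O, ~ is_conic O & ~ is_pointed_conic O].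

(* P arises from O: for some GF(2)-linear (= additive, F having char 2)
   identification phi of F^3 with GF(2)^12, P is the set of images of the
   points of O. *)
Definition arises_from (P : 'I_17 -> {vspace V2}) (O : 'I_17 -> {vspace 'rV[F]_3}) :=
  exists phi : 'rV[F]_3 -> V2, [/\ additive_map phi, bijective phi &
    exists s : {perm 'I_17}, forall i, vimg phi (O i) = P (s i)].

Definition elementary (P : 'I_17 -> {vspace V2}) :=
  exists O, is_oval O /\ arises_from P O.
End Plane.

(* Main.v *)
Require Import Defs.
From HB Require Import structures.
From mathcomp Require Import all_boot all_order all_algebra all_fingroup all_field.
From mathcomp Require Import ring.
Set Implicit Arguments. Unset Strict Implicit. Unset Printing Implicit Defensive.
Import GRing.Theory.
Local Open Scope ring_scope.

(** A counting argument shows that the tangent spaces at the 17 members of a pseudo-oval meet in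
    a common subgroup of order 16, so every pseudo-oval is a pseudo-hyperoval (18 members) minus
    one member. In suitable coordinates on [q^3], where [q] is a set of 16 elements, four members
    are [(x,0,0)], [(0,x,0)], [(0,0,x)], [(x,x,x)], and every other one is a graph
    [{(x, A x, B x)}] of a pair of linear maps. Up to the action of the symmetries of the frame
    there are few classes of pairs [(A, B)]. They are treated one after the other: for all but one
    class, every candidate for a sixth member either creates a pair of an earlier class or cannot
    be extended along some coset of a member. In the last class [A] and [B] are multiplications of
    GF(16), all further members are forced to be points of PG(2,16), and the hyperovals that occur
    are mapped by explicit collineations to the regular or to the Lunelli-Sce hyperoval. Deleting
    one point gives a conic, a pointed conic or a Lunelli-Sce oval.

    Conversely an additive bijection of GF(16)^3 mapping the points of one oval onto those of
    another is semilinear: in coordinates [e1, e2, e3] on the oval with [e1 + e2 + e3] on it, the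
    scaling characters of the points coincide, and the elements on which the common character is
    multiplicative form an additive group containing the 14 second coordinates of the other
    points. Hence the three types, which are told apart by the quadratic forms vanishing on all
    or all but one of their points, give inequivalent pseudo-ovals. *)

(** * The sixteen-element group and its tables of maps *)

(** Why irreducibility organises the classes: independence leaves the first map A of a graph, other
    than the two in the frame, without eigenvalue 0 or 1, so its characteristic polynomial is one of
    the three irreducible quartics over GF(2) or (X^2+X+1)^2. The frame symmetries A -> A^-1 and A
    -> A+1 permute the irreducible quartics transitively. Hence an irreducible A may be taken to be
    the companion matrix of X^4+X+1, and a class is recorded by B alone. That some first map, or
    some quotient of two of them, is irreducible at all is shown by a separate small search that
    looks at first maps only.

    What makes the searches finite and short: for u <> 0 and any a, exactly one graph of the
    pseudo-hyperoval has A u = a. So a branching value a can be chosen where few candidates survive,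
    and an empty list is a contradiction. Branching values and equivalences are produced by
    unverified searches and then checked. The order of the classes matters: a candidate that creates
    a 5-arc of a settled class is discarded, so each settled class shortens the later searches. *)

Inductive q := q0 | q1 | q2 | q3 | q4 | q5 | q6 | q7 | q8 | q9 | q10 | q11 | q12 | q13 | q14 | q15.

(** The index of each element is read as four bits and addition is bitwise exclusive or, so [q1],
    [q2], [q4], [q8] form a basis over GF(2). Explicit tables keep the exhaustive checks cheap under
    [vm_compute]. *)
Definition qadd (a b : q) : q := match a with
| q0 => match b with q0 => q0 | q1 => q1 | q2 => q2 | q3 => q3 | q4 => q4 | q5 => q5 | q6 => q6 | q7 => q7 | q8 => q8 | q9 => q9 | q10 => q10 | q11 => q11 | q12 => q12 | q13 => q13 | q14 => q14 | q15 => q15 end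
| q1 => match b with q0 => q1 | q1 => q0 | q2 => q3 | q3 => q2 | q4 => q5 | q5 => q4 | q6 => q7 | q7 => q6 | q8 => q9 | q9 => q8 | q10 => q11 | q11 => q10 | q12 => q13 | q13 => q12 | q14 => q15 | q15 => q14 end
| q2 => match b with q0 => q2 | q1 => q3 | q2 => q0 | q3 => q1 | q4 => q6 | q5 => q7 | q6 => q4 | q7 => q5 | q8 => q10 | q9 => q11 | q10 => q8 | q11 => q9 | q12 => q14 | q13 => q15 | q14 => q12 | q15 => q13 end
| q3 => match b with q0 => q3 | q1 => q2 | q2 => q1 | q3 => q0 | q4 => q7 | q5 => q6 | q6 => q5 | q7 => q4 | q8 => q11 | q9 => q10 | q10 => q9 | q11 => q8 | q12 => q15 | q13 => q14 | q14 => q13 | q15 => q12 end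
| q4 => match b with q0 => q4 | q1 => q5 | q2 => q6 | q3 => q7 | q4 => q0 | q5 => q1 | q6 => q2 | q7 => q3 | q8 => q12 | q9 => q13 | q10 => q14 | q11 => q15 | q12 => q8 | q13 => q9 | q14 => q10 | q15 => q11 end
| q5 => match b with q0 => q5 | q1 => q4 | q2 => q7 | q3 => q6 | q4 => q1 | q5 => q0 | q6 => q3 | q7 => q2 | q8 => q13 | q9 => q12 | q10 => q15 | q11 => q14 | q12 => q9 | q13 => q8 | q14 => q11 | q15 => q10 end
| q6 => match b with q0 => q6 | q1 => q7 | q2 => q4 | q3 => q5 | q4 => q2 | q5 => q3 | q6 => q0 | q7 => q1 | q8 => q14 | q9 => q15 | q10 => q12 | q11 => q13 | q12 => q10 | q13 => q11 | q14 => q8 | q15 => q9 end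
| q7 => match b with q0 => q7 | q1 => q6 | q2 => q5 | q3 => q4 | q4 => q3 | q5 => q2 | q6 => q1 | q7 => q0 | q8 => q15 | q9 => q14 | q10 => q13 | q11 => q12 | q12 => q11 | q13 => q10 | q14 => q9 | q15 => q8 end
| q8 => match b with q0 => q8 | q1 => q9 | q2 => q10 | q3 => q11 | q4 => q12 | q5 => q13 | q6 => q14 | q7 => q15 | q8 => q0 | q9 => q1 | q10 => q2 | q11 => q3 | q12 => q4 | q13 => q5 | q14 => q6 | q15 => q7 end
| q9 => match b with q0 => q9 | q1 => q8 | q2 => q11 | q3 => q10 | q4 => q13 | q5 => q12 | q6 => q15 | q7 => q14 | q8 => q1 | q9 => q0 | q10 => q3 | q11 => q2 | q12 => q5 | q13 => q4 | q14 => q7 | q15 => q6 end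
| q10 => match b with q0 => q10 | q1 => q11 | q2 => q8 | q3 => q9 | q4 => q14 | q5 => q15 | q6 => q12 | q7 => q13 | q8 => q2 | q9 => q3 | q10 => q0 | q11 => q1 | q12 => q6 | q13 => q7 | q14 => q4 | q15 => q5 end
| q11 => match b with q0 => q11 | q1 => q10 | q2 => q9 | q3 => q8 | q4 => q15 | q5 => q14 | q6 => q13 | q7 => q12 | q8 => q3 | q9 => q2 | q10 => q1 | q11 => q0 | q12 => q7 | q13 => q6 | q14 => q5 | q15 => q4 end
| q12 => match b with q0 => q12 | q1 => q13 | q2 => q14 | q3 => q15 | q4 => q8 | q5 => q9 | q6 => q10 | q7 => q11 | q8 => q4 | q9 => q5 | q10 => q6 | q11 => q7 | q12 => q0 | q13 => q1 | q14 => q2 | q15 => q3 end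
| q13 => match b with q0 => q13 | q1 => q12 | q2 => q15 | q3 => q14 | q4 => q9 | q5 => q8 | q6 => q11 | q7 => q10 | q8 => q5 | q9 => q4 | q10 => q7 | q11 => q6 | q12 => q1 | q13 => q0 | q14 => q3 | q15 => q2 end
| q14 => match b with q0 => q14 | q1 => q15 | q2 => q12 | q3 => q13 | q4 => q10 | q5 => q11 | q6 => q8 | q7 => q9 | q8 => q6 | q9 => q7 | q10 => q4 | q11 => q5 | q12 => q2 | q13 => q3 | q14 => q0 | q15 => q1 end
| q15 => match b with q0 => q15 | q1 => q14 | q2 => q13 | q3 => q12 | q4 => q11 | q5 => q10 | q6 => q9 | q7 => q8 | q8 => q7 | q9 => q6 | q10 => q5 | q11 => q4 | q12 => q3 | q13 => q2 | q14 => q1 | q15 => q0 end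
end.

Definition qeq (a b : q) : bool := match a with
| q0 => match b with q0 => true | _ => false end
| q1 => match b with q1 => true | _ => false end
| q2 => match b with q2 => true | _ => false end
| q3 => match b with q3 => true | _ => false end
| q4 => match b with q4 => true | _ => false end
| q5 => match b with q5 => true | _ => false end
| q6 => match b with q6 => true | _ => false end
| q7 => match b with q7 => true | _ => false end
| q8 => match b with q8 => true | _ => false end
| q9 => match b with q9 => true | _ => false end
| q10 => match b with q10 => true | _ => false end
| q11 => match b with q11 => true | _ => false end
| q12 => match b with q12 => true | _ => false end
| q13 => match b with q13 => true | _ => false end
| q14 => match b with q14 => true | _ => false end
| q15 => match b with q15 => true | _ => false end
end.

Definition qs : seq q := [:: q0; q1; q2; q3; q4; q5; q6; q7; q8; q9; q10; q11; q12; q13; q14; q15].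

Definition q2n (x : q) : nat := match x with q0 => 0 | q1 => 1 | q2 => 2 | q3 => 3 | q4 => 4 | q5 => 5 | q6 => 6 | q7 => 7 | q8 => 8 | q9 => 9 | q10 => 10 | q11 => 11 | q12 => 12 | q13 => 13 | q14 => 14 | q15 => 15 end.

Lemma q2nK : cancel q2n (nth q0 qs).
Proof. by case. Qed.

Lemma qeqP : Equality.axiom qeq.
Proof. by move=> x y; case: x; case: y; constructor. Qed.
HB.instance Definition _ := hasDecEq.Build q qeqP.
HB.instance Definition _ := CanIsCountable q2nK.

Lemma qs_enum : Finite.axiom qs.
Proof. by case. Qed.
HB.instance Definition _ := isFinite.Build q qs_enum.

Lemma qeqE x y : qeq x y = (x == y).
Proof. by []. Qed.

(** Here and below tests are nested [if]s instead of conjunctions: evaluation by value would compute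
    both arguments of [&&], whereas [if] stops at the first failure. *)
Fixpoint allq (P : q -> bool) (s : seq q) : bool :=
  if s is x :: s' then (if P x then allq P s' else false) else true.
Lemma allqP (P : q -> bool) : allq P qs = true -> forall x, P x.
Proof.
rewrite /=; do 15! (case: ifP => // ?); case: ifP => // ? _; by case.
Qed.

Lemma card_q : #|{: q}| = 16.
Proof.
by rewrite cardT enumT unlock.
Qed.

Lemma qaddA : associative qadd.
Proof.
move=> x y z; apply/eqP; rewrite -qeqE; move: z; apply: allqP; move: y; apply: allqP; move: x; apply: allqP.
by vm_compute.
Qed.
Lemma qaddC : commutative qadd.
Proof. by case; case. Qed.
Lemma qadd0 : left_id q0 qadd.
Proof. by case. Qed.
Lemma qaddN : left_inverse q0 id qadd.
Proof. by case. Qed.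
HB.instance Definition _ := GRing.isZmodule.Build q qaddA qaddC qadd0 qaddN.

Inductive tb (X : Type) := TB (x0 x1 x2 x3 x4 x5 x6 x7 x8 x9 x10 x11 x12 x13 x14 x15 : X).
Arguments TB {X}.

Definition ap {X} (t : tb X) (u : q) : X :=
  let: TB x0 x1 x2 x3 x4 x5 x6 x7 x8 x9 x10 x11 x12 x13 x14 x15 := t in match u with q0 => x0 | q1 => x1 | q2 => x2 | q3 => x3 | q4 => x4 | q5 => x5 | q6 => x6 | q7 => x7 | q8 => x8 | q9 => x9 | q10 => x10 | q11 => x11 | q12 => x12 | q13 => x13 | q14 => x14 | q15 => x15 end.

Definition mk {X} (f : q -> X) : tb X :=
  TB (f q0) (f q1) (f q2) (f q3) (f q4) (f q5) (f q6) (f q7) (f q8) (f q9) (f q10) (f q11) (f q12) (f q13) (f q14) (f q15).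

(** Inversion by search; [q15] is both the last index and the default, and [invP] speaks only of
    values c that are attained. *)
Definition inv (t : tb q) (c : q) : q := let: TB x0 x1 x2 x3 x4 x5 x6 x7 x8 x9 x10 x11 x12 x13 x14 x15 := t in
  if qeq x0 c then q0 else if qeq x1 c then q1 else if qeq x2 c then q2 else if qeq x3 c then q3 else if qeq x4 c then q4 else if qeq x5 c then q5 else if qeq x6 c then q6 else if qeq x7 c then q7 else if qeq x8 c then q8 else if qeq x9 c then q9 else if qeq x10 c then q10 else if qeq x11 c then q11 else if qeq x12 c then q12 else if qeq x13 c then q13 else if qeq x14 c then q14 else q15.

Definition nz (t : tb q) : bool := let: TB x0 x1 x2 x3 x4 x5 x6 x7 x8 x9 x10 x11 x12 x13 x14 x15 := t in
  if qeq x1 q0 then false else if qeq x2 q0 then false else if qeq x3 q0 then false else if qeq x4 q0 then false else if qeq x5 q0 then false else if qeq x6 q0 then false else if qeq x7 q0 then false else if qeq x8 q0 then false else if qeq x9 q0 then false else if qeq x10 q0 then false else if qeq x11 q0 then false else if qeq x12 q0 then false else if qeq x13 q0 then false else if qeq x14 q0 then false else if qeq x15 q0 then false else true.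

Definition dif (s t : tb q) : bool := let: TB x0 x1 x2 x3 x4 x5 x6 x7 x8 x9 x10 x11 x12 x13 x14 x15 := s in let: TB y0 y1 y2 y3 y4 y5 y6 y7 y8 y9 y10 y11 y12 y13 y14 y15 := t in
  if qeq x1 y1 then false else if qeq x2 y2 then false else if qeq x3 y3 then false else if qeq x4 y4 then false else if qeq x5 y5 then false else if qeq x6 y6 then false else if qeq x7 y7 then false else if qeq x8 y8 then false else if qeq x9 y9 then false else if qeq x10 y10 then false else if qeq x11 y11 then false else if qeq x12 y12 then false else if qeq x13 y13 then false else if qeq x14 y14 then false else if qeq x15 y15 then false else true.

Definition tl (r1 r2 r4 r8 : q) : tb q :=
  let r3 := qadd r1 r2 in let r5 := qadd r1 r4 in
  let r6 := qadd r2 r4 in let r7 := qadd r3 r4 in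
  TB q0 r1 r2 r3 r4 r5 r6 r7 r8 (qadd r1 r8) (qadd r2 r8) (qadd r3 r8)
     (qadd r4 r8) (qadd r5 r8) (qadd r6 r8) (qadd r7 r8).

Lemma qaddE (x y : q) : qadd x y = x + y. Proof. by []. Qed.
Lemma q0E : q0 = 0. Proof. by []. Qed.
Lemma addqq (x : q) : x + x = 0. Proof. by case: x. Qed.
Lemma oppq (x : q) : - x = x. Proof. by []. Qed.
Lemma addq_eq0 (x y : q) : (x + y == 0) = (x == y).
Proof. by rewrite -{1}(oppq y) subr_eq0. Qed.

Lemma ap_mk X (f : q -> X) u : ap (mk f) u = f u.
Proof. by case: u. Qed.

Lemma eq_tb X (s t : tb X) : (forall u, ap s u = ap t u) -> s = t.
Proof.
case: s => x0 x1 x2 x3 x4 x5 x6 x7 x8 x9 x10 x11 x12 x13 x14 x15.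
case: t => y0 y1 y2 y3 y4 y5 y6 y7 y8 y9 y10 y11 y12 y13 y14 y15 e; congr TB;
 [exact: e q0|exact: e q1|exact: e q2|exact: e q3|exact: e q4|exact: e q5
 |exact: e q6|exact: e q7|exact: e q8|exact: e q9|exact: e q10|exact: e q11|exact: e q12
 |exact: e q13|exact: e q14|exact: e q15].
Qed.

Definition lin (t : tb q) := forall x y, ap t (x + y) = ap t x + ap t y.

Lemma lin0 t : lin t -> ap t 0 = 0.
Proof. by move=> l; apply: (addrI (ap t 0)); rewrite -l !addr0. Qed.

Definition bit (k : q) (x : q) (r : q) : q :=
  let b := match k with
   | q1 => match x with q1 | q3 | q5 | q7 | q9 | q11 | q13 | q15 => true | _ => false end
   | q2 => match x with q2 | q3 | q6 | q7 | q10 | q11 | q14 | q15 => true | _ => false end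
   | q4 => match x with q4 | q5 | q6 | q7 | q12 | q13 | q14 | q15 => true | _ => false end
   | _ => match x with q8 | q9 | q10 | q11 | q12 | q13 | q14 | q15 => true | _ => false end end
  in if b then r else 0.

Lemma bitD k x y r : [\/ k = q1, k = q2, k = q4 | k = q8] -> bit k (x + y) r = bit k x r + bit k y r.
Proof.
by case=> ->; case: x; case: y => //=;
  rewrite /bit /= ?addqq ?addr0 ?add0r.
Qed.

Lemma ap_tl r1 r2 r4 r8 x :
  ap (tl r1 r2 r4 r8) x = bit q1 x r1 + bit q2 x r2 + bit q4 x r4 + bit q8 x r8.
Proof. by case: x; rewrite /bit /= ?addr0 ?add0r. Qed.

Lemma lin_tl r1 r2 r4 r8 : lin (tl r1 r2 r4 r8).
Proof.
move=> x y; rewrite !ap_tl (bitD _ _ _ (Or41 _ _ _ erefl)) (bitD _ _ _ (Or42 _ _ _ erefl)).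
rewrite (bitD _ _ _ (Or43 _ _ _ erefl)) (bitD _ _ _ (Or44 _ _ _ erefl)).
by rewrite (addrACA (bit q1 x r1)) (addrACA (bit q1 x r1 + _)) (addrACA (bit q1 x r1 + _ + _)).
Qed.

Lemma lin_eq s t : lin s -> lin t -> ap s q1 = ap t q1 -> ap s q2 = ap t q2 ->
  ap s q4 = ap t q4 -> ap s q8 = ap t q8 -> s = t.
Proof.
move=> ls lt e1 e2 e4 e8; apply: eq_tb => u.
have e0 : ap s q0 = ap t q0 by rewrite (lin0 ls) (lin0 lt).
have e3 : ap s q3 = ap t q3 by rewrite -[q3]/(q1 + q2) ls lt e1 e2.
have e5 : ap s q5 = ap t q5 by rewrite -[q5]/(q1 + q4) ls lt e1 e4.
have e6 : ap s q6 = ap t q6 by rewrite -[q6]/(q2 + q4) ls lt e2 e4.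
have e7 : ap s q7 = ap t q7 by rewrite -[q7]/(q3 + q4) ls lt e3 e4.
case: u => //.
- by rewrite -[q9]/(q1 + q8) ls lt e1 e8.
- by rewrite -[q10]/(q2 + q8) ls lt e2 e8.
- by rewrite -[q11]/(q3 + q8) ls lt e3 e8.
- by rewrite -[q12]/(q4 + q8) ls lt e4 e8.
- by rewrite -[q13]/(q5 + q8) ls lt e5 e8.
- by rewrite -[q14]/(q6 + q8) ls lt e6 e8.
by rewrite -[q15]/(q7 + q8) ls lt e7 e8.
Qed.

Lemma lin_tlE t : lin t -> t = tl (ap t q1) (ap t q2) (ap t q4) (ap t q8).
Proof. by move=> lt; apply: lin_eq => //; exact: lin_tl. Qed.

Lemma invP t c u : ap t u = c -> ap t (inv t c) = c.
Proof.
case: t => x0 x1 x2 x3 x4 x5 x6 x7 x8 x9 x10 x11 x12 x13 x14 x15 /=.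
by move=> <-; case: u => /=; rewrite !qeqE ?eqxx; do ?[case: eqP => [//|_]].
Qed.

Lemma nzP t : reflect (forall u, u != 0 -> ap t u != 0) (nz t).
Proof.
case: t => x0 x1 x2 x3 x4 x5 x6 x7 x8 x9 x10 x11 x12 x13 x14 x15; rewrite /nz.
do 15! (rewrite qeqE; case: eqP => [e|/eqP ?];
  first by constructor => h; have := e; apply/eqP; first
  [exact: (h q1 isT)|exact: (h q2 isT)|exact: (h q3 isT)|exact: (h q4 isT)|exact: (h q5 isT)|exact: (h q6 isT)|exact: (h q7 isT)
  |exact: (h q8 isT)|exact: (h q9 isT)|exact: (h q10 isT)|exact: (h q11 isT)|exact: (h q12 isT)|exact: (h q13 isT)|exact: (h q14 isT)
  |exact: (h q15 isT)]).
by constructor; case.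
Qed.

Lemma difP s t : reflect (forall u, u != 0 -> ap s u != ap t u) (dif s t).
Proof.
case: s => x0 x1 x2 x3 x4 x5 x6 x7 x8 x9 x10 x11 x12 x13 x14 x15.
case: t => y0 y1 y2 y3 y4 y5 y6 y7 y8 y9 y10 y11 y12 y13 y14 y15; rewrite /dif.
do 15! (rewrite qeqE; case: eqP => [e|/eqP ?];
  first by constructor => h; have := e; apply/eqP; first
  [exact: (h q1 isT)|exact: (h q2 isT)|exact: (h q3 isT)|exact: (h q4 isT)|exact: (h q5 isT)|exact: (h q6 isT)|exact: (h q7 isT)
  |exact: (h q8 isT)|exact: (h q9 isT)|exact: (h q10 isT)|exact: (h q11 isT)|exact: (h q12 isT)|exact: (h q13 isT)|exact: (h q14 isT)
  |exact: (h q15 isT)]).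
by constructor; case.
Qed.

Section Inverse.
Variable t : tb q.
Hypotheses (lt : lin t) (nt : forall u, u != 0 -> ap t u != 0).

Lemma ap_inj : injective (ap t).
Proof.
move=> x y e; apply/eqP; rewrite -addq_eq0; apply: contraTT isT => /nt.
by rewrite lt e addqq eqxx.
Qed.

Lemma ap_surj c : exists u, ap t u = c.
Proof. by have [g _ k] := injF_bij ap_inj; exists (g c). Qed.

Lemma apinv c : ap t (inv t c) = c.
Proof. by have [u] := ap_surj c; apply: invP. Qed.

Lemma invap u : inv t (ap t u) = u.
Proof. by apply: ap_inj; rewrite apinv. Qed.

Lemma lin_inv x y : inv t (x + y) = inv t x + inv t y.
Proof. by apply: ap_inj; rewrite lt !apinv. Qed.

End Inverse.

(** * Pseudo-arcs in coordinates *)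

Notation pt := (q * q * q)%type.
Notation pr := (tb q * tb q)%type.

Lemma addpp (x : pt) : x + x = 0.
Proof. by case: x => -[x y] z; congr (_, _, _); rewrite /= addqq. Qed.

Lemma addp_eq0 (x y : pt) : x + y = 0 -> x = y.
Proof. by move=> e; rewrite -[y]add0r -(addpp x) -addrA e addr0. Qed.

Definition tz : tb q := mk (fun _ => q0).
Definition idt : tb q := mk id.
Definition gr (p : pr) : {set pt} :=
  [set v | (v.1.2 == ap p.1 v.1.1) && (v.2 == ap p.2 v.1.1)].
Definition E1 := gr (tz, tz).
Definition E2 : {set pt} := [set v | (v.1.1 == 0) && (v.2 == 0)].
Definition E3 : {set pt} := [set v | (v.1.1 == 0) && (v.1.2 == 0)].
Definition E4 := gr (idt, idt).

Lemma grP p u : (u, ap p.1 u, ap p.2 u) \in gr p.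
Proof. by rewrite inE !eqxx. Qed.

Lemma gr_inv p v : v \in gr p -> v = (v.1.1, ap p.1 v.1.1, ap p.2 v.1.1).
Proof. by case: v => -[x y] z; rewrite inE /= => /andP[/eqP-> /eqP->]. Qed.

Lemma card_im16 (f : q -> pt) (E : {set pt}) : injective f ->
  (forall v, v \in E <-> exists u, v = f u) -> #|E| = 16.
Proof.
move=> fi h; rewrite -card_q -(card_imset predT fi); apply: eq_card => v.
by apply/idP/imsetP => [/h[u ->]|[u _ ->]]; [exists u | apply/h; exists u].
Qed.

Lemma card_gr p : #|gr p| = 16.
Proof.
apply: (@card_im16 (fun u => (u, ap p.1 u, ap p.2 u))) => [x y []//|v].
by split=> [/gr_inv ->|[u ->]]; [exists v.1.1 | exact: grP].
Qed.
Lemma card_E2 : #|E2| = 16.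
Proof.
apply: (@card_im16 (fun u => (0, u, 0))) => [x y []//|[[x y] z]]; rewrite inE /=.
by split=> [/andP[/eqP-> /eqP->]|[u [-> _ ->]]]; [exists y | rewrite !eqxx].
Qed.
Lemma card_E3 : #|E3| = 16.
Proof.
apply: (@card_im16 (fun u => (0, 0, u))) => [x y []//|[[x y] z]]; rewrite inE /=.
by split=> [/andP[/eqP-> /eqP->]|[u [-> -> _]]]; [exists z | rewrite !eqxx].
Qed.

Lemma gr_nE2 p : gr p != E2.
Proof. by apply/eqP => /setP/(_ (q1, ap p.1 q1, ap p.2 q1)); rewrite grP inE. Qed.
Lemma gr_nE3 p : gr p != E3.
Proof. by apply/eqP => /setP/(_ (q1, ap p.1 q1, ap p.2 q1)); rewrite grP inE. Qed.
Lemma E2_nE3 : E2 != E3.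
Proof. by apply/eqP => /setP/(_ (q0, q1, q0)); rewrite !inE. Qed.

Definition subg (E : {set pt}) :=
  [/\ 0 \in E, forall x y : pt, x \in E -> y \in E -> x + y \in E & #|E| = 16].
Definition indep (H : {set {set pt}}) := forall E F G, E \in H -> F \in H -> G \in H ->
  E != F -> F != G -> E != G -> forall x y z : pt, x \in E -> y \in F -> z \in G ->
  x + y + z = 0 -> [/\ x = 0, y = 0 & z = 0].
(** Pseudo-ovals (n = 17) and pseudo-hyperovals (n = 18) as bare sets of subgroups. Additivity
    stands for GF(2)-linearity, and independence of three groups of order 16 for spanning, since
    16^3 is the order of the whole group. *)
Definition hyp n (H : {set {set pt}}) :=
  [/\ #|H| = n, forall E, E \in H -> subg E & indep H].

Lemma gr_lin p : subg (gr p) -> lin p.1 /\ lin p.2.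
Proof.
case=> _ h _; split=> x y; have := h _ _ (grP p x) (grP p y); rewrite inE /=.
  by case/andP=> /eqP.
by case/andP=> _ /eqP.
Qed.

Definition iso (g : pt -> pt) := additive_map g /\ injective g.
Definition im (g : pt -> pt) (H : {set {set pt}}) : {set {set pt}} := [set g @: (E : {set pt}) | E in H].

Lemma iso0 g : iso g -> g 0 = 0.
Proof. by case=> ga _; apply: (addrI (g 0)); rewrite -ga !addr0. Qed.

Lemma hyp_im n g H : iso g -> hyp n H -> hyp n (im g H).
Proof.
move=> ig [cH sH iH]; have [ga gi] := ig; split.
- by rewrite card_imset //; apply: imset_inj.
- move=> _ /imsetP[E /sH[E0 Ea cE] ->]; split; last by rewrite card_imset.
    by rewrite -(iso0 ig) imset_f.
  by move=> _ _ /imsetP[x xE ->] /imsetP[y yE ->]; rewrite -ga imset_f // Ea.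
move=> _ _ _ /imsetP[E EH ->] /imsetP[F FH ->] /imsetP[G GH ->] nEF nFG nEG.
move=> _ _ _ /imsetP[x xE ->] /imsetP[y yF ->] /imsetP[z zG ->].
rewrite -!ga -(iso0 ig) => /gi e.
have ne (A B : {set pt}) : g @: A != g @: B -> A != B by apply: contraNneq => ->.
have [-> -> ->] := iH _ _ _ EH FH GH (ne _ _ nEF) (ne _ _ nFG) (ne _ _ nEG) _ _ _ xE yF zG e.
by [].

Qed.

Lemma im_eq g (E F : {set pt}) : iso g -> #|E| = 16 -> #|F| = 16 ->
  (forall x, x \in E -> g x \in F) -> g @: E = F.
Proof.
move=> [_ gi] cE cF h; apply/eqP; rewrite eqEcard card_imset // cE cF leqnn andbT.
by apply/subsetP=> _ /imsetP[x /h ? ->].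
Qed.

Lemma im_comp g h H : im g (im h H) = im (g \o h) H.
Proof.
apply/setP => X; apply/imsetP/imsetP => [[_ /imsetP[E EH ->] ->]|[E EH ->]].
  by exists E => //; rewrite -imset_comp.
by exists (h @: E); [exact: imset_f | rewrite -imset_comp].
Qed.

Lemma iso_comp g h : iso g -> iso h -> iso (g \o h).
Proof. by move=> [ga gi] [ha hi]; split=> [x y /=|]; [rewrite ha ga | apply: inj_comp]. Qed.

Definition Std H := [/\ hyp 18 H, E1 \in H, E2 \in H, E3 \in H & E4 \in H].
(** A fifth member next to the frame; a graph is never [E2] or [E3], so only the two graphs of the
    frame are excluded. *)
Definition Arc (H : {set {set pt}}) p := [/\ gr p \in H, gr p != E1 & gr p != E4].

Section Frame.
Variables (H : {set {set pt}}) (sH : Std H).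

Lemma Std_ind : indep H. Proof. by case: sH => -[]. Qed.
Lemma Std_subg E : E \in H -> subg E. Proof. by case: sH => -[] _ h *; apply: h. Qed.
Lemma Std_lin p : gr p \in H -> lin p.1 /\ lin p.2.
Proof. by move/Std_subg/gr_lin. Qed.
Let e1 : E1 \in H. Proof. by case: sH. Qed.
Let e2 : E2 \in H. Proof. by case: sH. Qed.
Let e3 : E3 \in H. Proof. by case: sH. Qed.
Let e4 : E4 \in H. Proof. by case: sH. Qed.

(** If the first maps agreed at u, the two points over u would differ by an element of [E3], against
    independence. Using [E2] in place of [E3] treats the second maps. *)
Lemma ind2A p r : gr p \in H -> gr r \in H -> gr p != gr r ->
  forall u, u != 0 -> ap p.1 u != ap r.1 u.
Proof.
move=> pH rH n u un; apply: contraNneq un => e.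
have z : (0, 0, ap p.2 u + ap r.2 u) \in E3 by rewrite inE /= !eqxx.
have [] := Std_ind pH rH e3 n (gr_nE3 _) (gr_nE3 _) (grP p u) (grP r u) z.
  by congr (_, _, _); rewrite /= ?e ?addr0 ?addqq.
by case=> ->.
Qed.

Lemma ind2B p r : gr p \in H -> gr r \in H -> gr p != gr r ->
  forall u, u != 0 -> ap p.2 u != ap r.2 u.
Proof.
move=> pH rH n u un; apply: contraNneq un => e.
have z : (0, ap p.1 u + ap r.1 u, 0) \in E2 by rewrite inE /= !eqxx.
have [] := Std_ind pH rH e2 n (gr_nE2 _) (gr_nE2 _) (grP p u) (grP r u) z.
  by congr (_, _, _); rewrite /= ?e ?addr0 ?addqq.
by case=> ->.
Qed.

Lemma ind3 p r s : gr p \in H -> gr r \in H -> gr s \in H ->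
  gr p != gr r -> gr r != gr s -> gr p != gr s -> forall x y z, x + y + z = 0 ->
  ap p.1 x + ap r.1 y + ap s.1 z = 0 -> ap p.2 x + ap r.2 y + ap s.2 z = 0 ->
  [/\ x = 0, y = 0 & z = 0].
Proof.
move=> pH rH sH' n1 n2 n3 x y z ex eA eB.
have [|[-> _ _] [-> _ _] [-> _ _] //] :=
  Std_ind pH rH sH' n1 n2 n3 (grP p x) (grP r y) (grP s z).
by congr (_, _, _).
Qed.

Lemma arc_nz p : gr p \in H -> gr p != E1 ->
  (forall u, u != 0 -> ap p.1 u != 0) /\ (forall u, u != 0 -> ap p.2 u != 0).
Proof.
move=> pH n; split=> u un.
  by have := ind2A (r := (tz, tz)) pH e1 n un; rewrite {1}/tz ap_mk.
by have := ind2B (r := (tz, tz)) pH e1 n un; rewrite {1}/tz ap_mk.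
Qed.

(** Two points of E with equal first coordinate differ by an element of [E2] + [E3], which
    independence makes 0. So the first coordinate is injective on 16 points, hence onto. *)
Lemma graphP E : E \in H -> E != E2 -> E != E3 -> exists p, E = gr p.
Proof.
move=> EH n2 n3; have [E0 Ea cE] := Std_subg EH.
have inj : {in E &, injective (fun v : pt => v.1.1)}.
  move=> v w vE wE e; have sE := Ea _ _ vE wE.
  have y2 : (0, v.1.2 + w.1.2, 0) \in E2 by rewrite inE !eqxx.
  have y3 : (0, 0, v.2 + w.2) \in E3 by rewrite inE !eqxx.
  have [|/addp_eq0 //] := Std_ind EH e2 e3 n2 E2_nE3 n3 sE y2 y3.
  by case: v w e {vE wE sE y2 y3} => -[a b] c [[a' b'] c'] /= ->;
     congr (_, _, _); rewrite /= ?addr0 ?addqq.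
have surj u : exists v, (v \in E) && (v.1.1 == u).
  have : u \in [set (v : pt).1.1 | v in E].
    have /eqP-> : [set (v : pt).1.1 | v in E] == setT.
      by rewrite eqEcard subsetT cardsT card_q card_in_imset // cE.
    by rewrite inE.
  by case/imsetP=> v vE ->; exists v; rewrite vE eqxx.
pose f u := xchoose (surj u).
have fE u : f u \in E by have /andP[] := xchooseP (surj u).
have f1 u : (f u).1.1 = u by have /andP[_ /eqP] := xchooseP (surj u).
exists (mk (fun u => (f u).1.2), mk (fun u => (f u).2)).
apply/eqP; rewrite eqEcard card_gr cE leqnn andbT; apply/subsetP => v vE.
have -> : v = f v.1.1 by apply: inj; rewrite ?f1.
by rewrite inE (ap_mk (fun u => (f u).1.2)) (ap_mk (fun u => (f u).2)) f1 !eqxx.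
Qed.

(** The 16 members other than [E2] and [E3] are graphs whose first maps take distinct values at u by
    [ind2A], and 16 distinct values exhaust [q]. Every search below branches on this fact. *)
Lemma cover u a : u != 0 -> exists2 p, gr p \in H & ap p.1 u = a.
Proof.
move=> un; pose H' := H :\ E2 :\ E3.
have cH' : #|H'| = 16.
  have [[cH _ _] _ _ _ _] := sH; move: cH.
  rewrite (cardsD1 E2) e2 (cardsD1 E3 (H :\ E2)) !inE eq_sym E2_nE3 e3 /=.
  by rewrite add1n add1n => -[].
have gP E : E \in H' -> exists p, gr p == E.
  by rewrite !inE => /and3P[n3 n2 EH]; have [p ->] := graphP EH n2 n3; exists p.
pose f (E : {set pt}) := [pick a | [exists b, (u, a, b) \in E]].
have fE p : gr p \in H' -> f (gr p) = Some (ap p.1 u).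
  move=> pH; rewrite /f; case: pickP => [a' /existsP[b]|/(_ (ap p.1 u))/existsP[]].
    by rewrite inE /= => /andP[/eqP->].
  by exists (ap p.2 u); rewrite grP.
have fi : {in H' &, injective f}.
  move=> E F EH FH; have [p /eqP eE] := gP _ EH; have [r /eqP eF] := gP _ FH.
  rewrite -eE -eF in EH FH *; rewrite !fE // => -[e]; apply/eqP.
  move: EH FH; rewrite !inE => /and3P[_ _ pH] /and3P[_ _ rH].
  by apply: contraT => n; have := ind2A pH rH n un; rewrite e eqxx.
have : Some a \in f @: H'.
  have /eqP-> : f @: H' == Some @: [set: q].
    rewrite eqEcard (card_in_imset fi) cH' card_imset ?cardsT ?card_q; last by move=> x y [].
    rewrite andbT; apply/subsetP => _ /imsetP[E EH ->]; have [p /eqP eE] := gP _ EH.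
    by rewrite -eE in EH *; rewrite fE // imset_f ?inE.
  by rewrite imset_f ?inE.
case/imsetP=> E EH; have [p /eqP eE] := gP _ EH; rewrite -eE in EH *; rewrite fE // => -[->].
by exists p => //; move: EH; rewrite !inE => /and3P[].
Qed.
End Frame.

(** * Symmetries of the frame *)

(** The companion matrix of X^4+X+1, with [q1], [q2], [q4], [q8] in the roles of 1, X, X^2, X^3. *)
Definition CC := tl q2 q4 q8 q3.
Definition tadd (s t : tb q) := mk (fun u => qadd (ap s u) (ap t u)).
Definition tadd1 (s : tb q) := mk (fun u => qadd (ap s u) u).
Definition tinv (A : tb q) : tb q := mk (inv A).
Definition tcmp (s t : tb q) : tb q := mk (fun u => ap t (ap s u)).
(** Effects on graphs of coordinate changes that permute the members of a 5-arc. Exchanging the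
    first two coordinates sends (x, A x, B x) to (A x, x, B x), the graph of A^-1 and B A^-1; adding
    x to the other coordinates exchanges [E1] and [E4] because the characteristic is 2. The
    transpositions (23), (12), (14), (45) generate all permutations of the five members. *)
Definition sw23 (p : pr) : pr := (p.2, p.1).
Definition sw12 (p : pr) : pr := (tinv p.1, tcmp (tinv p.1) p.2).
Definition sw14 (p : pr) : pr := (tadd1 p.1, tadd1 p.2).
Definition sw45 (p : pr) : pr := (tinv p.1, tinv p.2).
Definition scl (r p : pr) : pr := (tcmp p.1 (tinv r.1), tcmp p.2 (tinv r.2)).
Definition cj (T : tb q) (p : pr) : pr :=
  (mk (fun w => inv T (ap p.1 (ap T w))), mk (fun w => inv T (ap p.2 (ap T w)))).

(** The domain D is there for [scl r], where the graph of r itself turns into [E4] and is no longer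
    a fifth member. *)
Definition Mv (D : pr -> Prop) H g f :=
  [/\ iso g, Std (im g H) &
     forall p, Arc H p -> D p -> g @: gr p = gr (f p) /\ Arc (im g H) (f p)].

Lemma mvI (D : pr -> Prop) g f H X1 X2 X3 X4 : Std H -> iso g ->
  X1 \in H -> g @: X1 = E1 -> X2 \in H -> g @: X2 = E2 -> X3 \in H -> g @: X3 = E3 ->
  X4 \in H -> g @: X4 = E4 ->
  (forall p, Arc H p -> D p -> [/\ gr p != X1, gr p != X4 &
     forall u, g (u, ap p.1 u, ap p.2 u) \in gr (f p)]) -> Mv D H g f.
Proof.
move=> sH ig x1 i1 x2 i2 x3 i3 x4 i4 h; split=> //.
  split; rewrite -?i1 -?i2 -?i3 -?i4 ?imset_f //; apply: hyp_im => //; by case: sH.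
move=> p ap_ dp; have [n1 n4 hf] := h p ap_ dp.
have e : g @: gr p = gr (f p).
  by apply: im_eq; rewrite ?card_gr // => v /gr_inv ->.
split=> //; have gi := imset_inj ig.2; split; rewrite -e.
- by apply: imset_f; case: ap_.
- by rewrite -i1 (inj_eq gi).
by rewrite -i4 (inj_eq gi).
Qed.

Lemma in_E2 v : (v \in E2) = (v.1.1 == 0) && (v.2 == 0). Proof. by rewrite inE. Qed.
Lemma in_E3 v : (v \in E3) = (v.1.1 == 0) && (v.1.2 == 0). Proof. by rewrite inE. Qed.
Lemma in_E1 v : (v \in E1) = (v.1.2 == 0) && (v.2 == 0).
Proof. by rewrite inE ap_mk. Qed.
Lemma in_E4 v : (v \in E4) = (v.1.2 == v.1.1) && (v.2 == v.1.1).
Proof. by rewrite inE ap_mk. Qed.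

Ltac imE := apply: im_eq; rewrite ?card_gr ?card_E2 ?card_E3 //;
  move=> -[[x y] z]; rewrite ?in_E1 ?in_E2 ?in_E3 ?in_E4 /=;
  move=> /andP[/eqP-> /eqP->]; rewrite ?addqq ?addr0 ?add0r ?eqxx.

Lemma mv_sw23 H : Std H -> exists g, Mv (fun _ => True) H g sw23.
Proof.
move=> sH; exists (fun v => (v.1.1, v.2, v.1.2)).
have ig : iso (fun v : pt => (v.1.1, v.2, v.1.2)).
  by split=> // -[[a b] c] [[a' b'] c'] /= [-> -> ->].
have [_ e1 e2 e3 e4] := sH.
apply: (mvI sH ig e1 _ e3 _ e2 _ e4 _); try by imE.
by move=> p [_ n1 n4] _; split=> // u; rewrite inE /= !eqxx.
Qed.

Lemma mv_sw12 H : Std H -> exists g, Mv (fun _ => True) H g sw12.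
Proof.
move=> sH; exists (fun v => (v.1.2, v.1.1, v.2)).
have ig : iso (fun v : pt => (v.1.2, v.1.1, v.2)).
  by split=> // -[[a b] c] [[a' b'] c'] /= [-> -> ->].
have [_ e1 e2 e3 e4] := sH.
apply: (mvI sH ig e2 _ e1 _ e3 _ e4 _); try by imE.
move=> p [pH n1 n4] _; split=> // [|u]; first exact: gr_nE2.
have [l _] := Std_lin sH pH; have [nA _] := arc_nz sH pH n1.
by rewrite inE (ap_mk (inv p.1)) (ap_mk (fun u => ap p.2 (ap (tinv p.1) u))) ap_mk invap //= !eqxx.
Qed.

Lemma mv_sw14 H : Std H -> exists g, Mv (fun _ => True) H g sw14.
Proof.
move=> sH; exists (fun v => (v.1.1, v.1.2 + v.1.1, v.2 + v.1.1)).
have ig : iso (fun v : pt => (v.1.1, v.1.2 + v.1.1, v.2 + v.1.1)).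
  split=> [x y|]; first by congr (_, _, _); rewrite /= addrACA.
  by move=> [[a b] c] [[a' b'] c'] /= [-> /addIr -> /addIr ->].
have [_ e1 e2 e3 e4] := sH.
apply: (mvI sH ig e4 _ e2 _ e3 _ e1 _); try by imE.
move=> p [pH n1 n4] _; split=> // u.
by rewrite inE (ap_mk (fun u => qadd (ap p.1 u) u)) (ap_mk (fun u => qadd (ap p.2 u) u)) /= !eqxx.
Qed.

(** Applying the inverses of the two maps of r in the last two coordinates makes r the new [E4]; the
    old [E4] becomes the graph of these inverses, which is the new fifth member. *)
Lemma mv_scl H r : Std H -> Arc H r ->
  exists g, Mv (fun p => gr p != gr r) H g (scl r) /\ Arc (im g H) (sw45 r).
Proof.
move=> sH [rH n1 n4].
have [lA lB] := Std_lin sH rH; have [nA nB] := arc_nz sH rH n1.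
exists (fun v => (v.1.1, inv r.1 v.1.2, inv r.2 v.2)).
have ig : iso (fun v : pt => (v.1.1, inv r.1 v.1.2, inv r.2 v.2)).
  split=> [x y|]; first by congr (_, _, _); rewrite /= lin_inv.
  move=> [[a b] c] [[a' b'] c'] /= [-> eb ec].
  by rewrite -(apinv lA nA b) eb apinv // -(apinv lB nB c) ec apinv.
have [_ e1 e2 e3 e4] := sH.
have z1 : inv r.1 0 = 0 by rewrite -{1}(lin0 lA) invap.
have z2 : inv r.2 0 = 0 by rewrite -{1}(lin0 lB) invap.
have m : Mv (fun p => gr p != gr r) H (fun v : pt => (v.1.1, inv r.1 v.1.2, inv r.2 v.2)) (scl r).
  apply: (mvI sH ig e1 _ e2 _ e3 _ rH _); try by imE; rewrite ?z1 ?z2.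
  - apply: im_eq; rewrite ?card_gr // => v /gr_inv -> /=.
    by rewrite in_E4 /= !invap ?eqxx.
  move=> p [pH m1 m4] n; split=> // u.
  by rewrite inE !(ap_mk (fun u => ap _ (ap _ u))) !ap_mk /= !eqxx.
split=> //; have e : (fun v : pt => (v.1.1, inv r.1 v.1.2, inv r.2 v.2)) @: E4 = gr (sw45 r).
  apply: im_eq; rewrite ?card_gr // => v; rewrite in_E4 => /andP[/eqP ea /eqP eb].
  by rewrite inE (ap_mk (inv r.1)) (ap_mk (inv r.2)) /= ea eb !eqxx.
case: m => _ [_ f1 _ _ f4] _; split; rewrite -e ?imset_f //.
- have <- : (fun v : pt => (v.1.1, inv r.1 v.1.2, inv r.2 v.2)) @: E1 = E1 by imE; rewrite ?z1 ?z2.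
  rewrite (inj_eq (imset_inj ig.2)); apply/eqP => /setP/(_ (q1, q1, q1)).
  by rewrite in_E1 in_E4.
have e' : (fun v : pt => (v.1.1, inv r.1 v.1.2, inv r.2 v.2)) @: gr r = E4.
  apply: im_eq; rewrite ?card_gr // => v /gr_inv -> /=.
  by rewrite in_E4 /= !invap ?eqxx.
by rewrite -[X in _ != X]e' (inj_eq (imset_inj ig.2)) eq_sym.
Qed.

Lemma mv_cj H T : Std H -> lin T -> (forall u, u != 0 -> ap T u != 0) ->
  exists g, Mv (fun _ => True) H g (cj T).
Proof.
move=> sH lT nT; exists (fun v => (inv T v.1.1, inv T v.1.2, inv T v.2)).
have ig : iso (fun v : pt => (inv T v.1.1, inv T v.1.2, inv T v.2)).
  split=> [x y|]; first by congr (_, _, _); rewrite /= lin_inv.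
  have ii : injective (inv T) by apply: can_inj (apinv lT nT).
  by move=> [[a b] c] [[a' b'] c'] /= [/ii-> /ii-> /ii->].
have [_ e1 e2 e3 e4] := sH.
have zT : inv T 0 = 0 by rewrite -{1}(lin0 lT) invap.
apply: (mvI sH ig e1 _ e2 _ e3 _ e4 _); try by imE; rewrite ?zT ?eqxx.
move=> p [pH n1 n4] _; split=> // u.
by rewrite inE !(ap_mk (fun w => inv T (ap _ (ap T w)))) /= apinv // !eqxx.
Qed.

(** * Normal forms of 5-arcs and the table of settled classes *)

Section Good.
Variable Concl : {set {set pt}} -> Prop.
Hypothesis ConclI : forall g H, iso g -> Concl (im g H) -> Concl H.

Definition Good p := forall H, Std H -> Arc H p -> Concl H.

Lemma Good_mv (f : pr -> pr) p : (forall H, Std H -> exists g, Mv (fun _ => True) H g f) ->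
  Good (f p) -> Good p.
Proof.
move=> hf gp H sH pH; have [g [ig sH' h]] := hf H sH.
by apply: (ConclI ig); apply: gp => //; case: (h p pH I).
Qed.

Lemma Good_sw23 p : Good (sw23 p) -> Good p. Proof. exact: Good_mv mv_sw23. Qed.
Lemma Good_sw12 p : Good (sw12 p) -> Good p. Proof. exact: Good_mv mv_sw12. Qed.
Lemma Good_sw14 p : Good (sw14 p) -> Good p. Proof. exact: Good_mv mv_sw14. Qed.
Lemma Good_sw45 p : Good (sw45 p) -> Good p.
Proof.
move=> gp H sH pH; have [g [[ig sH' _] h]] := mv_scl sH pH.
by apply: (ConclI ig); apply: gp.
Qed.

(* A key lists the images of the basis q1, q2, q4, q8 under the second map B
   once the first map has been brought to the companion matrix CC. *)
Definition key := (q * q * q * q)%type.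
Definition kt (k : key) : tb q := let: (r1, r2, r4, r8) := k in tl r1 r2 r4 r8.
(** T sends the basis to x, A x, A^2 x, A^3 x, so conjugation by T turns A into [CC] and B into the
    map recorded by the key. The result is [None] when x is not cyclic for A. *)
Definition keyv (B : tb q) (x v1 v2 v3 : q) : option key :=
  let T := tl x v1 v2 v3 in if nz T then
   let f y := inv T (ap B y) in Some (f x, f v1, f v2, f v3) else None.
Definition nrm1 (x : q) (p : pr) : option key :=
  let A := p.1 in let v1 := ap A x in let v2 := ap A v1 in let v3 := ap A v2 in
  if qeq (ap A v3) (qadd x v1) then keyv p.2 x v1 v2 v3 else None.
(** The three tests are the irreducible quartics over GF(2), evaluated at x. The inverse of a root
    of X^4+X^3+1 is a root of X^4+X+1; adding 1 to a root of X^4+X^3+X^2+X+1 gives a root of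
    X^4+X^3+1, which is then inverted. *)
Definition nrm (x : q) (p : pr) : option key :=
  let A := p.1 in let v1 := ap A x in let v2 := ap A v1 in let v3 := ap A v2 in
  let s := qadd (ap A v3) x in
  if qeq s v1 then keyv p.2 x v1 v2 v3 else if qeq s v3 then nrm1 x (sw12 p)
  else if qeq s (qadd v1 (qadd v2 v3)) then nrm1 x (sw12 (sw14 p)) else None.

Lemma keyvG x p k : let v1 := ap p.1 x in let v2 := ap p.1 v1 in let v3 := ap p.1 v2 in
  ap p.1 v3 = x + v1 -> keyv p.2 x v1 v2 v3 = Some k -> Good (CC, kt k) -> Good p.
Proof.
move=> v1 v2 v3 e4; rewrite /keyv; set T := tl x v1 v2 v3.
case: (nzP T) => // nT [<-] gk H sH pH.
have lT : lin T by exact: lin_tl.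
have [g [ig sH' h]] := mv_cj sH lT nT; have [_ pH'] := h p pH I.
apply: (ConclI ig); apply: gk => //.
suff <- : cj T p = (CC, kt (inv T (ap p.2 x), inv T (ap p.2 v1), inv T (ap p.2 v2), inv T (ap p.2 v3))) by [].
have [l1 l2] := Std_lin sH' (let: And3 a _ _ := pH' in a).
rewrite [cj T p]surjective_pairing; congr (_, _).
  apply: lin_eq; rewrite ?(ap_mk (fun w => inv T (ap p.1 (ap T w)))) //; first exact: lin_tl.
  - by rewrite (_ : ap p.1 _ = ap T q2) ?invap.
  - by rewrite (_ : ap p.1 _ = ap T q4) ?invap.
  - by rewrite (_ : ap p.1 _ = ap T q8) ?invap.
  by rewrite (_ : ap p.1 _ = ap T q3) ?invap.
by apply: lin_eq; rewrite ?(ap_mk (fun w => inv T (ap p.2 (ap T w)))) //; exact: lin_tl.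
Qed.

Lemma nrm1G x p k : nrm1 x p = Some k -> Good (CC, kt k) -> Good p.
Proof. by rewrite /nrm1; case: qeqP => // e; apply: keyvG. Qed.

Lemma nrmG x p k : nrm x p = Some k -> Good (CC, kt k) -> Good p.
Proof.
rewrite /nrm; case: qeqP => [e|_].
  by apply: keyvG; rewrite -[X in _ = _ + X]e qaddE addrCA addqq addr0.
case: qeqP => _; first by move=> e g; apply: Good_sw12; apply: nrm1G e g.
by case: qeqP => // _ e g; apply: Good_sw14; apply: Good_sw12; apply: nrm1G e g.
Qed.

(** A set of keys, indexed by the first two entries for quick lookup; [Gvis] is the invariant that
    each of them is settled. *)
Definition vis := tb (tb (seq (q * q))).
Fixpoint mem2 (a b : q) (s : seq (q * q)) : bool :=
  if s is (c, d) :: s' then if qeq a c then if qeq b d then true else mem2 a b s' else mem2 a b s' else false.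
Definition look (v : vis) (k : key) : bool := let: (r1, r2, r4, r8) := k in mem2 r4 r8 (ap (ap v r1) r2).
Definition upd {X} (t : tb X) (u : q) (x : X) : tb X := mk (fun w => if qeq u w then x else ap t w).
Definition ins (v : vis) (k : key) : vis := let: (r1, r2, r4, r8) := k in
  upd v r1 (upd (ap v r1) r2 ((r4, r8) :: ap (ap v r1) r2)).
Definition vis0 : vis := mk (fun _ => mk (fun _ => [::])).
Definition Gvis v := forall k, look v k -> Good (CC, kt k).

Lemma Gvis0 : Gvis vis0.
Proof. by move=> [[[a b] c] d]; rewrite /look /vis0 !ap_mk. Qed.

Lemma Gins v k : Gvis v -> Good (CC, kt k) -> Gvis (ins v k).
Proof.
case: k => [[[a b] c] d] gv gk [[[a' b'] c'] d']; rewrite /look /ins /upd ap_mk.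
case: qeqP => [<-|_]; last exact: (gv (a', b', c', d')).
rewrite ap_mk; case: qeqP => [<- /=|_]; last exact: (gv (a, b', c', d')).
case: qeqP => [->|_]; last exact: (gv (a, b, c', d')).
by case: qeqP => [->//|_]; exact: (gv (a, b, c, d')).
Qed.

(** The key is taken from the first irreducible map among A, B and A B^-1; if there is none, the
    pair is not recognised. *)
Definition hand (v : vis) (p : pr) : bool :=
  match nrm q1 p with Some k => look v k | None =>
  match nrm q1 (sw23 p) with Some k => look v k | None =>
  match nrm q1 (sw23 (sw12 (sw23 p))) with Some k => look v k | None => false end end end.

Lemma handG v p : Gvis v -> hand v p -> Good p.
Proof.
move=> gv; rewrite /hand; case e: nrm => [k|]; first by move/gv; apply: nrmG e.
case e2: nrm => [k|]; first by move/gv => g; apply: Good_sw23; apply: nrmG e2 g.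
case e3: nrm => [k|//] /gv g.
by apply: Good_sw23; apply: Good_sw12; apply: Good_sw23; apply: nrmG e3 g.
Qed.

(* The five tests are the five 5-arcs formed by [p] and four of the five
   members of the base (frame and [r]). *)
Definition pruned (v : vis) (r p : pr) : bool :=
  if hand v p then true else if hand v (scl r p) then true else
  if hand v (scl (sw14 r) (sw14 p)) then true else
  if hand v (scl (sw14 (sw12 r)) (sw14 (sw12 p))) then true else
  hand v (scl (sw14 (sw12 (sw23 r))) (sw14 (sw12 (sw23 p)))).

Definition Two r p := forall H, Std H -> Arc H r -> Arc H p -> gr p != gr r -> Concl H.

Lemma Two_scl r p : Good (scl r p) -> Two r p.
Proof.
move=> gp H sH rH pH n; have [g [[ig sH' h] _]] := mv_scl sH rH.
by apply: (ConclI ig); apply: gp => //; case: (h p pH n).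
Qed.

Lemma Two_mv f r p : (forall H, Std H -> exists g, Mv (fun _ => True) H g f) ->
  Two (f r) (f p) -> Two r p.
Proof.
move=> hf t H sH rH pH n; have [g [ig sH' h]] := hf H sH.
have [er rH'] := h r rH I; have [ep pH'] := h p pH I.
by apply: (ConclI ig); apply: t => //; rewrite -er -ep (inj_eq (imset_inj ig.2)).
Qed.

Lemma prunedG v r p : Gvis v -> pruned v r p -> Two r p.
Proof.
move=> gv; rewrite /pruned.
case: ifP => [/(handG gv) g _ H sH rH pH _|_]; first exact: g.
case: ifP => [/(handG gv) g _|_]; first exact: Two_scl.
case: ifP => [/(handG gv) g _|_]; first by apply: (Two_mv mv_sw14); apply: Two_scl.
case: ifP => [/(handG gv) g _|_].
  by apply: (Two_mv mv_sw12); apply: (Two_mv mv_sw14); apply: Two_scl.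
move=> /(handG gv) g.
by apply: (Two_mv mv_sw23); apply: (Two_mv mv_sw12); apply: (Two_mv mv_sw14); apply: Two_scl.
Qed.

Fixpoint fld {X Y} (f : X -> Y -> Y) (s : seq X) (acc : Y) : Y :=
  if s is x :: s' then f x (fld f s' acc) else acc.

Inductive gen := G23 | G12 | G14 | G45.
Definition act (g : gen) : pr -> pr :=
  match g with G23 => sw23 | G12 => sw12 | G14 => sw14 | G45 => sw45 end.
Definition actw (w : seq gen) (p : pr) : pr := fld act w p.

Lemma actwG w p : Good (actw w p) -> Good p.
Proof.
elim: w => //= g w IH h; apply: IH; case: g h.
- exact: Good_sw23.
- exact: Good_sw12.
- exact: Good_sw14.
exact: Good_sw45.
Qed.

Definition ent := (key * (seq gen * q))%type.
(** An entry claims that its key is carried, by the word w followed by normalisation at x, to a key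
    already in the table. Entries are read in order, so each may rely on the ones before it. *)
Fixpoint chkents (v : vis) (es : seq ent) : option vis :=
  if es is (k, (w, x)) :: es' then
    match nrm x (actw w (CC, kt k)) with
    | Some k' => if look v k' then chkents (ins v k) es' else None | None => None end
  else Some v.

Lemma chkentsG v es v' : Gvis v -> chkents v es = Some v' -> Gvis v'.
Proof.
elim: es v => [v gv [<-]//|[k [w x]] es IH v gv] /=.
case e: nrm => [k'|//]; case: ifP => // /gv g; apply: IH; apply: Gins => //.
by apply: (@actwG w); apply: nrmG e g.
Qed.
End Good.

(** * Extension search *)

Fixpoint mem {X} (x : X) (s : seq X) : Prop := if s is y :: s' then x = y \/ mem x s' else False.
Fixpoint flt {X} (p : X -> bool) (s : seq X) : seq X :=
  if s is x :: s' then if p x then x :: flt p s' else flt p s' else [::].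

Lemma mem_flt X (p : X -> bool) s x : mem x s -> p x -> mem x (flt p s).
Proof.
elim: s => //= y s IH [<- ->|h px]; first by left.
by case: ifP => _; [right|]; apply: IH.
Qed.

Lemma mem_qs x : mem x qs.
Proof. by case: x => /=; do ?[by left | right]. Qed.

Lemma fld_mono X Y (f : X -> seq Y -> seq Y) s acc t :
  (forall y acc, mem t acc -> mem t (f y acc)) -> mem t acc -> mem t (fld f s acc).
Proof. by move=> h m; elim: s => //= x s IH; apply: h. Qed.

Lemma fld_mem X Y (f : X -> seq Y -> seq Y) s acc x t : mem x s ->
  (forall y acc, mem t acc -> mem t (f y acc)) -> (forall acc, mem t (f x acc)) ->
  mem t (fld f s acc).
Proof. by move=> m h hx; elim: s m => //= y s IH [<-|/IH]; [exact: hx | exact: h]. Qed.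

(** Backtracking over the images of the four basis vectors, testing each sum as soon as its image is
    determined. [enumlinP] records completeness, which is what a refutation relies on. *)
Definition enumlin (F : tb (tb bool)) : seq (tb q) :=
  let: TB _ f1 f2 f3 f4 f5 f6 f7 f8 f9 f10 f11 f12 f13 f14 f15 := F in
  fld (fun r1 acc =>
    if ap f1 r1 then
    fld (fun r2 acc =>
      if ap f2 r2 then let r3 := qadd r1 r2 in
      if ap f3 r3 then
      let R8 := flt (fun v => if ap f8 v then if ap f9 (qadd r1 v) then
           if ap f10 (qadd r2 v) then ap f11 (qadd r3 v) else false else false else false) qs in
      fld (fun r4 acc =>
       if ap f4 r4 then if ap f5 (qadd r1 r4) then if ap f6 (qadd r2 r4) then if ap f7 (qadd r3 r4) then
       fld (fun r8 acc => let s := qadd r4 r8 in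
         if ap f12 s then if ap f13 (qadd r1 s) then if ap f14 (qadd r2 s) then if ap f15 (qadd r3 s)
         then tl r1 r2 r4 r8 :: acc else acc else acc else acc else acc) R8 acc
       else acc else acc else acc else acc) qs acc
      else acc else acc) qs acc
    else acc) qs [::].

Lemma enumlinP (F : tb (tb bool)) t : lin t -> (forall u, u != 0 -> ap (ap F u) (ap t u)) -> mem t (enumlin F).
Proof.
case: F => f0 f1 f2 f3 f4 f5 f6 f7 f8 f9 f10 f11 f12 f13 f14 f15 l h; rewrite /enumlin.
have h1 : ap f1 (ap t q1) := h q1 isT.
have h2 : ap f2 (ap t q2) := h q2 isT.
have h3 : ap f3 (ap t q3) := h q3 isT.
have h4 : ap f4 (ap t q4) := h q4 isT.
have h5 : ap f5 (ap t q5) := h q5 isT.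
have h6 : ap f6 (ap t q6) := h q6 isT.
have h7 : ap f7 (ap t q7) := h q7 isT.
have h8 : ap f8 (ap t q8) := h q8 isT.
have h9 : ap f9 (ap t q9) := h q9 isT.
have h10 : ap f10 (ap t q10) := h q10 isT.
have h11 : ap f11 (ap t q11) := h q11 isT.
have h12 : ap f12 (ap t q12) := h q12 isT.
have h13 : ap f13 (ap t q13) := h q13 isT.
have h14 : ap f14 (ap t q14) := h q14 isT.
have h15 : ap f15 (ap t q15) := h q15 isT.
have m8 R r1 r2 r4 acc : mem t acc -> mem t (fld (fun r8 acc => let s := qadd r4 r8 in
         if ap f12 s then if ap f13 (qadd r1 s) then if ap f14 (qadd r2 s) then if ap f15 (qadd (qadd r1 r2) s)
         then tl r1 r2 r4 r8 :: acc else acc else acc else acc else acc) R acc).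
  by apply: fld_mono => y {}acc m; cbv zeta; do ![case: ifP => _ //]; right.
have m4 R8 r1 r2 acc : mem t acc -> mem t (fld (fun r4 acc =>
       if ap f4 r4 then if ap f5 (qadd r1 r4) then if ap f6 (qadd r2 r4) then if ap f7 (qadd (qadd r1 r2) r4) then
       fld (fun r8 acc => let s := qadd r4 r8 in
         if ap f12 s then if ap f13 (qadd r1 s) then if ap f14 (qadd r2 s) then if ap f15 (qadd (qadd r1 r2) s)
         then tl r1 r2 r4 r8 :: acc else acc else acc else acc else acc) R8 acc
       else acc else acc else acc else acc) qs acc).
  by apply: fld_mono => y {}acc m; cbv zeta; do ![case: ifP => _ //]; apply: m8.
apply: (@fld_mem _ _ _ _ _ (ap t q1) _ (mem_qs _)) => [y acc m|acc].
  case: ifP => // _; apply: fld_mono => // z {}acc {}m; cbv zeta; do ![case: ifP => _ //]; exact: m4.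
rewrite h1; apply: (@fld_mem _ _ _ _ _ (ap t q2) _ (mem_qs _)) => [y {}acc m|{}acc]; cbv zeta.
  by do ![case: ifP => _ //]; apply: m4.
have e a b c : a + b = c -> qadd (ap t a) (ap t b) = ap t c by move=> <-; rewrite l.
have e3 := e q1 q2 q3 erefl; have e5 := e q1 q4 q5 erefl; have e6 := e q2 q4 q6 erefl.
have e7 := e q3 q4 q7 erefl; have e9 := e q1 q8 q9 erefl; have e10 := e q2 q8 q10 erefl.
have e11 := e q3 q8 q11 erefl; have e12 := e q4 q8 q12 erefl; have e13 := e q1 q12 q13 erefl.
have e14 := e q2 q12 q14 erefl; have e15 := e q3 q12 q15 erefl.
rewrite h2 e3 h3.
apply: (@fld_mem _ _ _ _ _ (ap t q4) _ (mem_qs _)) => [y {}acc m|{}acc].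
  by do ![case: ifP => _ //]; rewrite -e3; apply: m8.
rewrite e5 e6 e7 h4 h5 h6 h7.
apply: (@fld_mem _ _ _ _ _ (ap t q8)) => [|y {}acc m|{}acc].
- by apply: mem_flt (mem_qs _) _; rewrite e9 e10 e11 h8 h9 h10 h11.
- by cbv zeta; do ![case: ifP => _ //]; right.
by rewrite e12 e13 e14 e15 h12 h13 h14 h15; left; apply: lin_tlE.
Qed.

Fixpoint notin (v : q) (s : seq q) : bool :=
  if s is x :: s' then if qeq v x then false else notin v s' else true.
Lemma notinE v s : notin v s = (v \notin s).
Proof. by elim: s => //= x s IH; rewrite inE negb_or -IH qeqE; case: eqP. Qed.

(** The map B A^-1, that is, the graph as seen from [E1]. If [E1] and two members are independent,
    their slopes differ at every nonzero vector. *)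
Definition slope (A B : tb q) :=
  let f c := ap B (inv A c) in tl (f q1) (f q2) (f q4) (f q8).

Lemma ap_slope A B c : lin A -> (forall u, u != 0 -> ap A u != 0) -> lin B ->
  ap (slope A B) c = ap B (inv A c).
Proof.
move=> lA nA lB; pose t := mk (fun c => ap B (inv A c)).
have lt : lin t by move=> x y; rewrite !ap_mk lin_inv ?lB.
have -> : slope A B = t by rewrite (lin_tlE lt) /slope !(ap_mk (fun c => ap B (inv A c))).
by rewrite ap_mk.
Qed.

Record cand := Cand { cB : tb q; c1 : tb q; c4 : tb q; c5 : tb q }.
Definition celt := (tb q * cand)%type.

Section Cands.
Variable r : pr.
(** Forbidden values of B u when A u = a. The first three come from [E2] together with [E1], [E4] or
    r; then a comes from [E1] and [E4], the fifth from [E1] and r, and the last from [E4] and r. *)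
Definition masks : tb (tb (tb bool)) :=
  let M1 := slope r.1 r.2 in let M2 := slope (tadd1 r.1) (tadd1 r.2) in
  mk (fun u => mk (fun a => mk (fun v =>
   notin v [:: q0; u; ap r.2 u; a; ap M1 a; qadd u (ap M2 (qadd a u))]))).
Definition FA (a : q) : tb (tb bool) := mk (fun u => mk (fun v =>
  if notin v [:: q0; u; ap r.1 u] then match u with q1 => qeq v a | _ => true end else false)).
(** Slopes seen from [E1], [E4] and r, computed once per candidate because each compatibility test
    between two candidates compares them. *)
Definition mkc A B :=
  Cand B (slope A B) (slope (tadd1 A) (tadd1 B)) (slope (tadd A r.1) (tadd B r.2)).
Definition candsof (ms : tb (tb (tb bool))) a : seq (tb q * seq cand) :=
  map (fun A => let m := mk (fun u => ap (ap ms u) (ap A u)) in (A, map (mkc A) (enumlin m)))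
    (enumlin (FA a)).

Fixpoint compB (ps : seq celt) (c : cand) : bool :=
  if ps is (_, d) :: ps' then
    if dif (cB d) (cB c) then if dif (c1 d) (c1 c) then if dif (c4 d) (c4 c) then
    if dif (c5 d) (c5 c) then compB ps' c
    else false else false else false else false else true.
Fixpoint compA (ps : seq celt) (A : tb q) : bool :=
  if ps is (A', _) :: ps' then if dif A' A then compA ps' A else false else true.
Fixpoint survB ps A (s : seq cand) (acc : seq celt) : seq celt :=
  if s is c :: s' then if compB ps c then (A, c) :: survB ps A s' acc else survB ps A s' acc
  else acc.
Fixpoint surv ps (s : seq (tb q * seq cand)) : seq celt :=
  if s is (A, l) :: s' then if compA ps A then survB ps A l (surv ps s') else surv ps s'
  else [::].
Definition slp (s p : celt) :=
  slope (tadd p.1 s.1) (tadd (cB p.2) (cB s.2)).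
Fixpoint tri1 (s : celt) (ps : seq celt) (p : celt) : bool :=
  if ps is p' :: ps' then if dif (slp s p') (slp s p) then tri1 s ps' p else false else true.
Fixpoint tri (ps : seq celt) (p : celt) : bool :=
  if ps is s :: ps' then if tri1 s ps' p then tri ps' p else false else true.
Definition fresh a (ps : seq celt) : bool :=
  notin a [:: q0, q1, ap r.1 q1 & map (fun p : celt => ap p.1 q1) ps].

Fixpoint walk {X O} (f : X -> O -> option O) (s : seq X) (o : O) : option O :=
  if s is p :: s' then match f p o with None => None | Some o' => walk f s' o' end else Some o.

Lemma walkP X O (f : X -> O -> option O) s o o' p : walk f s o = Some o' -> mem p s ->
  exists o1 o2, f p o1 = Some o2.
Proof.
elim: s o => //= y s IH o; case e: (f y o) => [o2|//] w [->|]; last exact: IH w.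
by exists o, o2.
Qed.

Fixpoint refute (cs : tb (seq (tb q * seq cand))) (n : nat) (ps : seq celt) (o : seq q) :=
  if n is n'.+1 then if o is a :: o' then if fresh a ps then
    walk (fun p => refute cs n' (p :: ps)) (flt (tri ps) (surv ps (ap cs a))) o'
  else None else None else None.
Definition allcands := let ms := masks in mk (candsof ms).

Section Sound.
Variables (H : {set {set pt}}) (sH : Std H) (rH : Arc H r).
Let e1 : E1 \in H. Proof. by case: sH. Qed.
Let e4 : E4 \in H. Proof. by case: sH. Qed.
Definition Mem p := Arc H p /\ gr p != gr r.
Definition celt_of p : celt := (p.1, mkc p.1 p.2).

Lemma E1_E4 : E4 != E1.
Proof. by apply/eqP => /setP/(_ (q1, q1, q1)); rewrite in_E1 in_E4. Qed.

Lemma ap_tz u : ap tz u = 0. Proof. exact: ap_mk. Qed.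
Lemma ap_id u : ap idt u = u. Proof. exact: ap_mk. Qed.
Lemma ap_add s t u : ap (tadd s t) u = ap s u + ap t u. Proof. exact: ap_mk. Qed.
Lemma ap_add1 s u : ap (tadd1 s) u = ap s u + u. Proof. exact: ap_mk. Qed.
Lemma lin_add s t : lin s -> lin t -> lin (tadd s t).
Proof. by move=> ls lt x y; rewrite !ap_add ls lt addrACA. Qed.
Lemma lin_add1 s : lin s -> lin (tadd1 s).
Proof. by move=> ls x y; rewrite !ap_add1 ls addrACA. Qed.

Lemma nz_add1 p : gr p \in H -> gr p != E4 -> forall u, u != 0 -> ap (tadd1 p.1) u != 0.
Proof.
move=> pH n u un; rewrite ap_add1 addq_eq0.
by have := ind2A sH pH e4 n un; rewrite [(idt, idt).1]/= ap_mk.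
Qed.

(** If the slopes agreed at c, vectors x and y with X x = X' y = c would give points of p over x, of
    p' over y and of s over x + y with sum 0. *)
Lemma slope_dif (s p p' : pr) X Y X' Y' : gr s \in H -> gr p \in H -> gr p' \in H ->
  gr p != gr s -> gr p' != gr s -> gr p != gr p' ->
  lin X -> lin Y -> lin X' -> lin Y' ->
  (forall u, ap X u = ap p.1 u + ap s.1 u) -> (forall u, ap Y u = ap p.2 u + ap s.2 u) ->
  (forall u, ap X' u = ap p'.1 u + ap s.1 u) -> (forall u, ap Y' u = ap p'.2 u + ap s.2 u) ->
  dif (slope X Y) (slope X' Y').
Proof.
move=> sH' pH pH' n n' npp lX lY lX' lY' eX eY eX' eY'.
have nX u : u != 0 -> ap X u != 0 by move=> un; rewrite eX addq_eq0; apply: (ind2A sH).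
have nX' u : u != 0 -> ap X' u != 0 by move=> un; rewrite eX' addq_eq0; apply: (ind2A sH).
apply/difP => c cn; rewrite !ap_slope //; apply: contraNneq cn => e.
set x := inv X c in e; set y := inv X' c in e.
have ex : ap X x = c by rewrite apinv.
have ey : ap X' y = c by rewrite apinv.
have [l1 l2] := Std_lin sH sH'.
have [] := ind3 sH pH pH' sH' npp n' n (x := x) (y := y) (z := x + y).
- by rewrite addqq.
- rewrite l1 addrACA -eX -eX' ex ey addqq //.
- by rewrite l2 addrACA -eY -eY' e addqq.
by move=> x0 _ _; rewrite -ex x0 lin0.
Qed.

Lemma maskP p u : Mem p -> u != 0 -> ap (ap (ap masks u) (ap p.1 u)) (ap p.2 u).
Proof.
move=> [[pH n1 n4] nr] un; have [rH' m1 m4] := rH.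
have [lA lB] := Std_lin sH rH'; have [nA nB] := arc_nz sH rH' m1.
rewrite /masks !ap_mk notinE !inE; set a := ap p.1 u; set b := ap p.2 u.
rewrite !negb_or; apply/and5P; split; last (apply/andP; split).
- by have [_ h] := arc_nz sH pH n1; apply: h.
- by have := ind2B sH pH e4 n4 un; rewrite [(idt, idt).2]/= ap_mk.
- exact: (ind2B sH).
- apply: contraNneq un => e.
  have [] := ind3 sH pH e4 e1 n4 E1_E4 n1 (x := u) (y := a) (z := u + a); rewrite ?addqq //.
  + by rewrite ap_id ap_tz addr0 addqq.
  + by rewrite ap_id ap_tz addr0 -/b e addqq.
  by move=> ->.
- rewrite ap_slope //; apply: contraNneq un => e.
  have [] := ind3 sH pH rH' e1 nr m1 n1 (x := u) (y := inv r.1 a) (z := u + inv r.1 a).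
  + by rewrite addqq.
  + by rewrite apinv // ap_tz addr0 addqq.
  + by rewrite ap_tz addr0 -/b e addqq.
  by move=> ->.
have lA1 := lin_add1 lA; have lB1 := lin_add1 lB; have nA1 := nz_add1 rH' m4.
rewrite ap_slope // ap_add1; set z := inv _ _.
have ez : ap r.1 z + z = a + u by rewrite -ap_add1 apinv.
apply: contraNneq un => e.
have [] := ind3 sH pH rH' e4 nr m4 n4 (x := u) (y := z) (z := u + z).
+ by rewrite addqq.
+ by rewrite ap_id -/a -addrA [u + z]addrC [_ + (z + u)]addrA ez -[a + u + u]addrA addqq addr0 addqq.
+ by rewrite ap_id -/b e qaddE -addrA [ap r.2 z + (u + z)]addrCA addqq.
by move=> ->.
Qed.

Lemma candsP p a : Mem p -> ap p.1 q1 = a ->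
  exists2 l, mem (p.1, l) (ap allcands a) & mem (mkc p.1 p.2) l.
Proof.
move=> mp e; have [[pH n1 n4] nr] := mp; have [lA lB] := Std_lin sH pH.
have mm X Y (f : X -> Y) s x : mem x s -> mem (f x) (map f s).
  by elim: s => //= y s IH [<-|/IH]; [left|right].
set m := mk (fun u => ap (ap masks u) (ap p.1 u)).
exists (map (mkc p.1) (enumlin m)).
  rewrite /allcands ap_mk.
  apply: (mm _ _ (fun A => (A, map (mkc A) (enumlin (mk (fun u => ap (ap masks u) (ap A u))))))).
  apply: enumlinP => // u un; rewrite !ap_mk notinE !inE !negb_or.
  have -> : ap p.1 u != 0 by have [h _] := arc_nz sH pH n1; apply: h.
  have -> : ap p.1 u != u by have := ind2A sH pH e4 n4 un; rewrite [(idt, idt).1]/= ap_mk.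
  have -> /= : ap p.1 u != ap r.1 u by apply: (ind2A sH) => //; case: rH.
  by case: u un => //= _; rewrite e qeqE eqxx.
by apply: mm; apply: enumlinP => // u un; rewrite ap_mk maskP.
Qed.

Lemma surv_mem P p s l : (forall p', mem p' P -> Mem p') -> Mem p ->
  (forall p', mem p' P -> gr p != gr p') ->
  mem (p.1, l) s -> mem (mkc p.1 p.2) l -> mem (celt_of p) (surv (map celt_of P) s).
Proof.
move=> hP mp np ml mc; have [[pH n1 n4] nr] := mp; have [rH' m1 m4] := rH.
have [lA lB] := Std_lin sH pH; have [lA2 lB2] := Std_lin sH rH'.
have cA : compA (map celt_of P) p.1.
  elim: P hP np => //= p' P IH hP np; rewrite IH; last 2 first.
  - by move=> s' ?; apply: hP; right.
  - by move=> s' ?; apply: np; right.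
  have [[pH' _ _] _] := hP p' (or_introl erefl).
  by have /difP-> := ind2A sH pH' pH (contra_neq (@esym _ _ _) (np _ (or_introl erefl))).
have cBc : compB (map celt_of P) (mkc p.1 p.2).
  elim: P hP np {cA} => [//|p' P IH] hP np; cbn [map compB celt_of mkc cB c1 c4 c5]; rewrite IH; last 2 first.
  - by move=> s' ?; apply: hP; right.
  - by move=> s' ?; apply: np; right.
  have [[pH' n1' n4'] nr'] := hP p' (or_introl erefl).
  have npp : gr p' != gr p by rewrite eq_sym; apply: np; left.
  have [lA' lB'] := Std_lin sH pH'.
  have /difP-> := ind2B sH pH' pH npp.
  rewrite (slope_dif e1 pH' pH n1' n1 npp) //; try by move=> u; rewrite ap_mk addr0.
  rewrite (slope_dif e4 pH' pH n4' n4 npp) //; try exact: lin_add1; try by move=> u; rewrite ap_add1 ap_mk.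
  by rewrite (slope_dif rH' pH' pH nr' nr npp) //; try exact: lin_add; move=> u; rewrite ap_add.
have sB l' acc : mem (celt_of p) acc -> mem (celt_of p) (survB (map celt_of P) p.1 l' acc).
  by move=> m; elim: l' => //= c l' IH; case: ifP => _ //; right.
have sB' A l' acc : mem (celt_of p) acc -> mem (celt_of p) (survB (map celt_of P) A l' acc).
  by move=> m; elim: l' => //= c l' IH; case: ifP => _ //; right.
elim: s ml => //= -[A l'] s IH [[<- <-]|/IH m].
  rewrite cA; elim: l mc {IH} => //= c l IH [<-|/IH m]; first by rewrite cBc; left.
  by case: ifP => _ //; right.
by case: ifP => _ //; apply: sB'.
Qed.

Fixpoint pw (P : seq pr) : Prop :=
  if P is p :: P' then (forall p', mem p' P' -> gr p != gr p') /\ pw P' else True.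

Lemma triP P p : (forall p', mem p' P -> Mem p') -> pw P -> Mem p ->
  (forall p', mem p' P -> gr p != gr p') -> tri (map celt_of P) (celt_of p).
Proof.
move=> + + [[pH _ _] _]; elim: P => [//|s P IH] hP [ns pP] np; cbn [map tri].
rewrite (IH (fun p' m => hP p' (or_intror m)) pP (fun p' m => np p' (or_intror m))).
have [[sH' _ _] _] := hP s (or_introl erefl).
have nps : gr p != gr s by apply: np; left.
have hP' p' : mem p' P -> gr p' \in H by move=> m; have [[]] := hP p' (or_intror m).
have np' p' : mem p' P -> gr p != gr p' by move=> m; apply: np; right.
suff -> : tri1 (celt_of s) (map celt_of P) (celt_of p) by [].
have [lA lB] := Std_lin sH sH'; have [lA' lB'] := Std_lin sH pH.
elim: P {IH hP pP np} ns hP' np' => [//|p' P IH] ns hP' np'; cbn [map tri1].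
rewrite (IH (fun p' m => ns p' (or_intror m)) (fun p' m => hP' p' (or_intror m)) (fun p' m => np' p' (or_intror m))).
have pH' : gr p' \in H by apply: hP'; left.
have [lA'' lB''] := Std_lin sH pH'.
rewrite (@slope_dif s p' p) //; try exact: lin_add; try by move=> u; rewrite ap_add.
  by rewrite eq_sym; apply: ns; left.
by rewrite eq_sym; apply: np'; left.
Qed.

(** A member with A q1 = a exists by [cover], and freshness of a separates it from the frame, from r
    and from P; as a genuine member it survives all tests. *)
Lemma next P a : (forall p, mem p P -> Mem p) -> fresh a (map celt_of P) ->
  exists2 p, mem (celt_of p) (surv (map celt_of P) (ap allcands a)) &
    [/\ Mem p, ap p.1 q1 = a & forall p', mem p' P -> gr p != gr p'].
Proof.
move=> hP; rewrite /fresh notinE !inE !negb_or => /and4P[a0 a1 a2 aP].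
have [p pH e] := cover sH a (isT : q1 != 0).
have ne s : ap s.1 q1 != a -> gr p != gr s.
  apply: contraNneq => es; have := grP s q1; rewrite -es inE => /andP[/eqP/= -> _].
  by rewrite e.
have mp : Mem p.
  split; last by apply: ne; rewrite eq_sym.
  by split=> //; apply: ne; rewrite [(_, _).1]/= ap_mk eq_sym.
have nP p' : mem p' P -> gr p != gr p'.
  move=> m; apply: ne; move: aP; apply: contraNneq => <-.
  by elim: (P) m {hP} => //= s P' IH [->|/IH h]; rewrite inE ?eqxx // h orbT.
by have [l ml mc] := candsP mp e; exists p => //; apply: surv_mem ml mc.
Qed.
End Sound.
End Cands.

Section Search.
Variable Concl : {set {set pt}} -> Prop.
Hypothesis ConclI : forall g H, iso g -> Concl (im g H) -> Concl H.
Notation Gvis := (Gvis Concl).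
Notation Good := (Good Concl).

(** By [next] every node has a genuine member among its candidates, so a walk that closes all
    candidates contradicts the existence of H; hence any conclusion. *)
Lemma refuteG r H n P o o' : Std H -> Arc H r -> (forall p, mem p P -> Mem r H p) -> pw P ->
  refute r (allcands r) n (map (celt_of r) P) o = Some o' -> Concl H.
Proof.
move=> sH rH; elim: n P o o' => [//|n IH] P [//|a o] o' hP pP; cbn [refute]; case: ifP => // fa.
have [p mp [Mp _ nP]] := next sH rH hP fa => w.
have mp' := mem_flt mp (triP sH hP pP Mp nP).
have [o1 [o2]] := walkP w mp'; apply: (IH (p :: P)) => [p' /= [->//|]|]; [exact: hP | by split].
Qed.

Definition unpruned (v : vis) (r : pr) (l : seq celt) : seq celt :=
  flt (fun p : celt => if pruned v r (p.1, cB p.2) then false else true) l.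

(** Beyond [E1], [E4], r and the sixth member only 12 graphs remain, so fuel 13 does not cut off a
    search that could close. *)
Definition clschk (v : vis) (B : tb q) (a : q) (o : seq q) : bool :=
  let r := (CC, B) in
  if fresh r a [::] then
  let cs := allcands r in
  if walk (fun p => refute r cs 13 [:: p]) (unpruned v r (surv [::] (ap cs a))) o is Some _
  then true else false else false.

Lemma unprunedP v r H a : Gvis v -> Std H -> Arc H r -> fresh r a [::] ->
  Concl H \/ exists2 p, mem (celt_of r p) (unpruned v r (surv [::] (ap (allcands r) a))) &
    Mem r H p /\ ap p.1 q1 = a.
Proof.
move=> gv sH rH fa; have [p mp [Mp ea _]] := next sH rH (P := [::]) (fun _ => False_ind _) fa.
case e: (pruned v r p).
  by left; case: Mp => pH n; apply: (prunedG ConclI gv e) sH rH pH n.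
by right; exists p => //; apply: mem_flt mp _; rewrite -surjective_pairing e.
Qed.

Lemma clschkG v B a o : Gvis v -> clschk v B a o -> Good (CC, B).
Proof.
move=> gv; rewrite /clschk; case: ifP => // fa.
case w: walk => [o'|//] _ H sH rH.
have [//|[p mp [Mp _]]] := unprunedP gv sH rH fa.
have [o1 [o2 h]] := walkP w mp.
by apply: (refuteG (P := [:: p])) sH rH _ _ h => [p' /= [->|]|].
Qed.

Definition clsstep (v : vis) (k : key) (a : q) (o : seq q) (es : seq ent) : option vis :=
  if clschk v (kt k) a o then chkents (ins v k) es else None.

Lemma clsstepG v k a o es v' : Gvis v -> clsstep v k a o es = Some v' -> Gvis v'.
Proof.
move=> gv; rewrite /clsstep; case: ifP => // /(clschkG gv) g.
by apply: (chkentsG ConclI); apply: Gins.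
Qed.
End Search.

(** * The classes of pairs of maps *)

(* The next definitions only search for certificates; nothing about them is
   proved, since [clsstep] checks whatever they return. *)
Fixpoint best cs (ps : seq celt) (l : seq q) (ba : q) (bs : seq celt) (bn : nat) : q * seq celt :=
  if l is a :: l' then
    if notin a (map (fun p : celt => ap p.1 q1) ps) then
    let s := flt (tri ps) (surv ps (ap cs a)) in let n := size s in
    if n is 0 then (a, [::]) else if (n < bn)%N then best cs ps l' a s n else best cs ps l' ba bs bn
    else best cs ps l' ba bs bn
  else (ba, bs).
Fixpoint orac cs (n : nat) (l : seq q) (ps : seq celt) (acc : seq q) : seq q :=
  if n is n'.+1 then
    let (a, s) := best cs ps (if (size ps < 3)%N then l else drop 3 qs) q0 [::] 1000 in
    a :: fld (fun p acc => orac cs n' l (p :: ps) acc) s acc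
  else acc.
Definition mkorac (v : vis) (k : key) (a : q) (al : seq q) : seq q :=
  let r := (CC, kt k) in
  let ms := masks r in
  let cs := mk (fun b => candsof r ms b) in
  fld (fun p acc => orac cs 12 al [:: p] acc) (unpruned v r (surv [::] (ap cs a))) [::].

Definition words : seq (seq gen) :=
  let ext s := flatten (map (fun w => map (fun g => g :: w) [:: G23; G12; G14; G45]) s) in
  let w1 := ext [:: [::]] in let w2 := ext w1 in [::] :: w1 ++ w2 ++ ext w2.
Fixpoint findx (v : vis) w (p : pr) (xs : seq q) : option (seq gen * q) :=
  if xs is x :: xs' then match nrm x p with
    | Some k => if look v k then Some (w, x) else findx v w p xs' | None => findx v w p xs' end
  else None.
Fixpoint findw v k (ws : seq (seq gen)) : option (seq gen * q) :=
  if ws is w :: ws' then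
    match findx v w (actw w (CC, kt k)) (if w is [::] then behead qs else [:: q1]) with
    | Some c => Some c | None => findw v k ws' end
  else None.
Definition orbit v k : vis * seq ent :=
  fld (fun x (st : vis * seq ent) => let: (v, es) := st in
     match nrm x (CC, kt k) with Some k' => if look v k' then st else
        match findx v [::] (CC, kt k') qs with Some c => (ins v k', (k', c) :: es) | None => st end
     | None => st end)
   (behead qs) (ins v k, [::]).
Fixpoint bfs n (v : vis) (fr : seq key) (es : seq ent) : vis * seq ent :=
  if n is n'.+1 then if fr is k :: fr' then
   let: (v', fr2, es') := fld (fun w (st : vis * seq key * seq ent) => let: (v, fr, es) := st in
      match nrm q1 (actw w (CC, kt k)) with Some k' => if look v k' then st else
        match findw v k' words with Some c =>
          let: (v2, es2) := orbit v k' in (v2, rcons fr k', es2 ++ (k', c) :: es)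
        | None => st end | None => st end) words (v, [::], es) in
   bfs n' v' (fr' ++ fr2) es' else (v, es) else (v, es).
Definition close v k : vis * seq ent :=
  let: (v1, es) := orbit v k in let: (v2, es2) := bfs 500 v1 [:: k] es in (v2, rev es2).

(** Class representatives in the order of treatment. In each step the single element is the value of
    A q1 that selects the sixth member, and the list restricts the branching values that the hint
    search compares near the root. *)
Definition k1 : key := (q10, q7, q6, q2).
Definition o1 := Eval vm_compute in mkorac vis0 k1 q4 [:: q3; q5; q6; q7; q8].
Definition r1 := Eval vm_compute in close vis0 k1.
Definition v1 := Eval vm_compute in r1.1.
Definition s1 := Eval vm_compute in r1.2.
Lemma step1 : clsstep vis0 k1 q4 o1 s1 = Some v1.
Proof. by vm_compute. Qed.

Definition k2 : key := (q8, q13, q10, q4).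
Definition o2 := Eval vm_compute in mkorac v1 k2 q13 [:: q3; q4; q5; q6].
Definition r2 := Eval vm_compute in close v1 k2.
Definition v2 := Eval vm_compute in r2.1.
Definition s2 := Eval vm_compute in r2.2.
Lemma step2 : clsstep v1 k2 q13 o2 s2 = Some v2.
Proof. by vm_compute. Qed.

Definition k3 : key := (q8, q13, q12, q2).
Definition o3 := Eval vm_compute in mkorac v2 k3 q15 [:: q3; q4; q5].
Definition r3 := Eval vm_compute in close v2 k3.
Definition v3 := Eval vm_compute in r3.1.
Definition s3 := Eval vm_compute in r3.2.
Lemma step3 : clsstep v2 k3 q15 o3 s3 = Some v3.
Proof. by vm_compute. Qed.

Definition k4 : key := (q8, q10, q1, q6).
Definition o4 := Eval vm_compute in mkorac v3 k4 q6 [:: q3; q4; q5].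
Definition r4 := Eval vm_compute in close v3 k4.
Definition v4 := Eval vm_compute in r4.1.
Definition s4 := Eval vm_compute in r4.2.
Lemma step4 : clsstep v3 k4 q6 o4 s4 = Some v4.
Proof. by vm_compute. Qed.

Definition k5 : key := (q3, q12, q7, q14).
Definition o5 := Eval vm_compute in mkorac v4 k5 q11 [:: q3; q4].
Definition r5 := Eval vm_compute in close v4 k5.
Definition v5 := Eval vm_compute in r5.1.
Definition s5 := Eval vm_compute in r5.2.
Lemma step5 : clsstep v4 k5 q11 o5 s5 = Some v5.
Proof. by vm_compute. Qed.

Definition k6 : key := (q6, q8, q5, q12).
Definition o6 := Eval vm_compute in mkorac v5 k6 q8 [:: q3; q4].
Definition r6 := Eval vm_compute in close v5 k6.
Definition v6 := Eval vm_compute in r6.1.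
Definition s6 := Eval vm_compute in r6.2.
Lemma step6 : clsstep v5 k6 q8 o6 s6 = Some v6.
Proof. by vm_compute. Qed.

Definition k7 : key := (q11, q1, q9, q13).
Definition o7 := Eval vm_compute in mkorac v6 k7 q14 [:: q3; q4].
Definition r7 := Eval vm_compute in close v6 k7.
Definition v7 := Eval vm_compute in r7.1.
Definition s7 := Eval vm_compute in r7.2.
Lemma step7 : clsstep v6 k7 q14 o7 s7 = Some v7.
Proof. by vm_compute. Qed.

Definition k8 : key := (q9, q7, q2, q4).
Definition o8 := Eval vm_compute in mkorac v7 k8 q14 [:: q3; q4].
Definition r8 := Eval vm_compute in close v7 k8.
Definition v8 := Eval vm_compute in r8.1.
Definition s8 := Eval vm_compute in r8.2.
Lemma step8 : clsstep v7 k8 q14 o8 s8 = Some v8.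
Proof. by vm_compute. Qed.

Definition k9 : key := (q5, q15, q7, q14).
Definition o9 := Eval vm_compute in mkorac v8 k9 q11 [:: q3; q4].
Definition r9 := Eval vm_compute in close v8 k9.
Definition v9 := Eval vm_compute in r9.1.
Definition s9 := Eval vm_compute in r9.2.
Lemma step9 : clsstep v8 k9 q11 o9 s9 = Some v9.
Proof. by vm_compute. Qed.

Definition k10 : key := (q15, q7, q14, q4).
Definition o10 := Eval vm_compute in mkorac v9 k10 q13 [:: q3; q4].
Definition r10 := Eval vm_compute in close v9 k10.
Definition v10 := Eval vm_compute in r10.1.
Definition s10 := Eval vm_compute in r10.2.
Lemma step10 : clsstep v9 k10 q13 o10 s10 = Some v10.
Proof. by vm_compute. Qed.

Definition k11 : key := (q12, q5, q11, q6).
Definition o11 := Eval vm_compute in mkorac v10 k11 q10 [:: q3; q4].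
Definition r11 := Eval vm_compute in close v10 k11.
Definition v11 := Eval vm_compute in r11.1.
Definition s11 := Eval vm_compute in r11.2.
Lemma step11 : clsstep v10 k11 q10 o11 s11 = Some v11.
Proof. by vm_compute. Qed.

Definition k12 : key := (q3, q7, q12, q14).
Definition o12 := Eval vm_compute in mkorac v11 k12 q6 [:: q3; q4].
Definition r12 := Eval vm_compute in close v11 k12.
Definition v12 := Eval vm_compute in r12.1.
Definition s12 := Eval vm_compute in r12.2.
Lemma step12 : clsstep v11 k12 q6 o12 s12 = Some v12.
Proof. by vm_compute. Qed.

Definition k13 : key := (q8, q10, q15, q6).
Definition o13 := Eval vm_compute in mkorac v12 k13 q11 [:: q3; q4].
Definition r13 := Eval vm_compute in close v12 k13.
Definition v13 := Eval vm_compute in r13.1.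
Definition s13 := Eval vm_compute in r13.2.
Lemma step13 : clsstep v12 k13 q11 o13 s13 = Some v13.
Proof. by vm_compute. Qed.

Definition k14 : key := (q13, q1, q9, q15).
Definition o14 := Eval vm_compute in mkorac v13 k14 q5 [:: q3; q4].
Definition r14 := Eval vm_compute in close v13 k14.
Definition v14 := Eval vm_compute in r14.1.
Definition s14 := Eval vm_compute in r14.2.
Lemma step14 : clsstep v13 k14 q5 o14 s14 = Some v14.
Proof. by vm_compute. Qed.

Definition k15 : key := (q12, q3, q13, q7).
Definition o15 := Eval vm_compute in mkorac v14 k15 q6 [:: q3; q4].
Definition r15 := Eval vm_compute in close v14 k15.
Definition v15 := Eval vm_compute in r15.1.
Definition s15 := Eval vm_compute in r15.2.
Lemma step15 : clsstep v14 k15 q6 o15 s15 = Some v15.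
Proof. by vm_compute. Qed.

(** * The field structure *)

(** This makes [q] the field GF(2)[X]/(X^4+X+1) with X = [q2], so that [CC] is multiplication by
    [q2]; row c is determined by c, c X, c X^2, c X^3. *)
Definition MT : tb (tb q) := Eval vm_compute in
  mk (fun c => tl c (ap CC c) (ap CC (ap CC c)) (ap CC (ap CC (ap CC c)))).
Definition qmul (x y : q) : q := ap (ap MT x) y.

Lemma qmulA : associative qmul.
Proof.
move=> x y z; apply/eqP; rewrite -qeqE; move: z; apply: allqP; move: y; apply: allqP; move: x; apply: allqP.
by vm_compute.
Qed.
Lemma qmulC : commutative qmul.
Proof. by case; case. Qed.
Lemma qmul1 : left_id q1 qmul.
Proof. by case. Qed.
Lemma qmulDl : left_distributive qmul +%R.
Proof.
move=> x y z; apply/eqP; rewrite -qeqE; move: z; apply: allqP; move: y; apply: allqP; move: x; apply: allqP.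
by vm_compute.
Qed.
HB.instance Definition _ := GRing.Zmodule_isComNzRing.Build q qmulA qmulC qmul1 qmulDl isT.

Lemma qmulE (x y : q) : qmul x y = x * y. Proof. by []. Qed.
Lemma apMT (c x : q) : ap (ap MT c) x = c * x. Proof. by []. Qed.
Lemma lin_MT c : lin (ap MT c). Proof. by move=> x y; rewrite !apMT mulrDr. Qed.
Lemma qmul_eq0 (x y : q) : (x * y == 0) = (x == 0) || (y == 0).
Proof. by case: x; case: y. Qed.
Lemma nz_MT c : c != 0 -> forall u, u != 0 -> ap (ap MT c) u != 0.
Proof. by move=> cn u un; rewrite apMT qmul_eq0 negb_or cn un. Qed.

Definition qdiv (x y : q) : q := inv (ap MT y) x.
Lemma qdivK (x y : q) : y != 0 -> y * qdiv x y = x.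
Proof. by move=> yn; rewrite -apMT /qdiv apinv //; [apply: lin_MT | apply: nz_MT]. Qed.
Lemma qmulI (x y z : q) : x != 0 -> x * y = x * z -> y = z.
Proof. by move=> xn; rewrite -!apMT => /(ap_inj (lin_MT x) (nz_MT xn)). Qed.

Definition gm (c d : q) : pr := (ap MT c, ap MT d).
Definition line (w : pt) : {set pt} := [set (x * w.1.1, x * w.1.2, x * w.2) | x : q].
(** The points (0,1,0), (0,0,1) and (1, c, f(c)): the usual form of a hyperoval given by an
    o-polynomial f. *)
Definition std (f : tb q) : {set {set pt}} :=
  [set E2; E3] :|: [set gr (gm c (ap f c)) | c : q].

Lemma lineP w v : reflect (exists x, v = (x * w.1.1, x * w.1.2, x * w.2)) (v \in line w).
Proof. by apply: (iffP imsetP) => [[x _ ->]|[x ->]]; exists x. Qed.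
Lemma line_gr c d : gr (gm c d) = line (1, c, d).
Proof.
apply/setP => -[[x y] z]; rewrite inE /= !apMT; apply/andP/lineP => [[/eqP-> /eqP->]|[u []]].
  by exists x; rewrite /= mulr1 ![x * _]mulrC.
by rewrite mulr1 => -> -> ->; rewrite ![u * _]mulrC !eqxx.
Qed.
Lemma line_E2 : E2 = line (0, 1, 0).
Proof.
apply/setP => -[[x y] z]; rewrite inE /=; apply/andP/lineP => [[/eqP-> /eqP->]|[u []]] /=.
  by exists y; rewrite !mulr0 mulr1.
by rewrite !mulr0 => -> _ ->; rewrite !eqxx.
Qed.
Lemma line_E3 : E3 = line (0, 0, 1).
Proof.
apply/setP => -[[x y] z]; rewrite inE /=; apply/andP/lineP => [[/eqP-> /eqP->]|[u []]] /=.
  by exists z; rewrite !mulr0 mulr1.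
by rewrite !mulr0 => -> -> _; rewrite !eqxx.
Qed.
Lemma lineS (s x y z : q) : s != 0 -> line (s * x, s * y, s * z) = line (x, y, z).
Proof.
move=> sn; apply/setP => v; apply/lineP/lineP => -[u ->] /=.
  by exists (u * s); rewrite /= !mulrA.
by exists (qdiv u s); rewrite /= !mulrA ![qdiv _ _ * _]mulrC qdivK.
Qed.

Definition frob (k : nat) (x : q) : q := iter k (fun y => qmul y y) x.
Lemma frobD k x y : frob k (x + y) = frob k x + frob k y.
Proof.
elim: k => //= k ->; rewrite !qmulE.
by rewrite !mulrDl !mulrDr [frob k y * frob k x]mulrC addrACA -addrA [in X in _ + X]addrA addqq add0r.
Qed.
Lemma frobM k x y : frob k (x * y) = frob k x * frob k y.
Proof. by elim: k => //= k ->; rewrite !qmulE mulrACA. Qed.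
Lemma frob_inj k : injective (frob k).
Proof.
elim: k => [x y //|k IH x y e]; apply: IH; apply/eqP; rewrite -addq_eq0 -frobD.
by have /eqP := frobD k.+1 x y; rewrite e addqq /= qmulE qmul_eq0 orbb.
Qed.

Definition mat := (pt * pt * pt)%type.
Definition apM (M : mat) (w : pt) : pt :=
  let: (m1, m2, m3) := M in let: (x, y, z) := w in
  let: (a1, b1, c1) := m1 in let: (a2, b2, c2) := m2 in let: (a3, b3, c3) := m3 in
  (qadd (qmul x a1) (qadd (qmul y a2) (qmul z a3)),
   qadd (qmul x b1) (qadd (qmul y b2) (qmul z b3)),
   qadd (qmul x c1) (qadd (qmul y c2) (qmul z c3))).
Definition detM (M : mat) : q :=
  let: ((a1, b1, c1), (a2, b2, c2), (a3, b3, c3)) := M in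
  qadd (qmul a1 (qadd (qmul b2 c3) (qmul b3 c2)))
  (qadd (qmul a2 (qadd (qmul b1 c3) (qmul b3 c1))) (qmul a3 (qadd (qmul b1 c2) (qmul b2 c1)))).
Definition frobp k (w : pt) : pt := let: (x, y, z) := w in (frob k x, frob k y, frob k z).
Definition gmap k M (w : pt) : pt := apM M (frobp k w).

Lemma iso_gmap k M : detM M != 0 -> iso (gmap k M).
Proof.
case: M => [[[[a1 b1] c1] [[a2 b2] c2]] [[a3 b3] c3]] dn.
have f0 : frob k 0 = 0 by apply: (addrI (frob k 0)); rewrite -frobD !addr0.
have ad : additive_map (gmap k ((a1, b1, c1), (a2, b2, c2), (a3, b3, c3))).
  move=> [[x y] z] [[x' y'] z']; rewrite /gmap /= !frobD !qmulE !qaddE.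
  by congr (_, _, _); rewrite /=; ring.
split=> // v w e; apply: addp_eq0; have := ad v w; rewrite e addpp {e}.
case: (v + w) => [[x y] z] []; rewrite !qmulE !qaddE.
set X := frob k x; set Y := frob k y; set Z := frob k z => ea eb ec.
(* This is [detM], with signs that are the identity on [q]; they let [ring] verify the identities of
   Cramer's rule without knowing the characteristic. *)
pose d := a1 * (b2 * c3 - b3 * c2) + (- a2 * (b1 * c3 - b3 * c1) + a3 * (b1 * c2 - b2 * c1)).
have D t : d * t = 0 -> t = 0 by move/eqP; rewrite qmul_eq0 (negbTE dn) => /eqP.
have hX : X = 0.
  apply: D; transitivity ((X * a1 + (Y * a2 + Z * a3)) * (b2 * c3 - b3 * c2)
    - (X * b1 + (Y * b2 + Z * b3)) * (a2 * c3 - a3 * c2)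
    + (X * c1 + (Y * c2 + Z * c3)) * (a2 * b3 - a3 * b2)); first by rewrite /d; ring.
  by rewrite ea eb ec !mul0r subr0 addr0.
have hY : Y = 0.
  apply: D; transitivity (- (X * a1 + (Y * a2 + Z * a3)) * (b1 * c3 - b3 * c1)
    + (X * b1 + (Y * b2 + Z * b3)) * (a1 * c3 - a3 * c1)
    - (X * c1 + (Y * c2 + Z * c3)) * (a1 * b3 - a3 * b1)); first by rewrite /d; ring.
  by rewrite ea eb ec oppr0 !mul0r subr0 addr0.
have hZ : Z = 0.
  apply: D; transitivity ((X * a1 + (Y * a2 + Z * a3)) * (b1 * c2 - b2 * c1)
    - (X * b1 + (Y * b2 + Z * b3)) * (a1 * c2 - a2 * c1)
    + (X * c1 + (Y * c2 + Z * c3)) * (a1 * b2 - a2 * b1)); first by rewrite /d; ring.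
  by rewrite ea eb ec !mul0r subr0 addr0.
by rewrite (frob_inj (etrans hX (esym f0))) (frob_inj (etrans hY (esym f0))) (frob_inj (etrans hZ (esym f0))).
Qed.

Lemma gmapZ k M s x y z : gmap k M (s * x, s * y, s * z) =
  let: (a, b, c) := gmap k M (x, y, z) in (frob k s * a, frob k s * b, frob k s * c).
Proof.
case: M => [[[[a1 b1] c1] [[a2 b2] c2]] [[a3 b3] c3]].
by rewrite /gmap /= !qmulE !qaddE !frobM; congr (_, _, _); rewrite /=; ring.
Qed.

Lemma gmap_line k M w : detM M != 0 -> gmap k M @: line w = line (gmap k M w).
Proof.
case: w => [[x y] z] dn; apply/setP => v.
have fs : forall t, exists s, frob k s = t.
  by move=> t; have [h _ hk] := injF_bij (@frob_inj k); exists (h t).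
apply/imsetP/lineP => [[_ /lineP[s ->] ->]|[t ->]].
  by rewrite gmapZ; case: (gmap k M (x, y, z)) => [[a b] c]; exists (frob k s).
have [s <-] := fs t; exists (s * x, s * y, s * z); first by apply/lineP; exists s.
by rewrite gmapZ; case: (gmap k M (x, y, z)) => [[a b] c].
Qed.

Definition instd (f : tb q) (w : pt) : bool :=
  let: (x, y, z) := w in
  if qeq x q0 then if qeq z q0 then true else qeq y q0 else qeq z (qmul x (ap f (qdiv y x))).

Lemma instdP f w : w != 0 -> instd f w -> line w \in std f.
Proof.
case: w => [[x y] z] wn; rewrite /instd !qeqE q0E; case: eqP => [x0|/eqP xn].
  rewrite x0 in wn *; case: eqP => [z0 _|/eqP zn /eqP y0].
    have yn : y != 0 by apply: contraNneq wn => y0; rewrite z0 y0.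
    have -> : line (0, y, z) = E2 by rewrite line_E2 -(lineS 0 1 0 yn) !mulr0 mulr1 z0.
    by rewrite !inE eqxx.
  have -> : line (0, y, z) = E3 by rewrite line_E3 -(lineS 0 0 1 zn) !mulr0 mulr1 y0.
  by rewrite !inE eqxx orbT.
move=> /eqP ez; rewrite inE; apply/orP; right; apply/imsetP; exists (qdiv y x) => //.
by rewrite line_gr -(lineS 1 (qdiv y x) (ap f (qdiv y x)) xn) mulr1 qdivK // ez.
Qed.

Fixpoint alls {X} (P : X -> bool) (s : seq X) : bool :=
  if s is x :: s' then if P x then alls P s' else false else true.
Lemma allsP X (P : X -> bool) s x : alls P s -> mem x s -> P x.
Proof. by elim: s => //= y s IH; case: ifP => // py /IH h [->//|]. Qed.

Definition chkmap f k M (L : seq pt) : bool :=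
  if qeq (detM M) q0 then false else alls (fun w => instd f (gmap k M w)) L.

Lemma chkmapP f k M L w : w != 0 -> chkmap f k M L -> mem w L -> gmap k M @: line w \in std f.
Proof.
rewrite /chkmap; case: qeqP => // /eqP dn wn c m; have ig := iso_gmap k dn.
rewrite gmap_line //; apply: instdP (allsP c m).
by apply: contraNneq wn => e; apply/eqP; apply: ig.2; rewrite e iso0.
Qed.

Lemma card_std f : (#|std f| <= 18)%N.
Proof.
rewrite (leq_trans (leq_card_setU _ _)) // (@leq_add _ _ 2 16) //.
  by rewrite cards2 ltnS leq_b1.
by rewrite (leq_trans (leq_imset_card _ _)) // card_q.
Qed.

(** The image has 18 members and lies in [std f], which has at most 18, so checking membership of
    each image point already gives equality. *)
Lemma chkmap_im f k M L H : hyp 18 H -> chkmap f k M L ->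
  (forall E, E \in H -> exists w, [/\ w != 0, mem w L & E = line w]) ->
  iso (gmap k M) /\ im (gmap k M) H = std f.
Proof.
move=> hH c hL; have ig : iso (gmap k M).
  by move: c; rewrite /chkmap; case: qeqP => // /eqP dn _; apply: iso_gmap.
split=> //; have [cH _ _] := hyp_im ig hH.
apply/eqP; rewrite eqEcard cH card_std andbT; apply/subsetP => _ /imsetP[E /hL[w [wn m ->]] ->].
exact: chkmapP c m.
Qed.

(** The regular hyperoval: the conic y^2 = x z together with its nucleus (0,1,0), which is [E2]. *)
Definition freg : tb q := Eval vm_compute in mk (fun t => qmul t t).
Definition Concl (H : {set {set pt}}) (fls : tb q) :=
  exists g, iso g /\ (im g H = std freg \/ im g H = std fls).

Lemma ConclI fls g H : iso g -> Concl (im g H) fls -> Concl H fls.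
Proof.
move=> ig [h [ih e]]; exists (h \o g); split; first exact: iso_comp.
by rewrite -im_comp.
Qed.

(** * Exhaustive extension of an elementary 5-arc *)

Definition teq (s t : tb q) : bool := allq (fun u => qeq (ap s u) (ap t u)) qs.
Lemma teqP s t : teq s t -> s = t.
Proof. by move/allqP => h; apply: eq_tb => u; apply/eqP; apply: h. Qed.

Definition elem (a : q) (p : celt) : bool :=
  if teq p.1 (ap MT a) then teq (cB p.2) (ap MT (ap (cB p.2) q1)) else false.
(** Sorts the candidates with A q1 = a: pairs of multiplications contribute d = B q1, and every
    other candidate must be refuted. *)
Fixpoint elts r cs (a : q) (s : seq celt) (o : seq q) : option (seq q) :=
  if s is p :: s' then
    if elem a p then
      if elts r cs a s' o is Some l then Some (ap (cB p.2) q1 :: l) else None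
    else if refute r cs 13 [:: p] o is Some o' then elts r cs a s' o' else None
  else Some [::].

Lemma eltsP r cs a s o l p : elts r cs a s o = Some l -> mem p s ->
  (exists2 d, mem d l & (p.1, cB p.2) = gm a d) \/
  exists o1 o2, refute r cs 13 [:: p] o1 = Some o2.
Proof.
elim: s l o => [//|p' s IH] l o; cbn [elts mem].
case: ifP => [|_].
  rewrite /elem; case: ifP => // /teqP eA /teqP eB; case e: elts => [l'|//] [<-] [->|m].
    by left; exists (ap (cB p'.2) q1); [left | congr (_, _)].
  by have [[d]|] := IH _ _ e m; [left; exists d => //; right | right].
by case e': refute => [o'|//] e [->|/(IH _ _ e)//]; right; exists o, o'.
Qed.

(** Slopes of the lines joining (a, d) to the chosen affine points; a repeated slope means three
    collinear points. *)
Definition sls (ps : seq (q * q)) (a d : q) : seq q :=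
  map (fun p : q * q => qdiv (qadd d p.2) (qadd a p.1)) ps.
Fixpoint uniqq (s : seq q) : bool :=
  if s is x :: s' then if notin x s' then uniqq s' else false else true.
Definition cert := (bool * nat * mat)%type.
Definition ptsof (ps : seq (q * q)) : seq pt :=
  (q0, q1, q0) :: (q0, q0, q1) :: map (fun p : q * q => (q1, p.1, p.2)) ps.
Definition ident fls (c : cert) (ps : seq (q * q)) : bool :=
  let: (b, k, M) := c in chkmap (if b then freg else fls) k M (ptsof ps).
(** Each level fixes the point of H with first affine coordinate a. At a leaf all 18 points are
    known, and the next certificate must carry them to a standard hyperoval. *)
Fixpoint dfs fls (ls : tb (option (seq q))) (al : seq q) (ps : seq (q * q)) (o : seq cert) :
    option (seq cert) :=
  if al is a :: al' then
    if ap ls a is Some l then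
      walk (fun d => dfs fls ls al' ((a, d) :: ps)) (flt (fun d => uniqq (sls ps a d)) l) o
    else None
  else if o is c :: o' then if ident fls c ps then Some o' else None else None.
Definition elchk fls (v : vis) (b : q) (os : tb (seq q)) (o : seq cert) : bool :=
  let r := gm q2 b in let cs := allcands r in
  let ls := mk (fun a => if fresh r a [::] then 
    elts r cs a (unpruned v r (surv [::] (ap cs a))) (ap os a) else None) in
  if dfs fls ls (drop 3 qs) [:: (q2, b); (q1, q1); (q0, q0)] o is Some _ then true else false.

Section Sound.
Variables (fls : tb q) (H : {set {set pt}}) (sH : Std H).

Lemma ap_gm1 a d : ap (gm a d).1 q1 = a.
Proof. by rewrite apMT mulr1. Qed.

Lemma slopes_neq a d c e c' e' : gr (gm a d) \in H -> gr (gm c e) \in H -> gr (gm c' e') \in H ->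
  a != c -> c != c' -> a != c' -> qdiv (d + e) (a + c) != qdiv (d + e') (a + c').
Proof.
move=> h1 h2 h3 n1 n2 n3.
have ne x y x' y' : x != x' -> gr (gm x y) != gr (gm x' y').
  apply: contraNneq => e0; have : ap (gm x y).1 q1 = ap (gm x' y').1 q1.
    by have := grP (gm x y) q1; rewrite e0 inE => /andP[/eqP].
  by rewrite !ap_gm1 => ->.
have z1 : a + c != 0 by rewrite addq_eq0.
have z2 : a + c' != 0 by rewrite addq_eq0.
apply/eqP => es; set s := qdiv (d + e) (a + c) in es.
have k1 : (a + c) * s = d + e by rewrite qdivK.
have k2 : (a + c') * s = d + e' by rewrite es qdivK.
have two (t : q) : t *+ 2 = 0 by rewrite mulr2n addqq.
(* These are the coefficients of the dependency between three collinear affine points. [ring] does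
   not know the characteristic, so the surplus multiples of 2 are added through [two]. *)
have [] := ind3 sH h1 h2 h3 (ne _ _ _ _ n1) (ne _ _ _ _ n2) (ne _ _ _ _ n3)
  (x := c + c') (y := a + c') (z := a + c).
- by rewrite -(two (a + c + c')); ring.
- by rewrite !apMT -(two (a * c + a * c' + c * c')); ring.
- rewrite !apMT; transitivity ((a + c') * (d + e) + (a + c) * (d + e')).
    by rewrite -[LHS]addr0 -(two (a * d)); ring.
  by rewrite -k1 -k2 mulrCA addqq.
by move=> _ e0; rewrite e0 eqxx in z2.
Qed.

Lemma uniqq_slopes ps a d : gr (gm a d) \in H -> (forall p, mem p ps -> gr (gm p.1 p.2) \in H) ->
  uniq (a :: map fst ps) -> uniqq (sls ps a d).
Proof.
move=> ha; elim: ps => [//|[c e] ps IH] hps; rewrite /= inE negb_or -andbA => /and4P[nac na nc u].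
rewrite -/(sls ps a d) IH /=; [|by move=> p m; apply: hps; right|by rewrite /= na].
suff -> : notin (qdiv (qadd d e) (qadd a c)) (sls ps a d) by [].
rewrite notinE; apply/negP; elim: ps {IH u} hps na nc => [//|[c' e'] ps IH] hps.
rewrite /= !inE !negb_or => /andP[n1 na] /andP[n2 nc] /orP[|].
  by apply/negP; apply: slopes_neq => //; [apply: (hps (c, e)); left|apply: (hps (c', e')); right; left].
by apply: IH => // p /= [->|m]; apply: hps; [left | right; right].
Qed.

Lemma dfsG ls al ps o o' : dfs fls ls al ps o = Some o' ->
  (forall p, mem p ps -> gr (gm p.1 p.2) \in H) -> uniq (map fst ps ++ al) ->
  (size ps + size al = 16)%N ->
  (forall a l, a \in al -> ap ls a = Some l -> exists2 d, mem d l & gr (gm a d) \in H) ->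
  Concl H fls.
Proof.
elim: al ps o o' => [|a al IH] ps o o'.
  case: o => // -[[b k] M] o /=; case: ifP => // c _ hps; rewrite cats0 addn0 => u sz _.
  have sub : {subset map fst ps <= enum {: q}} by move=> y _; rewrite mem_enum.
  have le : (size (enum {: q}) <= size (map fst ps))%N by rewrite -cardE card_q size_map sz.
  have [_ eqi] := uniq_min_size u sub le.
  (* The 16 distinct first coordinates exhaust [q], so each graph in H agrees at [q1] with a chosen
     point and equals it by [ind2A]. *)
  have full x : x \in map fst ps by rewrite eqi mem_enum.
  suff hL E : E \in H -> exists w, [/\ w != 0, mem w (ptsof ps) & E = line w].
    have [hH _ _ _ _] := sH; have [ig e] := chkmap_im hH c hL.
    by exists (gmap k M); split=> //; case: (b) e => e; [left|right].
  move=> EH; case: (eqVneq E E2) => [->|n2]; first by exists (0, 1, 0); split=> //; [left | exact: line_E2].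
  case: (eqVneq E E3) => [->|n3]; first by exists (0, 0, 1); split=> //; [right; left | exact: line_E3].
  have [p eE] := graphP sH EH n2 n3; rewrite eE in EH *.
  have /mapP[[x y] xy ex] := full (ap p.1 q1).
  have mxy : mem (x, y) ps by elim: (ps) xy => //= z s IHs; rewrite inE => /orP[/eqP->|/IHs]; [left|right].
  have e : gr p = gr (gm x y).
    apply/eqP; apply: contraT => n; have := ind2A sH EH (hps _ mxy) n (isT : q1 != 0).
    by rewrite ap_gm1 ex eqxx.
  exists (1, x, y); split=> //; last by rewrite e line_gr.
  right; right; elim: (ps) mxy => //= z s IHs [<-|/IHs]; by [left | right].
move=> /=; case e: (ap ls a) => [l|//] w hps u sz hls.
have [d dl dH] := hls a l (mem_head _ _) e.
have ua : uniq (a :: map fst ps) by move: u; rewrite -cat_rcons cat_uniq rcons_uniq => /and3P[].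
have [o1 [o2 h]] := walkP w (mem_flt dl (uniqq_slopes dH hps ua)).
apply: (IH _ _ _ h).
- by move=> p /= [->|]; [|exact: hps].
- by have := u; rewrite -cat1s uniq_catCA.
- by rewrite /= addSn -addnS.
by move=> a' l' ia; apply: hls; rewrite inE ia orbT.
Qed.
End Sound.

Lemma elchkG fls v b os o : Gvis (Concl^~ fls) v -> elchk fls v b os o ->
  Good (Concl^~ fls) (gm q2 b).
Proof.
move=> gv; rewrite /elchk; set ls := mk _; case e: dfs => [o'|//] _ H sH rH.
have cI g H' : iso g -> Concl (im g H') fls -> Concl H' fls by exact: ConclI.
(* Either the member with some value a at [q1] settles H by pruning or refutation, or each value a
   is taken by an elementary member. *)
have [//|nC] : Concl H fls \/ forall a l, a \in drop 3 qs -> ap ls a = Some l ->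
    exists2 d, mem d l & gr (gm a d) \in H.
  have h a l : ap ls a = Some l -> Concl H fls \/ exists2 d, mem d l & gr (gm a d) \in H.
    rewrite /ls ap_mk; case: ifP => // fa el.
    have [?|[p mp [Mp ea]]] := unprunedP cI gv sH rH fa; first by left.
    have [[d dl]|[o1 [o2 h]]] := eltsP el mp.
      rewrite -surjective_pairing => ep; right; exists d => //.
      by rewrite -ep; case: Mp => -[].
    by left; apply: (@refuteG (Concl^~ fls) _ _ _ [:: p] _ _ sH rH _ _ h) => [p' /= [->|]|].
  elim: (drop 3 qs) => [|a al IH]; first by right.
  case: IH => [|IH]; first by left.
  case el: (ap ls a) => [l|].
    case: (h _ _ el) => [|hd]; [by left | right => a' l'].
    by rewrite inE => /orP[/eqP->|]; [rewrite el => -[<-] | exact: IH].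
  by right=> a' l'; rewrite inE => /orP[/eqP->|]; [rewrite el | exact: IH].
apply: (dfsG sH e) => //.
move=> p /= [->|[->|[->|//]]]; first by case: rH.
  by have [_ _ _ _] := sH.
by have [_ + _ _ _] := sH.
Qed.

(** * Spread sets *)

Section Spread.
Variable Concl : {set {set pt}} -> Prop.
Hypothesis ConclI : forall g H, iso g -> Concl (im g H) -> Concl H.

Definition tkey (t : tb q) : key := (ap t q1, ap t q2, ap t q4, ap t q8).
Definition FK : tb (tb bool) := mk (fun u => mk (fun v => notin v [:: q0; u; ap CC u])).
(** Every B that can accompany [CC] passes the mask [FK], so once all these keys are settled, every
    5-arc with irreducible first map is settled. *)
Definition allkeys v : bool := alls (fun t => look v (tkey t)) (enumlin FK).

Lemma allkeysP v t : allkeys v -> mem t (enumlin FK) -> look v (tkey t).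
Proof. by rewrite /allkeys; move: (enumlin FK) => s; apply: allsP. Qed.

Lemma allkeysG v B : Gvis Concl v -> allkeys v -> Good Concl (CC, B).
Proof.
move=> gv av H sH pH; have [bH n1 n4] := pH; have [_ lB] := Std_lin sH bH.
have [_ e1 _ _ e4] := sH.
suff m : mem B (enumlin FK).
  by move/(allkeysP av)/gv: m; rewrite /kt /tkey -lin_tlE //; apply.
apply: enumlinP => // u un; rewrite !ap_mk notinE !inE !negb_or.
have -> : ap B u != 0 by have [_ h] := arc_nz sH bH n1; apply: h.
have -> : ap B u != u by have := ind2B sH bH e4 n4 un; rewrite [(idt, idt).2]/= ap_mk.
apply: contraNneq un => e.
have [] := ind3 sH bH e4 e1 n4 E1_E4 n1 (x := u) (y := ap B u) (z := u + ap B u).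
- by rewrite addqq.
- by rewrite ap_id ap_tz addr0 -e addqq.
- by rewrite ap_id ap_tz addr0 addqq.
by move=> ->.
Qed.

(** Success of [nrm] depends on the first map alone, as [irrP] shows, so [idt] can represent any
    second map. *)
Definition irr (A : tb q) : bool := isSome (nrm q1 (A, idt)).

Lemma irrP A B : irr A -> exists k, nrm q1 (A, B) = Some k.
Proof.
rewrite /irr /nrm /nrm1 /keyv /sw12 /sw14; cbn [fst snd]; cbv zeta.
do ?[case: ifP => _]; rewrite //; by eexists.
Qed.

Hypothesis CG : forall B, Good Concl (CC, B).

Lemma irrG p : irr p.1 -> Good Concl p.
Proof.
by case: p => A B /(irrP B)[k e]; apply: (nrmG ConclI e); apply: CG.
Qed.

Definition FD (a : q) : tb (tb bool) := mk (fun u => mk (fun v =>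
  if notin v [:: q0; u] then match u with q1 => qeq v a | _ => true end else false)).
(** Rescaling by the member of A', directly or after exchanging [E1] and [E4], produces the first
    maps A'^-1 A and (A'+1)^-1 (A+1); either being irreducible would lead to a settled 5-arc. *)
Definition pok (A' A : tb q) : bool :=
  if dif A' A then if irr (tcmp A (tinv A')) then false else
    if irr (tcmp (tadd1 A) (tinv (tadd1 A'))) then false else true
  else false.
Definition okall (ps : seq (tb q)) (A : tb q) : bool :=
  if irr A then false else alls (fun A' => pok A' A) ps.
Fixpoint refA (n : nat) (ps : seq (tb q)) (o : seq q) : option (seq q) :=
  if n is n'.+1 then if o is a :: o' then
    if notin a [:: q0, q1 & map (fun t => ap t q1) ps] then
      walk (fun A => refA n' (A :: ps)) (flt (okall ps) (enumlin (FD a))) o'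
    else None else None else None.

Lemma derP H p : Std H -> Arc H p -> mem p.1 (enumlin (FD (ap p.1 q1))).
Proof.
move=> sH [pH n1 n4]; have [l _] := Std_lin sH pH; have [_ _ _ _ e4] := sH.
apply: enumlinP => // u un; rewrite !ap_mk notinE !inE !negb_or.
have -> : ap p.1 u != 0 by have [h _] := arc_nz sH pH n1; apply: h.
have -> : ap p.1 u != u by have := ind2A sH pH e4 n4 un; rewrite [(idt, idt).1]/= ap_mk.
by case: u un => //= _; rewrite qeqE eqxx.
Qed.

Lemma gr_neq (p s : pr) : ap p.1 q1 != ap s.1 q1 -> gr p != gr s.
Proof.
apply: contraNneq => e; have := grP p q1; rewrite e inE => /andP[/eqP/= h _].
by apply/eqP.
Qed.

Lemma refAG H n P o o' : Std H -> (forall p, mem p P -> Arc H p) ->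
  refA n (map fst P) o = Some o' -> Concl H.
Proof.
move=> sH; elim: n P o o' => [//|n IH] P [//|a o] o' hP; cbn [refA].
case: ifP => //; rewrite notinE !inE !negb_or => /and3P[a0 a1 aP] w.
have [p pH e] := cover sH a (isT : q1 != 0).
have pA : Arc H p by split=> //; apply: gr_neq; rewrite e ap_mk.
have nP p' : mem p' P -> gr p != gr p'.
  move=> m; apply: gr_neq; rewrite e; move: aP; apply: contraNneq => ->.
  by elim: (P) m {hP w} => //= s P' IHs [->|/IHs h]; rewrite inE ?eqxx // h orbT.
case ir: (irr p.1); first exact: (irrG ir).
have [//|ok] : Concl H \/ okall (map fst P) p.1.
  rewrite /okall ir; elim: P hP nP {aP w} => [|p' P IHP] hP nP; first by right.
  have p'A : Arc H p' by apply: hP; left.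
  have np : gr p != gr p' by apply: nP; left.
  case: IHP => [p'' m|p'' m||al]; [by apply: hP; right|by apply: nP; right|by left|].
  suff [|pk] : Concl H \/ pok p'.1 p.1; [by left | by right; cbn [map alls]; rewrite al pk |].
  rewrite /pok; have /difP-> : forall u, u != 0 -> ap p'.1 u != ap p.1 u.
    by apply: (ind2A sH) => //; [case: p'A | rewrite eq_sym].
  case i1: (irr (tcmp _ _)).
    by left; exact: (Two_scl ConclI (@irrG (scl p' p) i1) sH p'A pA np).
  case i2: (irr (tcmp _ _)); last by right.
  have t : Two Concl (sw14 p') (sw14 p) by apply: (Two_scl ConclI); apply: irrG.
  by left; exact: (Two_mv ConclI mv_sw14 t sH p'A pA np).
have m : mem p.1 (flt (okall (map fst P)) (enumlin (FD a))).
  by apply: mem_flt => //; rewrite -e; apply: derP sH pA.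
have [o1 [o2]] := walkP w m; apply: (IH (p :: P)) => p' /= [->//|]; exact: hP.
Qed.

Definition conjT (T A X : tb q) : bool :=
  if nz T then alls (fun w => qeq (ap A (ap T w)) (ap T (ap X w))) [:: q1; q2; q4; q8] else false.

Lemma conjTG T A B X n o o' : lin T -> lin X -> conjT T A X -> refA n [:: X] o = Some o' ->
  Good Concl (A, B).
Proof.
rewrite /conjT => lT lX; case: (nzP T) => // nT c e H sH pH.
have [g [ig sH' h]] := mv_cj sH lT nT; have [_ pH'] := h _ pH I.
apply: (ConclI ig); apply: (@refAG _ n [:: cj T (A, B)] o o' sH') => [p /= [->|//]//|].
suff -> : map fst [:: cj T (A, B)] = [:: X] by [].
have [l1 _] := Std_lin sH' (let: And3 a _ _ := pH' in a).
have c' w : mem w [:: q1; q2; q4; q8] -> ap (cj T (A, B)).1 w = ap X w.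
  by move=> m; have /eqP := allsP c m; rewrite (ap_mk (fun w => inv T (ap A (ap T w)))) => ->; rewrite invap.
by change ([:: (cj T (A, B)).1] = [:: X]); rewrite (lin_eq l1 lX) //; apply: c' => /=; tauto.
Qed.

Fixpoint exq (P : q -> bool) (s : seq q) : bool :=
  if s is x :: s' then if P x then true else exq P s' else false.
Lemma exqP P s : exq P s -> exists x, P x.
Proof. by elim: s => //= x s IH; case: ifP => // px _; exists x. Qed.

(** The two conjugacy classes with characteristic polynomial (X^2+X+1)^2: [AS] has minimal
    polynomial X^2+X+1 and consists of two equal blocks, and [AN] is the companion matrix of
    X^4+X^2+1. *)
Definition AS := tl q2 q3 q8 q12.
Definition AN := tl q2 q4 q8 q5.
Definition chkder (A : tb q) : bool :=
  if irr A then true else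
  if exq (fun x => conjT (tl x (ap A x) (ap A (ap A x)) (ap A (ap A (ap A x)))) A AN) qs then true else
  exq (fun x => exq (fun y => conjT (tl x (ap A x) y (ap A y)) A AS) qs) qs.
Definition allder : bool := allq (fun a => alls chkder (enumlin (FD a))) qs.

Lemma allderP t a : allder -> mem t (enumlin (FD a)) -> chkder t.
Proof.
rewrite /allder => h; have {h} := @allqP (fun a => alls chkder (enumlin (FD a))) h a.
by move: (enumlin (FD a)) => s; apply: allsP.
Qed.

(** The member with A q1 = q2 has an irreducible A or one conjugate to [AN] or [AS]. In the last two
    cases the searches find that the remaining members cannot avoid irreducible maps and quotients.
    Any value besides 0 and [q1] would serve for q2. *)
Lemma allderG n n' oN oS xN xS : allder ->
  refA n [:: AN] oN = Some xN -> refA n' [:: AS] oS = Some xS -> forall H, Std H -> Concl H.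
Proof.
move=> ad eN eS H sH; have [p pH e] := cover sH q2 (isT : q1 != 0).
have pA : Arc H p by split=> //; apply: gr_neq; rewrite e ap_mk.
have := allderP ad (derP sH pA); rewrite /chkder.
case: ifP => [i _|_]; first exact: (irrG i) sH pA.
case: p pA {pH e} => A B pA.
case: ifP => [/exqP[x c] _|_]; first by apply: (conjTG _ _ c eN) sH pA; apply: lin_tl.
by case/exqP=> x /exqP[y c]; apply: (conjTG _ _ c eS) sH pA; apply: lin_tl.
Qed.
End Spread.

Fixpoint bestA (ps : seq (tb q)) (l : seq q) (ba : q) (bs : seq (tb q)) (bn : nat) : q * seq (tb q) :=
  if l is a :: l' then
    if notin a (map (fun t => ap t q1) ps) then
    let s := flt (okall ps) (enumlin (FD a)) in let n := size s in
    if n is 0 then (a, [::]) else if (n < bn)%N then bestA ps l' a s n else bestA ps l' ba bs bn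
    else bestA ps l' ba bs bn
  else (ba, bs).
Fixpoint oracA (n : nat) (ps : seq (tb q)) (acc : seq q) : seq q :=
  if n is n'.+1 then
    let (a, s) := bestA ps (drop 2 qs) q0 [::] 1000 in
    a :: fld (fun A acc => oracA n' (A :: ps) acc) s acc
  else acc.
Definition oAN := Eval vm_compute in oracA 4 [:: AN] [::].
Definition oAS := Eval vm_compute in oracA 4 [:: AS] [::].
Lemma refAN : refA 5 [:: AN] oAN = Some [::]. Proof. by vm_compute. Qed.
Lemma refAS : refA 5 [:: AS] oAS = Some [::]. Proof. by vm_compute. Qed.
Lemma allder_ok : allder. Proof. by vm_compute. Qed.

(** * The hyperovals *)

(** Values of the function describing a Lunelli-Sce hyperoval. The arc property after deletion of
    (0,0,1) is computed in [arc3], and that the resulting oval is neither a conic nor a pointed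
    conic is shown by [L3_not_conic] and [L3_not_pointed]. *)
Definition fls : tb q :=
  TB q0 q1 q8 q2 q5 q10 q3 q13 q14 q15 q9 q4 q7 q6 q11 q12.
Definition ct (b : bool) k a1 b1 c1 a2 b2 c2 a3 b3 c3 : cert :=
  (b, k, ((a1, b1, c1), (a2, b2, c2), (a3, b3, c3))).
(* One semilinear map per hyperoval through the chosen elementary 5-arc, in the
   order in which [dfs] meets them. *)
Definition certs : seq cert := [::
 ct false 0 q15 q11 q7 q3 q8 q2 q13 q3 q5;
 ct false 1 q4 q3 q7 q14 q1 q15 q11 q0 q0;
 ct false 0 q1 q6 q3 q12 q9 q1 q12 q8 q15;
 ct false 0 q4 q13 q10 q7 q4 q15 q3 q9 q4;
 ct false 3 q7 q11 q2 q0 q0 q9 q6 q14 q1;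
 ct false 1 q1 q12 q7 q3 q3 q3 q3 q11 q1;
 ct false 0 q14 q6 q7 q2 q3 q15 q13 q4 q9;
 ct false 2 q6 q14 q1 q5 q11 q6 q3 q5 q6;
 ct false 0 q14 q3 q6 q0 q0 q7 q14 q2 q1;
 ct false 2 q4 q4 q4 q13 q11 q15 q8 q3 q12;
 ct false 1 q6 q9 q3 q9 q0 q0 q14 q5 q4;
 ct false 3 q9 q12 q2 q12 q7 q11 q4 q7 q14;
 ct false 2 q15 q8 q11 q4 q2 q9 q10 q12 q1;
 ct false 1 q4 q14 q2 q3 q3 q3 q6 q4 q14;
 ct false 3 q4 q13 q10 q0 q9 q0 q5 q14 q3;
 ct false 1 q13 q7 q3 q4 q7 q14 q8 q2 q5;
 ct false 1 q10 q6 q2 q7 q13 q12 q12 q6 q8;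
 ct false 0 q8 q7 q6 q8 q11 q3 q1 q5 q10;
 ct false 3 q4 q12 q8 q3 q12 q15 q6 q15 q11;
 ct false 0 q9 q3 q8 q9 q2 q11 q0 q0 q3;
 ct false 0 q3 q13 q8 q5 q10 q14 q6 q6 q6;
 ct false 1 q8 q14 q15 q7 q6 q5 q14 q11 q8;
 ct false 2 q11 q1 q2 q1 q10 q9 q11 q8 q9;
 ct false 0 q12 q7 q11 q4 q11 q12 q9 q0 q0;
 ct false 1 q4 q15 q1 q5 q0 q0 q0 q14 q0;
 ct false 1 q10 q14 q4 q0 q0 q15 q11 q0 q0;
 ct false 0 q0 q5 q0 q8 q2 q5 q9 q4 q7;
 ct false 0 q1 q12 q7 q10 q9 q13 q10 q0 q0;
 ct false 3 q12 q5 q9 q12 q8 q15 q1 q1 q1;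
 ct false 3 q7 q11 q2 q5 q1 q7 q3 q10 q5;
 ct false 0 q4 q0 q0 q13 q5 q14 q8 q8 q8;
 ct false 3 q6 q9 q3 q5 q15 q10 q3 q7 q9;
 ct false 0 q13 q10 q6 q14 q6 q7 q2 q14 q9;
 ct false 0 q11 q6 q15 q0 q0 q1 q10 q7 q15;
 ct false 3 q13 q1 q12 q15 q7 q4 q3 q9 q4;
 ct false 2 q13 q5 q14 q13 q2 q10 q1 q9 q15;
 ct false 2 q10 q0 q0 q5 q11 q6 q15 q11 q7;
 ct false 3 q8 q13 q2 q14 q13 q3 q6 q0 q0;
 ct false 0 q5 q12 q13 q4 q3 q7 q0 q0 q6;
 ct false 2 q7 q9 q14 q6 q9 q3 q0 q0 q13;
 ct false 0 q10 q15 q6 q5 q1 q7 q14 q13 q3;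
 ct false 0 q0 q0 q8 q10 q0 q0 q11 q10 q1;
 ct false 3 q11 q6 q15 q12 q6 q8 q6 q7 q10;
 ct false 0 q9 q3 q8 q4 q10 q3 q12 q4 q13;
 ct false 0 q5 q7 q2 q9 q14 q6 q13 q15 q7;
 ct false 3 q4 q13 q10 q8 q5 q11 q12 q9 q1;
 ct false 3 q6 q6 q6 q0 q0 q2 q7 q11 q2;
 ct false 0 q2 q3 q15 q11 q2 q12 q8 q14 q15;
 ct false 0 q0 q12 q0 q8 q3 q12 q9 q0 q0;
 ct false 0 q2 q1 q13 q0 q9 q0 q3 q10 q5;
 ct false 2 q3 q6 q11 q6 q13 q9 q4 q1 q11;
 ct false 2 q4 q9 q5 q13 q1 q12 q9 q9 q9;
 ct false 2 q13 q4 q9 q7 q14 q13 q11 q15 q14;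
 ct false 1 q5 q11 q6 q0 q0 q8 q5 q10 q14;
 ct false 0 q6 q15 q11 q15 q2 q13 q8 q0 q0;
 ct false 1 q8 q10 q13 q5 q0 q0 q12 q7 q11;
 ct false 2 q15 q6 q12 q8 q4 q1 q6 q15 q11;
 ct false 2 q1 q12 q7 q10 q0 q0 q10 q9 q13;
 ct true 0 q2 q15 q5 q6 q4 q9 q5 q11 q12;
 ct false 1 q12 q8 q15 q14 q12 q10 q3 q8 q2;
 ct false 3 q2 q0 q0 q15 q11 q7 q12 q15 q2;
 ct false 1 q8 q11 q3 q9 q12 q2 q0 q0 q12;
 ct false 3 q0 q1 q0 q13 q1 q12 q12 q14 q7;
 ct false 1 q11 q8 q9 q9 q8 q1 q3 q6 q11;
 ct false 1 q9 q5 q13 q1 q2 q8 q9 q4 q7;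
 ct false 3 q9 q6 q10 q10 q9 q13 q2 q8 q10;
 ct false 2 q1 q12 q7 q15 q13 q1 q15 q5 q3;
 ct false 3 q8 q0 q0 q12 q4 q13 q5 q1 q7;
 ct false 1 q4 q6 q13 q0 q3 q0 q5 q11 q6;
 ct false 1 q8 q14 q15 q15 q3 q9 q6 q0 q0;
 ct false 1 q7 q1 q9 q4 q9 q5 q2 q11 q14;
 ct false 0 q4 q14 q2 q6 q0 q0 q3 q1 q14;
 ct false 3 q0 q0 q9 q6 q4 q14 q7 q3 q10;
 ct false 0 q12 q3 q14 q9 q9 q9 q4 q13 q10;
 ct false 2 q5 q8 q12 q11 q9 q10 q15 q5 q3;
 ct false 1 q8 q3 q12 q9 q15 q3 q0 q0 q8;
 ct false 3 q0 q13 q0 q8 q4 q1 q9 q4 q7;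
 ct false 1 q10 q7 q15 q0 q0 q8 q11 q10 q1;
 ct false 2 q8 q7 q6 q9 q5 q13 q0 q0 q3;
 ct false 0 q1 q0 q0 q7 q4 q15 q6 q4 q14;
 ct false 2 q8 q15 q4 q3 q2 q7 q11 q12 q3;
 ct false 1 q3 q12 q15 q0 q0 q8 q2 q0 q0;
 ct false 1 q5 q14 q3 q15 q4 q2 q11 q8 q9;
 ct false 1 q9 q2 q11 q1 q1 q1 q9 q4 q7;
 ct false 1 q11 q0 q0 q4 q11 q12 q14 q15 q9;
 ct false 0 q2 q9 q12 q1 q6 q3 q2 q7 q1;
 ct false 3 q5 q11 q6 q4 q14 q2 q0 q0 q14;
 ct false 0 q1 q5 q10 q9 q7 q12 q9 q1 q4;
 ct false 1 q3 q3 q3 q0 q1 q0 q2 q8 q10;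
 ct false 2 q12 q4 q13 q0 q0 q11 q13 q1 q12;
 ct false 0 q13 q2 q10 q14 q5 q4 q2 q1 q13;
 ct false 3 q0 q0 q3 q12 q2 q3 q13 q12 q11;
 ct false 1 q7 q9 q14 q0 q1 q0 q6 q0 q0;
 ct false 3 q6 q15 q11 q12 q10 q4 q11 q8 q9;
 ct false 0 q9 q10 q15 q3 q13 q8 q11 q12 q3;
 ct false 2 q5 q4 q11 q4 q7 q14 q0 q7 q0;
 ct false 3 q7 q15 q8 q6 q9 q3 q0 q0 q8;
 ct false 1 q12 q9 q1 q13 q8 q4 q0 q0 q4;
 ct false 0 q7 q10 q11 q14 q1 q15 q8 q0 q0;
 ct false 2 q13 q5 q14 q7 q5 q1 q11 q11 q11;
 ct false 3 q0 q12 q0 q8 q3 q12 q9 q8 q1;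
 ct false 2 q11 q5 q7 q11 q4 q6 q1 q0 q0;
 ct false 3 q13 q13 q13 q7 q6 q5 q10 q11 q9;
 ct false 2 q12 q2 q3 q3 q1 q14 q14 q6 q7;
 ct false 1 q8 q4 q1 q8 q9 q7 q1 q12 q7;
 ct false 0 q6 q14 q1 q7 q9 q14 q0 q14 q0;
 ct false 0 q13 q8 q4 q3 q4 q10 q15 q12 q14;
 ct false 0 q15 q1 q5 q11 q4 q6 q5 q15 q10;
 ct false 3 q3 q1 q14 q6 q0 q0 q4 q12 q8;
 ct false 2 q1 q2 q8 q12 q12 q12 q12 q2 q3;
 ct false 2 q1 q4 q5 q4 q4 q4 q5 q0 q0;
 ct false 3 q4 q2 q9 q6 q12 q5 q3 q14 q12;
 ct false 0 q5 q12 q13 q9 q0 q0 q12 q12 q12;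
 ct false 1 q2 q3 q15 q0 q0 q14 q3 q6 q11;
 ct false 1 q14 q13 q3 q4 q15 q1 q11 q14 q5;
 ct false 2 q4 q9 q5 q9 q9 q9 q13 q1 q12;
 ct false 0 q1 q10 q9 q12 q12 q12 q12 q4 q13;
 ct false 3 q11 q13 q4 q4 q14 q2 q14 q12 q10;
 ct false 2 q0 q0 q7 q5 q6 q9 q4 q15 q1;
 ct false 2 q14 q11 q8 q3 q4 q10 q12 q15 q2;
 ct false 3 q0 q12 q0 q2 q3 q15 q3 q10 q5;
 ct false 0 q1 q0 q0 q1 q9 q15 q1 q6 q3;
 ct false 0 q13 q5 q14 q14 q10 q2 q3 q15 q13;
 ct false 2 q14 q1 q15 q11 q12 q3 q4 q1 q11;
 ct false 2 q13 q12 q11 q0 q12 q0 q12 q6 q8;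
 ct false 2 q0 q6 q0 q1 q13 q6 q0 q0 q2;
 ct false 1 q0 q0 q5 q1 q12 q7 q0 q15 q0;
 ct false 1 q15 q13 q1 q7 q6 q5 q9 q0 q0;
 ct false 2 q5 q10 q14 q1 q0 q0 q5 q6 q9;
 ct false 2 q13 q1 q12 q12 q9 q1 q0 q0 q3;
 ct false 2 q6 q13 q9 q7 q4 q15 q0 q4 q0;
 ct false 0 q3 q4 q10 q4 q15 q1 q6 q14 q1;
 ct false 0 q0 q3 q0 q11 q2 q12 q10 q7 q15;
 ct false 3 q4 q4 q4 q2 q1 q13 q7 q14 q13;
 ct false 0 q4 q3 q7 q4 q5 q15 q1 q3 q2;
 ct false 0 q2 q12 q6 q12 q0 q0 q15 q2 q13;
 ct false 1 q0 q0 q7 q13 q12 q11 q12 q12 q12;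
 ct false 2 q7 q4 q15 q10 q8 q5 q13 q12 q11;
 ct false 1 q5 q3 q1 q6 q6 q6 q3 q5 q6;
 ct false 2 q11 q9 q10 q1 q12 q7 q11 q10 q1;
 ct false 1 q8 q14 q15 q12 q4 q13 q4 q10 q3;
 ct false 0 q5 q15 q10 q11 q9 q10 q15 q15 q15;
 ct false 2 q6 q14 q1 q9 q5 q13 q14 q15 q9;
 ct false 2 q13 q2 q10 q11 q6 q15 q7 q0 q0;
 ct false 3 q0 q1 q0 q4 q9 q5 q5 q13 q15;
 ct false 1 q0 q6 q0 q12 q3 q14 q13 q15 q7;
 ct false 3 q15 q1 q5 q6 q14 q1 q8 q9 q7;
 ct false 2 q15 q10 q8 q4 q12 q8 q10 q4 q8;
 ct false 1 q10 q5 q12 q15 q12 q14 q4 q12 q8;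
 ct false 3 q13 q7 q3 q6 q7 q10 q10 q3 q11;
 ct false 2 q6 q3 q4 q12 q1 q6 q11 q14 q5;
 ct false 2 q11 q7 q8 q10 q4 q8 q0 q3 q0;
 ct false 0 q7 q3 q10 q9 q9 q9 q15 q2 q13;
 ct false 1 q2 q1 q13 q13 q6 q1 q15 q6 q12;
 ct false 3 q10 q10 q10 q12 q13 q5 q7 q3 q10;
 ct false 0 q13 q15 q7 q13 q6 q1 q1 q7 q13;
 ct false 2 q1 q8 q14 q0 q0 q11 q0 q12 q0;
 ct false 3 q5 q5 q5 q8 q9 q7 q12 q3 q14;
 ct false 1 q1 q1 q1 q15 q3 q9 q15 q11 q7;
 ct false 1 q11 q11 q11 q1 q0 q0 q11 q15 q14;
 ct false 1 q2 q7 q1 q7 q2 q6 q4 q12 q8].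

(** Multiplication by [q8]: the 5-arc formed by the frame and the point (1, X, X^3). *)
Definition k16 : key := (q8, q3, q6, q12).
Definition os16 : tb (seq q) := Eval vm_compute in
  let r := gm q2 q8 in let ms := masks r in let cs := mk (candsof r ms) in
  mk (fun a => if fresh r a [::] then
     fld (fun p acc => if elem a p then acc else orac cs 12 (drop 3 qs) [:: p] acc)
     (unpruned v15 r (surv [::] (ap cs a))) [::] else [::]).
Lemma el16 : elchk fls v15 q8 os16 certs.
Proof. by vm_compute. Qed.
Definition r16 := Eval vm_compute in close v15 k16.
Definition v16 := Eval vm_compute in r16.1.
Definition s16 := Eval vm_compute in r16.2.
Lemma ents16 : chkents (ins v15 k16) s16 = Some v16.
Proof. by vm_compute. Qed.
(** Multiplication by [q4], from the point (1, X, X^2). This pair is elementary too, but each sixth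
    member examined leads to a settled class or is refuted, so the ordinary step applies. *)
Definition k17 : key := (q4, q8, q3, q6).
Definition o17 := Eval vm_compute in mkorac v16 k17 q6 [:: q3; q4].
Definition r17 := Eval vm_compute in close v16 k17.
Definition v17 := Eval vm_compute in r17.1.
Definition s17 := Eval vm_compute in r17.2.
Lemma step17 : clsstep v16 k17 q6 o17 s17 = Some v17.
Proof. by vm_compute. Qed.
Lemma allkeys17 : allkeys v17.
Proof. by vm_compute. Qed.

Lemma hyperovals H : Std H -> Concl H fls.
Proof.
have cI g H' : iso g -> Concl (im g H') fls -> Concl H' fls by exact: ConclI.
have g15 : Gvis (Concl^~ fls) v15.
  apply: (clsstepG cI _ step15).
  apply: (clsstepG cI _ step14).
  apply: (clsstepG cI _ step13).
  apply: (clsstepG cI _ step12).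
  apply: (clsstepG cI _ step11).
  apply: (clsstepG cI _ step10).
  apply: (clsstepG cI _ step9).
  apply: (clsstepG cI _ step8).
  apply: (clsstepG cI _ step7).
  apply: (clsstepG cI _ step6).
  apply: (clsstepG cI _ step5).
  apply: (clsstepG cI _ step4).
  apply: (clsstepG cI _ step3).
  apply: (clsstepG cI _ step2).
  apply: (clsstepG cI _ step1).
  exact: Gvis0.
have g16 : Gvis (Concl^~ fls) v16.
  apply: (chkentsG cI _ ents16); apply: Gins => //.
  (* The pair of [CC] and [kt k16] is [gm q2 q8] by computation. *)
  by have := elchkG g15 el16.
have g17 := clsstepG cI g16 step17.
exact: (allderG cI (fun B => allkeysG g17 allkeys17) allder_ok refAN refAS).
Qed.

(* Collineations fixing the hyperoval and moving the point [c] to [E3]. *)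
Definition autreg : tb cert :=
  TB
   (ct true 0 q0 q0 q10 q0 q15 q0 q1 q7 q6)
   (ct true 0 q12 q13 q6 q0 q8 q0 q12 q5 q7)
   (ct true 1 q8 q10 q1 q0 q2 q0 q9 q15 q7)
   (ct true 0 q12 q10 q15 q0 q6 q0 q13 q0 q0)
   (ct true 0 q8 q0 q0 q0 q13 q0 q9 q14 q5)
   (ct true 2 q8 q13 q5 q0 q1 q0 q9 q7 q12)
   (ct true 0 q6 q8 q2 q0 q14 q0 q7 q9 q8)
   (ct true 0 q7 q13 q2 q0 q15 q0 q6 q1 q7)
   (ct true 1 q2 q12 q14 q0 q14 q0 q3 q12 q5)
   (ct true 2 q13 q0 q0 q0 q5 q0 q12 q15 q8)
   (ct true 3 q4 q3 q12 q0 q11 q0 q5 q0 q0)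
   (ct true 3 q13 q3 q7 q0 q8 q0 q12 q4 q13)
   (ct true 3 q5 q12 q3 q0 q1 q0 q4 q14 q6)
   (ct true 3 q11 q5 q10 q0 q8 q0 q10 q4 q7)
   (ct true 2 q11 q14 q1 q0 q7 q0 q10 q3 q9)
   (ct true 3 q2 q6 q10 q0 q5 q0 q3 q1 q14).
Definition autls : tb cert :=
  TB
   (ct true 1 q0 q0 q7 q13 q1 q12 q12 q14 q7)
   (ct true 0 q15 q14 q10 q12 q12 q12 q3 q2 q7)
   (ct true 1 q11 q0 q0 q12 q14 q7 q6 q11 q13)
   (ct true 2 q10 q2 q14 q7 q7 q7 q13 q4 q9)
   (ct true 0 q8 q5 q11 q3 q1 q14 q10 q11 q9)
   (ct true 0 q14 q14 q14 q3 q9 q4 q12 q9 q1)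
   (ct true 0 q8 q2 q5 q0 q6 q0 q9 q3 q8)
   (ct true 3 q15 q15 q15 q8 q12 q9 q7 q2 q6)
   (ct true 0 q11 q7 q8 q9 q8 q1 q2 q14 q9)
   (ct true 3 q11 q14 q5 q9 q11 q5 q3 q3 q3)
   (ct true 1 q8 q15 q4 q4 q13 q10 q13 q1 q12)
   (ct true 3 q4 q10 q3 q6 q14 q1 q3 q9 q4)
   (ct true 3 q13 q15 q7 q5 q9 q8 q9 q4 q7)
   (ct true 3 q0 q3 q0 q9 q3 q8 q8 q15 q4)
   (ct true 2 q2 q7 q1 q8 q5 q11 q11 q5 q7)
   (ct true 3 q13 q12 q11 q5 q8 q12 q9 q4 q7).
Definition autls2 : cert := ct true 1 q5 q7 q2 q0 q0 q15 q4 q14 q2.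

Definition stdpts (f : tb q) : seq pt := ptsof (map (fun c => (c, ap f c)) qs).
Definition toE3 (w : pt) : bool := let: (x, y, z) := w in if qeq x q0 then qeq y q0 else false.
Definition chkaut f (c : cert) (w : pt) : bool :=
  let: (_, k, M) := c in if chkmap f k M (stdpts f) then toE3 (gmap k M w) else false.

Lemma std_line f E : E \in std f -> exists w, [/\ w != 0, mem w (stdpts f) & E = line w].
Proof.
rewrite !inE => /orP[/orP[/eqP->|/eqP->]|/imsetP[c _ ->]].
- by exists (0, 1, 0); split=> //; [left | exact: line_E2].
- by exists (0, 0, 1); split=> //; [right; left | exact: line_E3].
exists (1, c, ap f c); split=> //; last exact: line_gr.
right; right; have := mem_qs c; elim: (qs) => //= z s IH [<-|/IH]; by [left | right].
Qed.

Lemma chkautP f c w : hyp 18 (std f) -> w != 0 -> chkaut f c w ->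
  exists g, [/\ iso g, im g (std f) = std f & g @: line w = E3].
Proof.
case: c => [[b k] M] hf wn; rewrite /chkaut; case: ifP => // c.
have [ig e] := chkmap_im hf c (@std_line f) => t; exists (gmap k M); split=> //.
have dn : detM M != 0 by move: c; rewrite /chkmap; case: qeqP => // /eqP.
rewrite gmap_line // line_E3; have := wn; rewrite -(inj_eq ig.2) (iso0 ig).
move: (gmap k M w) t => [[x y] z] /=; rewrite !qeqE q0E; case: eqP => // -> /eqP-> zn.
have {}zn : z != 0 by apply: contraNneq zn => ->.
by rewrite -(lineS 0 0 1 zn) !mulr0 mulr1.
Qed.

Lemma autreg_ok : allq (fun c => chkaut freg (ap autreg c) (q1, c, ap freg c)) qs.
Proof. by vm_compute. Qed.
Lemma autls_ok : allq (fun c => chkaut fls (ap autls c) (q1, c, ap fls c)) qs.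
Proof. by vm_compute. Qed.
Lemma autls2_ok : chkaut fls autls2 (q0, q1, q0).
Proof. by vm_compute. Qed.

(** The listed collineations act transitively on the points of the regular hyperoval other than the
    nucleus, and on all 18 points of the Lunelli-Sce hyperoval. So these three deletions represent
    all of them. *)
Definition D1 := std freg :\ E2.
Definition D2 := std freg :\ E3.
Definition D3 := std fls :\ E3.

Lemma im_D1 g H N : iso g -> im g (H :\ N) = im g H :\ (g @: N).
Proof.
move=> [_ gi]; have ii := imset_inj gi; apply/setP => E; rewrite !inE.
apply/imsetP/andP => [[F] | [n /imsetP[F FH e]]].
  by rewrite !inE => /andP[n FH] ->; rewrite (inj_eq ii) n imset_f.
by exists F => //; rewrite !inE FH andbT -(inj_eq ii) -e.
Qed.

Lemma ovals H N : hyp 18 H -> Concl H fls -> N \in H ->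
  exists g, iso g /\ [\/ im g (H :\ N) = D1, im g (H :\ N) = D2 | im g (H :\ N) = D3].
Proof.
move=> hH [g [ig hg]] NH.
have gN : g @: N \in im g H by apply: imset_f.
have fin f h : iso h -> im g H = std f -> im h (std f) = std f -> h @: (g @: N) = E3 ->
    iso (h \o g) /\ im (h \o g) (H :\ N) = std f :\ E3.
  move=> ih eg eh e3; split; first exact: iso_comp.
  by rewrite -im_comp im_D1 // im_D1 // eg eh e3.
have id_ f : im id (std f) = std f.
  by apply/setP => E; apply/imsetP/idP => [[F FH ->]|EH]; rewrite ?imset_id //; exists E; rewrite ?imset_id.
have iid : iso id by split=> [x y|x y].
case: hg => eg; have hs := hyp_im ig hH; rewrite eg in gN hs.
  move: gN; rewrite !inE => /orP[/orP[/eqP e2|/eqP e3]|/imsetP[c _ ec]].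
  - by exists g; split=> //; constructor 1; rewrite im_D1 // eg e2.
  - have [] := fin _ id iid eg (id_ _); first by rewrite imset_id.
    by exists (id \o g); split=> //; constructor 2.
  have wn : (1, c, ap freg c) != 0 :> pt by [].
  have [h [ih eh e3]] := chkautP hs wn (allqP autreg_ok c).
  have [|i e] := fin _ h ih eg eh; first by rewrite ec line_gr.
  by exists (h \o g); split=> //; constructor 2.
move: gN; rewrite !inE => /orP[/orP[/eqP e2|/eqP e3]|/imsetP[c _ ec]].
- have wn : (0, 1, 0) != 0 :> pt by [].
  have [h [ih eh e3]] := chkautP hs wn autls2_ok.
  have [|i e] := fin _ h ih eg eh; first by rewrite e2 line_E2.
  by exists (h \o g); split=> //; constructor 3.
- have [] := fin _ id iid eg (id_ _); first by rewrite imset_id.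
  by exists (id \o g); split=> //; constructor 3.
have wn : (1, c, ap fls c) != 0 :> pt by [].
have [h [ih eh e3]] := chkautP hs wn (allqP autls_ok c).
have [|i e] := fin _ h ih eg eh; first by rewrite ec line_gr.
by exists (h \o g); split=> //; constructor 3.
Qed.

(** * Existence of a frame *)

Lemma subset_card_eq (T : finType) (A B : {set T}) : A \subset B -> (#|B| <= #|A|)%N -> A = B.
Proof. by move=> s c; apply/eqP; rewrite eqEcard s c. Qed.

Lemma odd_involution (T : finType) (A : {set T}) (f : T -> T) :
  (forall x, x \in A -> [/\ f x \in A, f x != x & f (f x) = x]) -> ~~ odd #|A|.
Proof.
have [n] := ubnP #|A|; elim: n A => // n IH A /ltnSE le h.
have [->|[x xA]] := set_0Vmem A; first by rewrite cards0.
have [fA fn ff] := h x xA.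
have c : #|A| = #|A :\ x :\ f x|.+2.
  by rewrite (cardsD1 x) xA (cardsD1 (f x) (A :\ x)) !inE fn fA.
rewrite c /= negbK; apply: IH => [|y]; first by rewrite (leq_trans _ le) // c.
rewrite !inE => /and3P[ny nx yA]; have [fyA fyn ffy] := h y yA; split=> //.
rewrite fyA andbT; apply/andP; split; [apply: contraNneq nx | apply: contraNneq ny] => e.
  by rewrite -ffy e ff.
by rewrite -ffy e.
Qed.

Lemma iso_inv g : iso g -> exists h, [/\ iso h, cancel g h & cancel h g].
Proof.
move=> ig; have [ga gi] := ig; have [h gh hg] := injF_bij gi; exists h; split=> //; split.
  by move=> x y; apply: gi; rewrite ga !hg.
exact: can_inj hg.
Qed.

Definition comb (x1 x2 x4 x8 : pt) (u : q) : pt :=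
  (ap (tl x1.1.1 x2.1.1 x4.1.1 x8.1.1) u, ap (tl x1.1.2 x2.1.2 x4.1.2 x8.1.2) u,
   ap (tl x1.2 x2.2 x4.2 x8.2) u).
Lemma combD x1 x2 x4 x8 u v : comb x1 x2 x4 x8 (u + v) = comb x1 x2 x4 x8 u + comb x1 x2 x4 x8 v.
Proof. by rewrite /comb !lin_tl. Qed.

Lemma subg_param E : subg E -> exists a : q -> pt,
  [/\ forall u v, a (u + v) = a u + a v, injective a & forall v, v \in E <-> exists u, v = a u].
Proof.
move=> [E0 Ea cE].
have out (s : seq pt) : (size s < 16)%N -> exists2 x, x \in E & x \notin s.
  move=> le; case: (pickP [pred x | (x \in E) && (x \notin s)]) => [x /andP[]|h]; first by exists x.
  have : (#|E| <= size s)%N.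
    rewrite (leq_trans _ (card_size s)) //; apply: subset_leq_card; apply/subsetP => x xE.
    by have := h x; rewrite /= xE /= => /negbFE.
  by rewrite cE leqNgt le.
(* A basis is chosen greedily: [comb] with trailing zeros lists the span of the vectors found so
   far, which has fewer than 16 elements. *)
have [x1 e1 n1] := out [:: 0] isT.
have [x2 e2 n2] := out [:: 0; x1] isT.
have [x4 e4 n4] := out (map (comb x1 x2 0 0) [:: q0; q1; q2; q3]) isT.
have [x8 e8 n8] := out (map (comb x1 x2 x4 0) [:: q0; q1; q2; q3; q4; q5; q6; q7]) isT.
pose a := comb x1 x2 x4 x8; have aD u v : a (u + v) = a u + a v by exact: combD.
have sp (x : pt) : (x.1.1, x.1.2, x.2) = x by case: x => -[].
have a0 : a q0 = 0 by apply: (addrI (a q0)); rewrite -aD !addr0.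
have a1 : a q1 = x1 by rewrite /a /comb /= sp.
have a2 : a q2 = x2 by rewrite /a /comb /= sp.
have a4 : a q4 = x4 by rewrite /a /comb /= sp.
have a8 : a q8 = x8 by rewrite /a /comb /= sp.
have aE u : a u \in E.
  have i3 : a q3 \in E by rewrite -[q3]/(q1 + q2) aD Ea // ?a1 ?a2.
  have i5 : a q5 \in E by rewrite -[q5]/(q1 + q4) aD Ea // ?a1 ?a4.
  have i6 : a q6 \in E by rewrite -[q6]/(q2 + q4) aD Ea // ?a2 ?a4.
  have i7 : a q7 \in E by rewrite -[q7]/(q3 + q4) aD Ea // ?a4.
  case: u; rewrite ?a0 ?a1 ?a2 ?a4 ?a8 //.
  - by rewrite -[q9]/(q1 + q8) aD Ea // ?a1 ?a8.
  - by rewrite -[q10]/(q2 + q8) aD Ea // ?a2 ?a8.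
  - by rewrite -[q11]/(q3 + q8) aD Ea // ?a8.
  - by rewrite -[q12]/(q4 + q8) aD Ea // ?a4 ?a8.
  - by rewrite -[q13]/(q5 + q8) aD Ea // ?a8.
  - by rewrite -[q14]/(q6 + q8) aD Ea // ?a8.
  by rewrite -[q15]/(q7 + q8) aD Ea // ?a8.
have n8' u : u \in [:: q0; q1; q2; q3; q4; q5; q6; q7] -> a (u + q8) != 0.
  move=> m; apply: contraNneq n8; rewrite aD a8 => /addp_eq0 <-.
  apply/mapP; exists u => //; rewrite /a /comb; move: m; rewrite !inE.
  by do ![case/orP]; move/eqP->.
have n4' u : u \in [:: q0; q1; q2; q3] -> a (u + q4) != 0.
  move=> m; apply: contraNneq n4; rewrite aD a4 => /addp_eq0 <-.
  apply/mapP; exists u => //; rewrite /a /comb; move: m; rewrite !inE.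
  by do ![case/orP]; move/eqP->.
have nz u : u != 0 -> a u != 0.
  move: n1 n2; rewrite !inE !negb_or => n1 /andP[n2 n2'].
  case: u => // _; rewrite ?a1 ?a2 //.
  - rewrite -[q3]/(q1 + q2) aD a1 a2; apply: contraNneq n2' => /addp_eq0 ->; exact: eqxx.
  - exact: (n4' q0). - exact: (n4' q1). - exact: (n4' q2). - exact: (n4' q3).
  - exact: (n8' q0). - exact: (n8' q1). - exact: (n8' q2). - exact: (n8' q3).
  - exact: (n8' q4). - exact: (n8' q5). - exact: (n8' q6). - exact: (n8' q7).
have ai : injective a.
  move=> u v e; apply/eqP; rewrite -addq_eq0; apply: contraT => /nz.
  by rewrite aD e addpp eqxx.
exists a; split=> // v; split=> [|[u ->]//].
have <- : a @: predT = E.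
  apply: subset_card_eq; first by apply/subsetP=> _ /imsetP[u _ ->].
  by rewrite card_imset // cardT -cardE card_q cE.
by case/imsetP=> u _ ->; exists u.
Qed.

(** Three members decompose the whole group through F. Each component of the fourth member is
    injective, since a zero component would put a point into the sum of two other members. Rescaling
    by these components, through K, makes the fourth member the diagonal. *)
Lemma frame H : hyp 18 H -> exists g, iso g /\ Std (im g H).
Proof.
move=> hH; have [cH sH iH] := hH.
have out (S : {set {set pt}}) : (#|S| < 18)%N -> exists2 E, E \in H & E \notin S.
  move=> le; have /subsetPn[E EH n] : ~~ (H \subset S).
    by apply: contraL le => /subset_leq_card; rewrite cH -leqNgt.
  by exists E.
have [|U1 h1 _] := out set0; first by rewrite cards0.
have [|U2 h2] := out [set U1]; first by rewrite cards1.
rewrite !inE => n21.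
have c3 : (#|[set U1; U2]| < 18)%N by rewrite cards2; case: (_ == _).
have [U3 h3] := out _ c3; rewrite !inE negb_or => /andP[n31 n32].
have c4 : (#|U3 |: [set U1; U2]| < 18)%N.
  by rewrite cardsU1 cards2; case: (_ \in _); case: (_ == _).
have [U4 h4] := out _ c4; rewrite !inE !negb_or => /and3P[n43 n41 n42].
have [a1 [a1D a1i a1P]] := subg_param (sH _ h1).
have [a2 [a2D a2i a2P]] := subg_param (sH _ h2).
have [a3 [a3D a3i a3P]] := subg_param (sH _ h3).
have [a4 [a4D a4i a4P]] := subg_param (sH _ h4).
have i1 u : a1 u \in U1 by apply/a1P; exists u.
have i2 u : a2 u \in U2 by apply/a2P; exists u.
have i3 u : a3 u \in U3 by apply/a3P; exists u.
have i4 u : a4 u \in U4 by apply/a4P; exists u.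
have z (b : q -> pt) : (forall u v, b (u + v) = b u + b v) -> b 0 = 0.
  by move=> bD; apply: (addrI (b 0)); rewrite -bD !addr0.
have ker (b : q -> pt) : (forall u v, b (u + v) = b u + b v) -> injective b -> forall u, b u = 0 -> u = 0.
  by move=> bD bi u e; apply: bi; rewrite e z.
pose F (v : pt) : pt := a1 v.1.1 + a2 v.1.2 + a3 v.2.
have iF : iso F.
  have Fa : additive_map F.
    by move=> x y; rewrite /F /= a1D a2D a3D (addrACA (a1 _)) (addrACA (a1 _ + _)).
  split=> // x y e; apply: addp_eq0; have := Fa x y; rewrite e addpp.
  move: (x + y) => -[[u v] w]; rewrite {1}/F /= => s.
  have [e1 e2 e3] := iH _ _ _ h1 h2 h3 (contra_neq (@esym _ _ _) n21) (contra_neq (@esym _ _ _) n32)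
     (contra_neq (@esym _ _ _) n31) _ _ _ (i1 u) (i2 v) (i3 w) s.
  by rewrite (ker _ a1D a1i _ e1) (ker _ a2D a2i _ e2) (ker _ a3D a3i _ e3).
have [G [iG FG GF]] := iso_inv iF.
pose c u := G (a4 u).
have cF u : F (c u) = a4 u by rewrite /c GF.
have cD u v : c (u + v) = c u + c v by rewrite /c a4D iG.1.
have k1 u : (c u).1.1 = 0 -> u = 0.
  move=> e; have [] := iH _ _ _ h4 h2 h3 n42 (contra_neq (@esym _ _ _) n32) n43 _ _ _ (i4 u) (i2 (c u).1.2) (i3 (c u).2).
    by rewrite -cF /F e (z a1) // add0r -addrA addpp.
  by move/(ker _ a4D a4i).
have k2 u : (c u).1.2 = 0 -> u = 0.
  move=> e; have [] := iH _ _ _ h4 h1 h3 n41 (contra_neq (@esym _ _ _) n31) n43 _ _ _ (i4 u) (i1 (c u).1.1) (i3 (c u).2).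
    by rewrite -cF /F e (z a2) // addr0 -addrA addpp.
  by move/(ker _ a4D a4i).
have k3 u : (c u).2 = 0 -> u = 0.
  move=> e; have [] := iH _ _ _ h4 h1 h2 n41 (contra_neq (@esym _ _ _) n21) n42 _ _ _ (i4 u) (i1 (c u).1.1) (i2 (c u).1.2).
    by rewrite -cF /F e (z a3) // addr0 -addrA addpp.
  by move/(ker _ a4D a4i).
pose K (v : pt) : pt := ((c v.1.1).1.1, (c v.1.2).1.2, (c v.2).2).
have iK : iso K.
  have Ka : additive_map K by move=> x y; rewrite /K /= !cD.
  split=> // x y e; apply: addp_eq0; have := Ka x y; rewrite e addpp.
  by move: (x + y) => -[[u v] w] [/= /k1-> /k2-> /k3->].
have iFK := iso_comp iF iK; have [g [ig lg rg]] := iso_inv iFK.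
exists g; split=> //.
have gU (U E : {set pt}) : U \in H -> #|E| = 16 -> (forall v, v \in E -> F (K v) \in U) -> E \in im g H.
  move=> UH cE h; have [_ _ cU] := sH _ UH.
  have <- : g @: U = E; last exact: imset_f.
  rewrite -(im_eq iFK cE cU h) -imset_comp.
  by apply/setP => v; apply/imsetP/idP => [[w wE ->]|vE]; [rewrite /= lg | exists v; rewrite //= lg].
have c0 : c 0 = 0 by rewrite /c (z a4) // (iso0 iG).
split; first exact: hyp_im.
- apply: (gU U1) => //; first exact: card_gr.
  move=> v /gr_inv ->; rewrite !ap_mk /F /K /= c0 /= (z a2) // (z a3) // !addr0; exact: i1.
- apply: (gU U2) => //; first exact: card_E2.
  move=> [[x y] w]; rewrite inE => /andP[/eqP/= -> /eqP/= ->].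
  by rewrite /F /K /= c0 /= (z a1) // (z a3) // addr0 add0r i2.
- apply: (gU U3) => //; first exact: card_E3.
  move=> [[x y] w]; rewrite inE => /andP[/eqP/= -> /eqP/= ->].
  by rewrite /F /K /= c0 /= (z a1) // (z a2) // !add0r i3.
apply: (gU U4) => //; first exact: card_gr.
move=> v /gr_inv ->; rewrite !ap_mk.
have -> : F (K (v.1.1, v.1.1, v.1.1)) = F (c v.1.1) by rewrite /K /F.
by rewrite cF.
Qed.

(** * The nucleus *)

Section Nucleus.
Implicit Types (E F G K : {set pt}) (x y : pt).
Variables (O : {set {set pt}}) (hO : hyp 17 O).
Let cO : #|O| = 17. Proof. by case: hO. Qed.
Let sO E : E \in O -> subg E. Proof. by case: hO => _ h _; apply: h. Qed.
Let iO : indep O. Proof. by case: hO. Qed.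
Let O0 E : E \in O -> 0 \in E. Proof. by case/sO. Qed.
Let OD E x y : E \in O -> x \in E -> y \in E -> x + y \in E. Proof. by case/sO => _ h _; apply: h. Qed.
Let O16 E : E \in O -> #|E| = 16. Proof. by case/sO. Qed.

Lemma cardD0 E : E \in O -> #|E :\ (0 : pt)| = 15.
Proof.
by move=> EO; apply: (@addnI 1); rewrite -[RHS](O16 EO) (cardsD1 (0 : pt) E) O0.
Qed.

Definition sm (E F : {set pt}) : {set pt} :=
  [set x | [exists u in E, exists v in F, x == u + v]].

Lemma smP E F x : reflect (exists u v : pt, [/\ u \in E, v \in F & x = u + v]) (x \in sm E F).
Proof.
rewrite inE; apply: (iffP exists_inP) => [[u uE /exists_inP[v vF /eqP->]]|[u [v [uE vF ->]]]].
  by exists u, v.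
by exists u => //; apply/exists_inP; exists v.
Qed.
Lemma smC E F : sm E F = sm F E.
Proof. by apply/setP => x; apply/smP/smP => -[u [v [? ? ->]]]; exists v, u; rewrite addrC. Qed.
Lemma smD E F x y : E \in O -> F \in O -> x \in sm E F -> y \in sm E F -> x + y \in sm E F.
Proof.
move=> EO FO /smP[u [v [uE vF ->]]] /smP[u' [v' [uE' vF' ->]]]; apply/smP.
by exists (u + u'), (v + v'); rewrite !OD // addrACA.
Qed.
Lemma sm_l E F x : F \in O -> x \in E -> x \in sm E F.
Proof. by move=> FO xE; apply/smP; exists x, 0; rewrite O0 // addr0. Qed.

Lemma third E F : exists2 G, G \in O & (G != E) && (G != F).
Proof.
have /subsetPn[G GO] : ~~ (O \subset [set E; F]).
  by apply/negP => /subset_leq_card; rewrite cO cards2; case: (_ == _).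
by rewrite !inE negb_or => n; exists G.
Qed.

Lemma ind2 E F x y : E \in O -> F \in O -> E != F -> x \in E -> y \in F -> x + y = 0 -> x = 0 /\ y = 0.
Proof.
move=> EO FO n xE yF e; have [G GO /andP[nE nF]] := third E F.
have [] := iO EO FO GO n _ _ xE yF (O0 GO); rewrite 1?eq_sym // 1?eq_sym //.
by rewrite e addr0.
Qed.

(** Comparing the two decompositions of x gives a relation between E, F and G, so its part in F
    vanishes. *)
Lemma sm_cap E F G x : E \in O -> F \in O -> G \in O -> E != F -> E != G -> F != G ->
  x \in sm E F -> x \in sm E G -> x \in E.
Proof.
move=> EO FO GO n1 n2 n3 /smP[u [v [uE vF ->]]] /smP[u' [w [uE' wG e]]].
have [] := iO EO FO GO n1 n3 n2 (OD EO uE uE') vF wG.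
  by rewrite -addrA addrACA e addpp.
by move=> _ -> _; rewrite addr0.
Qed.

(* The tangent space at [E]. *)
Definition tg E : {set pt} := [set x | (x \in E) || [forall F in O, (F != E) ==> (x \notin sm E F)]].

Lemma tg_l E x : x \in E -> x \in tg E.
Proof. by rewrite inE => ->. Qed.
Lemma tgPn E x : x \notin tg E -> x \notin E /\ exists2 F, F \in O & (F != E) && (x \in sm E F).
Proof.
rewrite inE negb_or => /andP[nx /forall_inPn[F FO]]; rewrite negb_imply negbK => h.
by split=> //; exists F.
Qed.
Lemma tg_sm E F x : F \in O -> F != E -> x \in tg E -> x \in sm E F -> x \in E.
Proof.
move=> FO n; rewrite inE => /orP[//|/forall_inP/(_ F FO)/implyP/(_ n) h] s.
by rewrite s in h.
Qed.

(* Every coset of F meets the tangent space at G in exactly one point: of the 16 elements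
   x + b, b in F, exactly 15 lie on the spans of G with the other members. *)
Lemma comp_inj G F x K (K' : {set pt}) (b : pt) : G \in O -> F \in O -> K \in O -> K' \in O -> G != F -> K != G ->
  K != F -> K' != G -> K' != F -> b \in F -> x \notin sm G F ->
  x + b \in sm G K -> x + b \in sm G K' -> K = K'.
Proof.
move=> GO FO KO KO' nGF n1 n2 n3 n4 bF nx s s'; apply/eqP; apply: contraT => n.
have : x + b \in G by apply: (sm_cap GO KO KO' _ _ n s s'); rewrite eq_sym.
move=> xG; case/negP: nx; apply/smP; exists (x + b), b; split=> //.
by rewrite -addrA addpp addr0.
Qed.

(** The sum map on the product of the three members is injective by independence, and both sides
    have 16^3 elements. *)
Lemma full3 G F K x : G \in O -> F \in O -> K \in O -> G != F -> F != K -> G != K ->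
  exists u v w, [/\ u \in G, v \in F, w \in K & x = u + v + w].
Proof.
move=> GO FO KO n1 n2 n3.
pose f (t : pt * pt * pt) := t.1.1 + t.1.2 + t.2.
pose D := setX (setX G F) K.
have fi : {in D &, injective f}.
  move=> [[u v] w] [[u' v'] w']; rewrite !inE /= => /andP[/andP[a b] c] /andP[/andP[a' b'] c'] e.
  have [] := iO GO FO KO n1 n2 n3 (OD GO a a') (OD FO b b') (OD KO c c').
    by rewrite (addrACA u) (addrACA (u + v)) -[u + v + w]/(f (u, v, w)) e addpp.
  by move=> /addp_eq0-> /addp_eq0-> /addp_eq0->.
have : x \in f @: D.
  suff -> : f @: D = setT by rewrite inE.
  apply: subset_card_eq; first exact: subsetT.
  by rewrite cardsT (card_in_imset fi) !card_prod card_q /D !cardsX !O16.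
case/imsetP=> -[[u v] w]; rewrite !inE /= => /andP[/andP[a b] c] ->.
by exists u, v, w.
Qed.

Lemma b_of G F K x : G \in O -> F \in O -> G != F -> K \in O :\ G :\ F ->
  exists b, (b \in F) && (x + b \in sm G K).
Proof.
move=> GO FO n; rewrite !inE => /and3P[nF nG KO].
have nGK : G != K by rewrite eq_sym.
have nFK : F != K by rewrite eq_sym.
have [u [v [w [uG vF wK ->]]]] := full3 x GO FO KO n nFK nGK.
exists v; rewrite vF; apply/smP; exists u, w; split=> //.
by rewrite -addrA [w + v]addrC addrA -(addrA u) addpp addr0.
Qed.

Lemma card_rest G F : G \in O -> F \in O -> G != F -> #|O :\ G :\ F| = 15.
Proof.
move=> GO FO n; have := cO; rewrite (cardsD1 G) GO (cardsD1 F (O :\ G)) !inE FO eq_sym n /=.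
by rewrite !add1n => -[].
Qed.

Section Beta.
Variables (G F : {set pt}) (GO : G \in O) (FO : F \in O) (n : G != F) (x : pt).
Hypothesis nx : x \notin sm G F.
Let beta (K : {set pt}) : pt := odflt 0 [pick b | (b \in F) && (x + b \in sm G K)].

Let betaP K : K \in O :\ G :\ F -> beta K \in F /\ x + beta K \in sm G K.
Proof.
move=> KO; rewrite /beta; case: pickP => [b /andP[]//|h].
by have [b] := b_of x GO FO n KO; rewrite h.
Qed.

Let beta_inj : {in O :\ G :\ F &, injective beta}.
Proof.
move=> K K' KO KO' e; have [bF s] := betaP KO; have [_] := betaP KO'; rewrite -e => s'.
move: KO KO'; rewrite !inE => /and3P[n1 n2 n3] /and3P[n4 n5 n6].
by apply: (comp_inj GO FO n3 n6) s s'.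
Qed.

(** If x lies on no secant span through G, the 15 members other than G and F yield distinct nonzero
    elements of F, hence all 15 of them. *)
Lemma beta_surj b : b \in F -> b != 0 -> (forall K, K \in O -> K != G -> x \notin sm G K) ->
  exists2 K, K \in O & (K != G) && (x + b \in sm G K).
Proof.
move=> bF bn h; have : b \in beta @: (O :\ G :\ F).
  suff -> : beta @: (O :\ G :\ F) = F :\ (0 : pt) by rewrite !inE bn.
  apply: subset_card_eq.
    apply/subsetP=> _ /imsetP[K KO ->]; have [kF s] := betaP KO; rewrite !inE kF andbT.
    move: KO; rewrite !inE => /and3P[_ nG KO]; apply: contraNneq (h K KO nG) => e.
    by move: s; rewrite e addr0.
  rewrite (card_in_imset beta_inj) card_rest //.
  by rewrite cardD0.
case/imsetP=> K KO e; have [_ s] := betaP KO; move: KO; rewrite !inE => /and3P[_ nG KO].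
by exists K => //; rewrite nG e.
Qed.

Lemma beta_free : exists2 b, b \in F & forall K, K \in O -> K != G -> x + b \notin sm G K.
Proof.
have /subsetPn[b bF nb] : ~~ (F \subset beta @: (O :\ G :\ F)).
  apply/negP => /subset_leq_card; rewrite (card_in_imset beta_inj) card_rest // O16 //.
exists b => // K KO nK; case: (eqVneq K F) => [->|nF].
  apply: contra nx => s; rewrite -[x]addr0 -(addpp b) addrA; apply: smD => //.
  by rewrite smC; apply: sm_l.
have KO' : K \in O :\ G :\ F by rewrite !inE nK nF.
apply: contra nb => s; apply/imsetP; exists K => //.
have [bF' s'] := betaP KO'; apply: addp_eq0.
have sG : x + b + (x + beta K) \in G.
  have s2 : x + b + (x + beta K) \in sm G F.
    rewrite addrACA addpp add0r smC; apply: sm_l => //; exact: OD.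
  by apply: (sm_cap GO FO KO n _ _ s2 (smD GO KO s s')); rewrite eq_sym.
rewrite addrACA addpp add0r in sG.
have [] := ind2 GO FO n sG (OD FO bF bF'); first exact: addpp.
by [].
Qed.
End Beta.

(** Suppose x + y = u + w with u in G and w in F. Outside the easy cases w is nonzero, so
    [beta_surj] gives a member K with x + w in G + K. Then y = x + w + u also lies in G + K,
    although y is tangent at G. *)
Lemma tgD G x y : G \in O -> x \in tg G -> y \in tg G -> x + y \in tg G.
Proof.
move=> GO xT yT; apply: contraT => /tgPn[nG [F FO /andP[nF s]]].
have nGF : G != F by rewrite eq_sym.
have half u v : u \in tg G -> v \in tg G -> u \in G -> u + v \in sm G F -> u + v \in G.
  move=> uT vT uG suv; apply: OD => //; apply: (tg_sm FO nF vT).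
  by rewrite -[v]add0r -(addpp u) -addrA; apply: smD => //; apply: sm_l.
case xG: (x \in G); first by rewrite (half x y) in nG.
case yG: (y \in G); first by rewrite addrC (half y x) // addrC in nG.
have free v : v \in tg G -> v \in G = false -> forall K, K \in O -> K != G -> v \notin sm G K.
  move=> vT vG K KO nK; apply/negP => sv; by rewrite (tg_sm KO nK vT sv) in vG.
have [u [w [uG wF e]]] := smP _ _ _ s.
have wn : w != 0 by apply: contraNneq nG => w0; rewrite e w0 addr0.
have [K KO /andP[nK sK]] := beta_surj GO FO nGF (free x xT xG F FO nF) wF wn (free x xT xG).
have /negP[] := free y yT yG K KO nK.
have -> : y = x + w + u by rewrite -[y]add0r -(addpp x) -addrA e [u + w]addrC addrA.
by apply: smD => //; apply: sm_l.
Qed.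

Lemma tg_compl G F x : G \in O -> F \in O -> G != F -> exists2 b, b \in F & x + b \in tg G.
Proof.
move=> GO FO n; case s: (x \in sm G F).
  have [u [v [uG vF ->]]] := smP _ _ _ s; exists v => //.
  by rewrite -addrA addpp addr0; apply: tg_l.
have [b bF h] := beta_free GO FO n (negbT s); exists b => //.
by rewrite inE; apply/orP; right; apply/forall_inP => K KO; apply/implyP; apply: h.
Qed.

Lemma tg_cap E G x : E \in O -> G \in O -> E != G -> x \in E -> x \in tg G -> x = 0.
Proof.
move=> EO GO n xE xT; have xG : x \in G.
  by apply: (tg_sm EO n xT); rewrite smC; apply: sm_l.
by have [] := ind2 EO GO n xE xG (addpp x).
Qed.

(** Otherwise each G would have a partner F with x in G + F, unique by [sm_cap]: a fixed-point-free
    involution on 17 members. *)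
Lemma some_tg x : exists2 G, G \in O & x \in tg G.
Proof.
case: (pickP [pred G | (G \in O) && (x \in tg G)]) => [G /andP[]|h]; first by exists G.
have hn G : G \in O -> x \notin G /\ exists2 F, F \in O & (F != G) && (x \in sm G F).
  by move=> GO; apply: tgPn; have := h G; rewrite /= GO /= => ->.
pose f (G : {set pt}) := odflt set0 [pick F in O | (F != G) && (x \in sm G F)].
have fP G : G \in O -> [/\ f G \in O, f G != G & x \in sm G (f G)].
  move=> GO; rewrite /f; case: pickP => [F /and3P[]//|k].
  by have [_ [F FO s]] := hn G GO; have := k F; rewrite FO s.
have /odd_involution : forall G, G \in O -> [/\ f G \in O, f G != G & f (f G) = G].
  move=> G GO; have [fO fn s] := fP G GO; have [ffO ffn ss] := fP _ fO; split=> //.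
  apply/eqP; apply: contraT => nn; have [nx _] := hn _ fO; case/negP: nx.
  by apply: (sm_cap fO GO ffO) ss; rewrite // 1?eq_sym // smC.
by rewrite cO.
Qed.

(** Double counting over the 255 nonzero points of E + F: each of the 17 tangent spaces contains at
    most 15 of them and each point lies in at least one. Since 17 * 15 = 255, no point lies in
    two. *)
Lemma sm_one E F x : E \in O -> F \in O -> E != F -> x \in sm E F -> x != 0 ->
  forall G G', G \in O -> G' \in O -> x \in tg G -> x \in tg G' -> G = G'.
Proof.
move=> EO FO n xs xn G G' GO GO' xG xG'; apply/eqP; apply: contraT => nGG.
pose L := sm E F :\ (0 : pt).
have cL : #|L| = 255%N.
  have : #|sm E F| = 256%N.
    have -> : sm E F = (fun t : pt * pt => t.1 + t.2 : pt) @: setX E F.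
      apply/setP => y; apply/smP/imsetP => [[u [v [uE vF ->]]]|[[u v]]].
        by exists (u, v); rewrite // inE uE.
      by rewrite inE => /andP[uE vF] ->; exists u, v.
    rewrite card_in_imset ?cardsX ?O16 //.
    move=> [u v] [u' v']; rewrite !inE /= => /andP[a b] /andP[a' b'] e.
    have [] := ind2 EO FO n (OD EO a a') (OD FO b b'); last by move=> /addp_eq0-> /addp_eq0->.
    by rewrite addrACA e addpp.
  by rewrite (cardsD1 (0 : pt)) (sm_l FO (O0 EO)) /= add1n => -[].
have cT K : K \in O -> (#|L :&: tg K| <= 15)%N.
  move=> KO; have bnd (A B : {set pt}) : A \in O -> B \in O -> A != B -> sm A B = sm E F -> K != A ->
      (#|L :&: tg K| <= 15)%N.
    move=> AO BO nAB es nKA.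
    have dec y : y \in sm A B -> exists b, (b \in B) && (y + b \in A).
      by case/smP=> u [v [uA vB ->]]; exists v; rewrite vB -addrA addpp addr0.
    (* Projection of A + B onto B along A. It is injective on the tangent space at K because this
       space meets A only in 0, and it avoids 0 for the same reason. *)
    pose p y : pt := odflt 0 [pick b | (b \in B) && (y + b \in A)].
    have pP y : y \in sm A B -> p y \in B /\ y + p y \in A.
      by move=> sy; rewrite /p; case: pickP => [b /andP[]//|k]; have [b] := dec y sy; rewrite k.
    have sub : p @: (L :&: tg K) \subset B :\ (0 : pt).
      apply/subsetP=> _ /imsetP[y /setIP[/setD1P[yn ys] yT] ->]; rewrite -es in ys.
      have [pB pA] := pP y ys; rewrite in_setD1 pB andbT; apply: contraNneq yn => e.
      by apply/eqP; apply: (tg_cap AO KO) yT; rewrite 1?eq_sym // -[y]addr0 -e.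
    have inj : {in L :&: tg K &, injective p}.
      move=> y z /setIP[/setD1P[_ ys] yT] /setIP[/setD1P[_ zs] zT] e; rewrite -es in ys zs.
      have [_ yA] := pP y ys; have [_ zA] := pP z zs; apply: addp_eq0.
      apply: (tg_cap AO KO); [by rewrite eq_sym| |exact: tgD].
      by have := OD AO yA zA; rewrite addrACA e addpp addr0.
    rewrite -(card_in_imset inj) (leq_trans (subset_leq_card sub)) //.
    by rewrite cardD0.
  case: (eqVneq K E) => [e|nE]; last exact: (bnd E F).
  have nFE : F != E by rewrite eq_sym.
  have nKF : K != F by rewrite e.
  exact: (bnd F E FO EO nFE (smC F E) nKF).
have sum1 : (\sum_(K in O) #|L :&: tg K| <= 255)%N.
  apply: (@leq_trans (\sum_(K in O) 15)); first exact: leq_sum.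
  by rewrite sum_nat_const cO.
have sum2 : (\sum_(K in O) #|L :&: tg K| = \sum_(y in L) \sum_(K in O | y \in tg K) 1)%N.
  rewrite (exchange_big_dep (ssrbool.mem O)) /=; last by move=> y K _ /andP[].
  by apply: eq_bigr => K KO; rewrite sum1_card; apply: eq_card => y; rewrite in_setI [RHS]unfold_in KO.
have xL : x \in L by rewrite in_setD1 xn xs.
have : (256 <= \sum_(y in L) \sum_(K in O | y \in tg K) 1)%N.
  rewrite (bigD1 x) //= (bigD1 G) ?GO //= (bigD1 G') /=; last by rewrite GO' xG' eq_sym.
  have : (254 <= \sum_(y in L | y != x) \sum_(K in O | y \in tg K) 1)%N.
    apply: (@leq_trans (\sum_(y in L | y != x) 1)).
      have c254 : #|L :\ x| = 254%N by apply: (@addnI 1); rewrite -[RHS]cL (cardsD1 x L) xL.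
      rewrite sum1_card -c254.
      by apply: subset_leq_card; apply/subsetP => y /setD1P[n1 n2]; rewrite unfold_in n1 n2.
    apply: leq_sum => y _; have [K KO yK] := some_tg y.
    by rewrite (bigD1 K) ?KO.
  by move=> h; rewrite !addnA -[256%N]/(1 + 1 + 254)%N; apply: leq_add => //; rewrite leq_addr.
by rewrite -sum2 leqNgt ltnS sum1.
Qed.

Lemma nucleus : exists2 N, N \notin O & hyp 18 (N |: O).
Proof.
have [E EO] : exists E, E \in O by have [G GO _] := third set0 set0; exists G.
have [F FO /andP[nFE _]] := third E E; have nEF : E != F by rewrite eq_sym.
have [K KO /andP[nKE nKF]] := third E F.
pose N := tg E :&: tg F.
have N0 : 0 \in N by rewrite !inE !O0.
have ND x y : x \in N -> y \in N -> x + y \in N.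
  by rewrite ![_ \in N]inE => /andP[a b] /andP[c d]; rewrite !tgD.
(* A nonzero point of N on a secant span would lie in two tangent spaces, against [sm_one]. So N is
   independent of any two members. *)
have Nsm A B x : A \in O -> B \in O -> A != B -> x \in sm A B -> x \in N -> x = 0.
  move=> AO BO n s; rewrite inE => /andP[xE xF]; apply/eqP; apply: contraT => xn.
  by have := sm_one AO BO n s xn EO FO xE xF => e; rewrite e eqxx in nEF.
have cN : #|N| = 16.
  (* Correcting k by an element of F and then by one of E brings it into both tangent spaces. Thus N
     and K are both complements of E + F and have the same order. *)
  have lift k : exists n, (n \in N) && (n + k \in sm E F).
    have [f fF kf] := tg_compl k EO FO nEF; have [e eE kfe] := tg_compl (k + f) FO EO nFE.
    exists (k + f + e); rewrite inE kfe (tgD EO kf (tg_l eE)) /=.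
    by apply/smP; exists e, f; split=> //; rewrite addrC !addrA addpp add0r addrC.
  pose p k := xchoose (lift k).
  have pP k : p k \in N /\ p k + k \in sm E F by apply/andP; exact: xchooseP (lift k).
  have pi : {in K &, injective p}.
    move=> k l kK lK e; have [_ s] := pP k; have [_ s'] := pP l; apply: addp_eq0.
    have := smD EO FO s s'; rewrite addrACA e addpp add0r => /smP[u [v [uE vF ek]]].
    have [] := iO EO FO KO nEF (contra_neq (@esym _ _ _) nKF) (contra_neq (@esym _ _ _) nKE) uE vF (OD KO kK lK).
      by rewrite -ek addpp.
    by [].
  rewrite -(O16 KO) -(card_in_imset pi); apply: eq_card => n; apply/idP/imsetP => [nN|[k _ ->]]; last by case: (pP k).
  have [u [v [w [uE vF wK e]]]] := full3 n EO FO KO nEF (contra_neq (@esym _ _ _) nKF) (contra_neq (@esym _ _ _) nKE).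
  exists w => //; apply: addp_eq0; have [pN ps] := pP w.
  apply: (Nsm E F) => //; last exact: ND.
  have -> : n + p w = u + v + (p w + w) by rewrite e -!addrA [w + p w]addrC.
  by apply: smD => //; apply/smP; exists u, v.
have nNO : N \notin O.
  apply/negP => NO; have [G GO /andP[nGN _]] := third N N.
  have [x xN] : exists2 x, x \in N & x != 0.
    have /subsetPn[x xN] : ~~ (N \subset [set (0 : pt)]) by apply/negP => /subset_leq_card; rewrite cN cards1.
    by rewrite inE; exists x.
  by rewrite (Nsm N G x NO GO _ (sm_l GO xN) xN) ?eqxx // eq_sym.
exists N => //; have iN A B x y z : A \in O -> B \in O -> A != B -> x \in N -> y \in A -> z \in B ->
    x + y + z = 0 -> [/\ x = 0, y = 0 & z = 0].
  move=> AO BO n xN yA zB e; have ex : x = y + z by apply: addp_eq0; rewrite addrA.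
  have x0 : x = 0 by apply: (Nsm A B) => //; apply/smP; exists y, z.
  by have [] := ind2 AO BO n yA zB (etrans (esym ex) x0).
split.
- by rewrite cardsU1 nNO cO.
- by move=> A; rewrite !inE => /orP[/eqP->|/sO//]; split.
move=> A B C; rewrite !inE => /orP[/eqP->|AO] /orP[/eqP->|BO] /orP[/eqP->|CO] nAB nBC nAC x y z xA yB zC e;
  rewrite ?eqxx // in nAB nBC nAC.
- exact: (iN B C).
- by have [] := iN A C y x z AO CO nAC yB xA zC; rewrite // addrC [y + x]addrC // addrC.
- by have [] := iN A B z x y AO BO nAB zC xA yB; rewrite // -addrA addrC.
exact: (iO AO BO CO).
Qed.
End Nucleus.

(** * Coordinates over GF(2) and GF(16) *)

Lemma mem_span_closed (K : fieldType) (vT : vectType K) (X : seq vT) (v : vT) :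
  (forall x y, x \in X -> y \in X -> x + y \in X) -> (forall c x, x \in X -> c *: x \in X) ->
  0 \in X -> v \in <<X>>%VS -> v \in X.
Proof.
move=> XD XZ X0 /(@coord_span _ _ _ (in_tuple X)) ->.
by apply: (big_ind (fun w => w \in X)) => // i _; apply: XZ; apply: mem_nth.
Qed.

Lemma sum3_indep (K : fieldType) (vT : vectType K) (U V W : {vspace vT}) :
  \dim (U + V + W) = (\dim U + \dim V + \dim W)%N ->
  forall x y z, x \in U -> y \in V -> z \in W -> x + y + z = 0 -> [/\ x = 0, y = 0 & z = 0].
Proof.
move=> e x y z xU yV zW s.
have c1 := dimv_sum_cap (U + V)%VS W; have c2 := dimv_sum_cap U V.
have d2 : \dim (U :&: V) = 0%N.
  apply/eqP; rewrite -leqn0 -(leq_add2l (\dim (U + V))) c2 addn0.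
  by rewrite -(leq_add2r (\dim W)) -e -c1 leq_addr.
have d1 : \dim ((U + V) :&: W) = 0%N.
  by apply/eqP; rewrite -(eqn_add2l (\dim (U + V + W))) c1 e -c2 d2 !addn0.
have z0 : z = 0.
  apply/eqP; rewrite -memv0; move/eqP: d1; rewrite dimv_eq0 => /eqP <-; rewrite memv_cap zW andbT.
  have -> : z = - (x + y) by apply/eqP; rewrite eq_sym eqr_oppLR -addr_eq0 s.
  by rewrite memvN memv_add.
have y0 : y = 0.
  apply/eqP; rewrite -memv0; move/eqP: d2; rewrite dimv_eq0 => /eqP <-; rewrite memv_cap yV andbT.
  have xy : x + y = 0 by rewrite -[RHS]s z0 addr0.
  have -> : y = - x by apply/eqP; rewrite -addr_eq0 addrC xy.
  by rewrite memvN.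
by split=> //; move: s; rewrite y0 z0 !addr0.
Qed.

Lemma indep_sum3 (K : fieldType) (vT : vectType K) (U V W : {vspace vT}) :
  (forall x y z, x \in U -> y \in V -> z \in W -> x + y + z = 0 -> [/\ x = 0, y = 0 & z = 0]) ->
  \dim (U + V + W) = (\dim U + \dim V + \dim W)%N.
Proof.
move=> h; have c1 := dimv_sum_cap (U + V)%VS W; have c2 := dimv_sum_cap U V.
have d2 : \dim (U :&: V) = 0%N.
  apply/eqP; rewrite dimv_eq0; apply/eqP/vspaceP => v; rewrite memv0 memv_cap.
  apply/andP/eqP => [[vU vV]|->]; last by rewrite !mem0v.
  have nV : - v \in V by rewrite memvN.
  by have [] := h v (- v) 0 vU nV (mem0v _); rewrite ?subrr ?addr0.
have d1 : \dim ((U + V) :&: W) = 0%N.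
  apply/eqP; rewrite dimv_eq0; apply/eqP/vspaceP => v; rewrite memv0 memv_cap.
  apply/andP/eqP => [[/memv_addP[x xU [y yV e]] vW]|->]; last by rewrite !mem0v.
  have nW : - v \in W by rewrite memvN.
  by have [|_ _ /eqP] := h x y (- v) xU yV nW; rewrite ?e ?subrr // oppr_eq0 -e => /eqP.
by rewrite -[LHS]addn0 -d1 c1 -[\dim (U + V)]addn0 -d2 c2.
Qed.

Definition bt (k : nat) (x : q) : bool := odd (q2n x %/ 2 ^ k).
Lemma btD k x y : (k < 4)%N -> bt k (x + y) = bt k x (+) bt k y.
Proof. by case: k => [|[|[|[|//]]]] _; case: x; case: y. Qed.

Lemma F2_addb (a b : bool) : (a (+) b)%:R = a%:R + b%:R :> 'F_2.
Proof. by case: a; case: b; apply/eqP. Qed.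

Definition delta (v : pt) : V2 :=
  \row_i (bt (i %% 4) (if (i < 4)%N then v.1.1 else if (i < 8)%N then v.1.2 else v.2))%:R.

Lemma deltaD : additive_map delta.
Proof.
move=> v w; apply/rowP => i; rewrite !mxE -F2_addb -btD ?ltn_mod //.
by do ![case: ifP => _].
Qed.

Lemma delta_inj : injective delta.
Proof.
move=> v w e; apply: addp_eq0; have := deltaD v w; rewrite e -deltaD addpp {e}.
have -> : delta 0 = 0 by apply: (addrI (delta 0)); rewrite -deltaD !addr0.
move: (v + w) => -[[x y] z] /rowP h.
have B (n : 'I_12) k u : (bt k u)%:R = 0 :> 'F_2 -> bt k u = false by case: (bt k u) => // /eqP.
have ext u : bt 0 u = false -> bt 1 u = false -> bt 2 u = false -> bt 3 u = false -> u = q0 by case: u.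
have g (n : nat) (l : (n < 12)%N) := h (Ordinal l).
have {}g n (l : (n < 12)%N) : bt (n %% 4) (if (n < 4)%N then x else if (n < 8)%N then y else z) = false.
  by apply: (B ord0); have := g n l; rewrite !mxE.
rewrite (ext x (g 0 isT) (g 1 isT) (g 2 isT) (g 3 isT)).
rewrite (ext y (g 4 isT) (g 5 isT) (g 6 isT) (g 7 isT)).
by rewrite (ext z (g 8 isT) (g 9 isT) (g 10 isT) (g 11 isT)).
Qed.

Lemma card_F2 : #|'F_2| = 2%N. Proof. exact: card_Fp. Qed.

Lemma V2_scale (c : 'F_2) (x : V2) : c *: x = 0 \/ c *: x = x.
Proof.
have : (c == 0) || (c == 1) by case: c => -[|[|]].
by case/orP => /eqP->; [left; rewrite scale0r | right; rewrite scale1r].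
Qed.

Lemma delta_bij : bijective delta.
Proof.
apply: inj_card_bij delta_inj _.
by rewrite card_mx !card_prod card_q card_F2.
Qed.

Section Field16.
Variables (F : finFieldType) (hF : #|F| = 16%N).

(** Translation by 1 permutes F, so the sum of all elements equals itself plus 16. *)
Lemma F16_two : 2 = 0 :> F.
Proof.
have e : \sum_(x : F) x = \sum_(x : F) (x + 1).
  by rewrite (reindex_inj (addIr 1)).
have : (16%:R : F) = 0.
  apply: (addrI (\sum_(x : F) x)); rewrite addr0 {2}e big_split /=; congr (_ + _).
  by rewrite sumr_const hF.
by rewrite -[16%N]/(2 ^ 4)%N natrX => /eqP; rewrite expf_eq0 => /eqP.
Qed.

Lemma F16_addxx (x : F) : x + x = 0. Proof. by rewrite -mulr2n -mulr_natr F16_two mulr0. Qed.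
Lemma F16_sqD (x y : F) : (x + y) ^+ 2 = x ^+ 2 + y ^+ 2.
Proof. by rewrite sqrrD -mulr_natr F16_two mulr0 addr0. Qed.
Lemma F16_4D (x y : F) : (x + y) ^+ 4 = x ^+ 4 + y ^+ 4.
Proof. by rewrite -[4%N]/(2 * 2)%N !exprM !F16_sqD. Qed.

(** X^4+X has at most four roots, so b = a^4 + a is nonzero for some a. Then b^4 = a^16 + a^4 = b,
    and (a/b)^4 = (a + b)/b = a/b + 1. *)
Lemma F16_root : exists al : F, al ^+ 4 = al + 1.
Proof.
have [a an] : exists a : F, a ^+ 4 + a != 0.
  case: (pickP (fun a : F => a ^+ 4 + a != 0)) => [a|h]; first by exists a.
  pose p : {poly F} := 'X^4 + 'X.
  have sp : size p = 5%N by rewrite /p size_polyDl size_polyXn ?size_polyX.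
  have pn : p != 0 by rewrite -size_poly_eq0 sp.
  have ar : all (root p) (enum F).
    by apply/allP => x _; have := h x => /negbFE; rewrite /root !hornerE.
  by have := max_poly_roots pn ar (enum_uniq _); rewrite sp -cardE hF.
pose b := a ^+ 4 + a; have b4 : b ^+ 4 = b.
  rewrite /b F16_4D -exprM -[(4 * 4)%N]/16%N -{1}hF expf_card addrC //.
exists (a / b); rewrite expr_div_n b4.
have -> : a ^+ 4 = a + b by rewrite /b addrCA F16_addxx addr0.
by rewrite mulrDl divff.
Qed.

Section Lambda.
Variables (al : F) (hal : al ^+ 4 = al + 1).
Definition lam (x : q) : F :=
  (bt 0 x)%:R + (bt 1 x)%:R * al + (bt 2 x)%:R * al ^+ 2 + (bt 3 x)%:R * al ^+ 3.

Lemma natb (a b : bool) : (a (+) b)%:R = a%:R + b%:R :> F.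
Proof. by case: a; case: b; rewrite /= ?addr0 ?add0r // -[1%:R]/1 F16_addxx. Qed.

Lemma lamD x y : lam (x + y) = lam x + lam y.
Proof. by rewrite /lam !btD // !natb !mulrDl; ring. Qed.

Lemma lam0 : lam 0 = 0. Proof. by rewrite /lam /= !mul0r !addr0. Qed.
Lemma lam1 : lam 1 = 1. Proof. by rewrite /lam /= !mul0r !addr0. Qed.

Lemma lam2 y : lam (q2 * y) = al * lam y.
Proof.
have e : al * al ^+ 3 = al + 1 by rewrite -exprS.
have b0 : bt 0 (q2 * y) = bt 3 y by case: (y).
have b1 : bt 1 (q2 * y) = bt 0 y (+) bt 3 y by case: (y).
have b2 : bt 2 (q2 * y) = bt 1 y by case: (y).
have b3 : bt 3 (q2 * y) = bt 2 y by case: (y).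
rewrite /lam b0 b1 b2 b3 natb.
transitivity ((bt 3 y)%:R * (al + 1) + (bt 0 y)%:R * al + (bt 1 y)%:R * al ^+ 2 + (bt 2 y)%:R * al ^+ 3).
  by ring.
by rewrite -e; ring.
Qed.

(** The x that satisfy this for all y are closed under sums and products and include [q2] by [lam2],
    which generates [q] as a ring. *)
Lemma lamM x y : lam (x * y) = lam x * lam y.
Proof.
pose good x := forall y, lam (x * y) = lam x * lam y.
have gD a b : good a -> good b -> good (a + b).
  by move=> ga gb z; rewrite (mulrDl a b z) (lamD (a * z) (b * z)) (lamD a b) (ga z) (gb z) -mulrDl.
have gM a b : good a -> good b -> good (a * b) by move=> ga gb z; rewrite -mulrA (ga (b * z)) (gb z) (ga b) mulrA.
have g0 : good q0 by move=> z; rewrite -[q0]/(0 : q) mul0r lam0 mul0r.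
have g1 : good q1 by move=> z; rewrite -[q1]/(1 : q) mul1r lam1 mul1r.
have g2 : good q2 by move=> z; rewrite lam2; congr (_ * _); rewrite -[q2]mulr1 lam2 lam1 mulr1.
have g4 : good q4 := gM _ _ g2 g2.
have g8 : good q8 := gM _ _ g2 g4.
have g3 : good q3 := gD _ _ g1 g2.
have g5 : good q5 := gD _ _ g1 g4.
have g6 : good q6 := gD _ _ g2 g4.
have g7 : good q7 := gD _ _ g3 g4.
suff : good x by [].
case: x => //; [exact: (gD _ _ g1 g8)|exact: (gD _ _ g2 g8)|exact: (gD _ _ g3 g8)|exact: (gD _ _ g4 g8)
 |exact: (gD _ _ g5 g8)|exact: (gD _ _ g6 g8)|exact: (gD _ _ g7 g8)].
Qed.

Lemma lam_eq0 x : lam x = 0 -> x = 0.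
Proof.
move=> e; apply/eqP; apply: contraT => xn.
by have /eqP := lamM x (qdiv 1 x); rewrite qdivK // lam1 e mul0r oner_eq0.
Qed.

Lemma lam_bij : bijective lam.
Proof.
apply: inj_card_bij; last by rewrite card_q hF.
by move=> x y e; apply/eqP; rewrite -addq_eq0; apply/eqP/lam_eq0; rewrite lamD e F16_addxx.
Qed.
End Lambda.
End Field16.
Opaque lam.

(** * From subspaces to subgroups *)

(** The scalars of GF(2) are 0 and 1, so a set closed under addition and containing 0 is its own
    span. Hence the spans in [vimg] and [vimg2] add nothing to the images. *)
Lemma mem_span_map (T : zmodType) (f : T -> V2) (s : seq T) (v : V2) : additive_map f ->
  0 \in s -> (forall x y, x \in s -> y \in s -> x + y \in s) ->
  v \in <<map f s>>%VS -> v \in map f s.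
Proof.
move=> fD s0 sD; have f0 : f 0 = 0 by apply: (addrI (f 0)); rewrite -fD !addr0.
have z : 0 \in map f s by apply/mapP; exists 0.
apply: mem_span_closed => // [_ _ /mapP[x xs ->] /mapP[y ys ->]|c w ws].
  by rewrite -fD map_f // sD.
by case: (V2_scale c w) => ->.
Qed.

Lemma mem_vimg2 (g : V2 -> V2) U x : additive_map g -> injective g -> (g x \in vimg2 g U) = (x \in U).
Proof.
move=> gD gi; apply/idP/idP => [h|xU]; last first.
  by apply: memv_span; apply: map_f; rewrite mem_filter xU mem_enum.
have fE y : (y \in [seq x <- enum V2 | x \in U]) = (y \in U) by rewrite mem_filter mem_enum andbT.
have /mapP[y] : g x \in map g [seq x <- enum V2 | x \in U].
  apply: mem_span_map h => // [|y z]; first by rewrite fE mem0v.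
  by rewrite !fE => yU zU; rewrite memvD.
by rewrite fE => yU /gi ->.
Qed.

Lemma mem_vimg (F : finFieldType) (g : 'rV[F]_3 -> V2) U x : additive_map g -> injective g ->
  (g x \in vimg g U) = (x \in U).
Proof.
move=> gD gi; apply/idP/idP => [h|xU]; last first.
  by apply: memv_span; apply: map_f; rewrite mem_filter xU mem_enum.
have fE y : (y \in [seq x <- enum 'rV[F]_3 | x \in U]) = (y \in U) by rewrite mem_filter mem_enum andbT.
have /mapP[y] : g x \in map g [seq x <- enum 'rV[F]_3 | x \in U].
  apply: mem_span_map h => // [|y z]; first by rewrite fE mem0v.
  by rewrite !fE => yU zU; rewrite memvD.
by rewrite fE => yU /gi ->.
Qed.

Lemma additive_inv (A B : zmodType) (f : A -> B) g : additive_map f -> cancel f g -> cancel g f ->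
  additive_map g.
Proof. by move=> fD fg gf x y; apply: (can_inj fg); rewrite fD !gf. Qed.

Lemma dimV2 : \dim (fullv : {vspace V2}) = 12%N. Proof. by rewrite dimvf. Qed.

Definition member (U : {vspace V2}) : {set pt} := [set x | delta x \in U].
Definition members (P : 'I_17 -> {vspace V2}) : {set {set pt}} := [set member (P i) | i : 'I_17].

Lemma member_inj : injective member.
Proof.
move=> U W e; apply/vspaceP => v; have [th td dt] := delta_bij.
by have := congr1 (fun A : {set pt} => th v \in A) e; rewrite !inE dt.
Qed.

Lemma card_member U : #|member U| = (2 ^ \dim U)%N.
Proof.
transitivity (#|'F_2| ^ \dim U)%N; last by rewrite card_F2.
rewrite -card_vspace -(card_imset (member U) delta_inj); apply: eq_card => v.
have [th td dt] := delta_bij.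
apply/imsetP/idP => [[x]|vU]; first by rewrite inE => xU ->.
by exists (th v); rewrite ?inE dt.
Qed.

Lemma delta0 : delta 0 = 0.
Proof. by apply: (addrI (delta 0)); rewrite -deltaD !addr0. Qed.

Lemma members_hyp P : is_pseudo_oval P -> hyp 17 (members P).
Proof.
move=> [Pi Pd Ps]; split.
- by rewrite card_imset ?card_ord // => i j /member_inj/Pi.
- move=> _ /imsetP[i _ ->]; split; first by rewrite inE delta0 mem0v.
    by move=> x y; rewrite !inE deltaD => xP yP; rewrite memvD.
  by rewrite card_member Pd.
move=> _ _ _ /imsetP[i _ ->] /imsetP[j _ ->] /imsetP[k _ ->] nij njk nik x y z.
rewrite !inE => xi yj zk e.
have dn (a b : 'I_17) : member (P a) != member (P b) -> a != b by apply: contra_neq => ->.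
have d : \dim (P i + P j + P k) = (\dim (P i) + \dim (P j) + \dim (P k))%N.
  by rewrite Ps ?dn // dimV2 !Pd.
have [] := sum3_indep d xi yj zk; first by rewrite -!deltaD e delta0.
have z0 (u : pt) : delta u = 0 -> u = 0 by move=> eu; apply: delta_inj; rewrite eu delta0.
by move=> /z0-> /z0-> /z0->.
Qed.

Lemma pequivI P Q g : injective P -> iso g -> im g (members P) = members Q -> pequiv P Q.
Proof.
move=> Pi ig e; have [th td dt] := delta_bij; have [gD gi] := ig.
have thD : additive_map th := additive_inv deltaD td dt.
pose G v := delta (g (th v)).
have GD : additive_map G by move=> x y; rewrite /G thD gD deltaD.
have Gi : injective G by move=> x y /delta_inj/gi/(can_inj dt).
have [G' GG' G'G] := injF_bij Gi.
have ex i : exists j, g @: member (P i) == member (Q j).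
  have : g @: member (P i) \in members Q by rewrite -e; apply: imset_f; apply: imset_f.
  by case/imsetP=> j _ ->; exists j.
(* Members are compared as sets, so the permutation of indices has to be recovered; it is injective
   because P, [member] and the image under g are. *)
pose s0 i := xchoose (ex i).
have s0P i : g @: member (P i) = member (Q (s0 i)) by apply/eqP; exact: (xchooseP (ex i)).
have s0i : injective s0.
  move=> i j eij; apply: Pi; apply: member_inj; apply: (imset_inj gi).
  by rewrite !s0P eij.
exists G; split=> //; first by exists G'.
exists (perm s0i) => i; rewrite permE; apply/vspaceP => v; rewrite -(G'G v) mem_vimg2 //.
have := congr1 (fun A : {set pt} => g (th (G' v)) \in A) (s0P i).
by rewrite (mem_imset _ _ gi) !inE dt => ->.
Qed.

Lemma members_classification P : is_pseudo_oval P -> exists g, iso g /\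
  [\/ im g (members P) = D1, im g (members P) = D2 | im g (members P) = D3].
Proof.
move=> hP; have [N nN hN] := nucleus (members_hyp hP).
have [g [ig sg]] := frame hN.
have c : Concl (N |: members P) fls := ConclI ig (hyperovals sg).
have [|h [ih]] := ovals hN c (_ : N \in N |: members P); first by rewrite !inE eqxx.
by rewrite setU1K //; exists h.
Qed.

Lemma third_index (i j : 'I_17) : exists k, (k != i) && (k != j).
Proof.
have /subsetPn[k _] : ~~ ([set: 'I_17] \subset [set i; j]).
  by apply/negP => /subset_leq_card; rewrite cardsT card_ord cards2; case: (_ == _).
by rewrite !inE negb_or; exists k.
Qed.

Section Points.
Variables (F : finFieldType) (hF : #|F| = 16%N).

Lemma dimF3 : \dim (fullv : {vspace 'rV[F]_3}) = 3%N. Proof. by rewrite dimvf. Qed.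

Lemma oval_indep (O : 'I_17 -> {vspace 'rV[F]_3}) i j k : is_oval O -> i != j -> j != k -> i != k ->
  forall x y z, x \in O i -> y \in O j -> z \in O k -> x + y + z = 0 -> [/\ x = 0, y = 0 & z = 0].
Proof.
move=> [_ Od Os] nij njk nik; apply: sum3_indep.
by rewrite Os // dimF3 !Od.
Qed.

Lemma arises_pseudo_oval P (O : 'I_17 -> {vspace 'rV[F]_3}) : is_oval O -> arises_from P O ->
  is_pseudo_oval P.
Proof.
move=> hO [phi [pD pb [s sP]]]; have [Oi Od Os] := hO; have pi := bij_inj pb; have [ph pp' p'p] := pb.
have PE j : P j = vimg phi (O (s^-1 j)%g) by rewrite sP permKV.
have mP j x : (phi x \in P j) = (x \in O (s^-1 j)%g) by rewrite PE mem_vimg.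
have dP j : \dim (P j) = 4%N.
  apply: (@expnI 2) => //; rewrite -card_member.
  have -> : #|member (P j)| = #|O (s^-1 j)%g|.
    have [th td dt] := delta_bij.
    have inj : injective (fun x => th (phi x)) by move=> x y /(can_inj dt)/pi.
    rewrite -(card_imset _ inj); apply: eq_card => v; rewrite inE.
    apply/idP/imsetP => [vP|[x xO ->]]; last by rewrite dt mP.
    by exists (ph (delta v)); rewrite ?p'p ?td // -mP p'p.
  by rewrite card_vspace Od hF.
split=> // [i j e|i j k nij njk nik].
  apply: (@perm_inj _ s^-1%g); apply: Oi; apply/vspaceP => x; by rewrite -!mP e.
apply/eqP; rewrite eqEdim subvf dimV2 indep_sum3 ?dP //.
move=> x y z; rewrite -(p'p x) -(p'p y) -(p'p z) !mP => xO yO zO; rewrite -!pD => e.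
have p0 : phi 0 = 0 by apply: (addrI (phi 0)); rewrite -pD !addr0.
have n2 a b : a != b -> (s^-1 a)%g != (s^-1 b)%g by rewrite (inj_eq perm_inj).
have [|-> -> ->//] := oval_indep hO (n2 _ _ nij) (n2 _ _ njk) (n2 _ _ nik) xO yO zO.
by apply: pi; rewrite e p0.
Qed.

Lemma arises_pequiv P Q (O : 'I_17 -> {vspace 'rV[F]_3}) : pequiv P Q -> arises_from Q O ->
  arises_from P O.
Proof.
move=> [g [gD gb [s sP]]] [f [fD fb [t tP]]].
have [g' gg' g'g] := gb; have [f' ff' f'f] := fb.
have g'D := additive_inv gD gg' g'g.
exists (fun x => g' (f x)); split.
- by move=> x y; rewrite fD g'D.
- by exists (fun y => f' (g y)) => x /=; rewrite ?g'g ?ff' // f'f gg'.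
exists (t * s^-1)%g => i; rewrite permM; apply/vspaceP => v.
pose x := f' (g v); have -> : v = g' (f x) by rewrite /x f'f gg'.
rewrite (@mem_vimg F (fun x => g' (f x))); last 2 first.
- by move=> a b; rewrite fD g'D.
- by move=> a b /(can_inj g'g)/(can_inj ff').
rewrite -(@mem_vimg2 g) //; last exact: can_inj gg'.
by rewrite sP permKV g'g -tP mem_vimg //; exact: can_inj ff'.
Qed.

(** Passing through the two identifications turns an equivalence of pseudo-ovals into a map of F^3
    that is so far only additive; its semilinearity is proved later from the ovals. *)
Lemma equiv_additive P Q (O O' : 'I_17 -> {vspace 'rV[F]_3}) : pequiv P Q -> arises_from P O ->
  arises_from Q O' -> exists h : 'rV[F]_3 -> 'rV[F]_3, [/\ additive_map h, bijective h &
    exists s : {perm 'I_17}, forall i x, (h x \in O' (s i)) = (x \in O i)].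
Proof.
move=> e aP aQ; have [f [fD fb [s sP]]] := aP; have [f' [f'D f'b [t tP]]] := arises_pequiv e aQ.
have [k kf fk] := f'b; have kD := additive_inv f'D kf fk; have [f1 ff1 f1f] := fb.
exists (fun x => k (f x)); split.
- by move=> x y; rewrite fD kD.
- by exists (fun y => f1 (f' y)) => x /=; rewrite ?fk ?ff1 // f1f kf.
exists (s * t^-1)%g => i x; rewrite permM -(mem_vimg _ _ f'D (can_inj kf)) tP permKV fk -sP.
by rewrite mem_vimg //; exact: can_inj ff1.
Qed.

Section Coordinates.
Variables (al : F) (hal : al ^+ 4 = al + 1).
Let lamD := lamD hF al.
Let lam0 := lam0 al.
Let lamM := lamM hF hal.
Let lam_bij := lam_bij hF hal.

Definition vec (w : pt) : 'rV[F]_3 := \row_i lam al (nth 0 [:: w.1.1; w.1.2; w.2] i).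

Lemma vecD : additive_map vec.
Proof.
move=> [[x y] z] [[x' y'] z']; apply/rowP => -[[|[|[|//]]] i]; by rewrite !mxE /= -lamD.
Qed.
Lemma vecZ x w : vec (x * w.1.1, x * w.1.2, x * w.2) = lam al x *: vec w.
Proof. by apply/rowP => -[[|[|[|//]]] i]; rewrite !mxE /= lamM. Qed.
Lemma vec_inj : injective vec.
Proof.
move=> [[x y] z] [[x' y'] z'] /rowP h.
have := h (inord 0); have := h (inord 1); have := h (inord 2); rewrite !mxE !inordK //=.
by move=> /(bij_inj lam_bij)-> /(bij_inj lam_bij)-> /(bij_inj lam_bij)->.
Qed.
Lemma vec_bij : bijective vec.
Proof. by apply: inj_card_bij vec_inj _; rewrite card_mx !card_prod card_q hF. Qed.
Lemma vec0 : vec 0 = 0.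
Proof. by apply: (addrI (vec 0)); rewrite -vecD !addr0. Qed.
Lemma vec_eq0 w : (vec w == 0) = (w == 0).
Proof. by rewrite -vec0 (inj_eq vec_inj). Qed.

Lemma mem_vec_line w v : (vec v \in <[vec w]>%VS) = (v \in line w).
Proof.
apply/vlineP/lineP => [[k]|[x ->]]; last by exists (lam al x); rewrite vecZ.
have [li l1 l2] := lam_bij; rewrite -(l2 k) -vecZ => /vec_inj ->; by exists (li k).
Qed.

Lemma identification : exists phi : 'rV[F]_3 -> V2,
  [/\ additive_map phi, bijective phi & forall w, phi (vec w) = delta w].
Proof.
have [v' vv' v'v] := vec_bij; have v'D := additive_inv vecD vv' v'v.
exists (fun x => delta (v' x)); split=> [x y||w]; [by rewrite v'D deltaD| |by rewrite vv'].
by have [th td dt] := delta_bij; exists (fun y => vec (th y)) => x; rewrite ?td ?v'v // vv' dt.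
Qed.

Definition points (L : seq pt) (i : 'I_17) : {vspace 'rV[F]_3} := <[vec (nth 0%R L i)]>%VS.

Definition arcb (L : seq pt) : bool :=
  alls (fun i => alls (fun j => alls (fun k =>
    if eqn i j then true else if eqn j k then true else if eqn i k then true else
    if qeq (detM (nth (q0, q0, q0) L i, nth (q0, q0, q0) L j, nth (q0, q0, q0) L k)) q0 then false else true)
    (iota 0 17)) (iota 0 17)) (iota 0 17).

Lemma mem_iota17 (i : 'I_17) : mem (i : nat) (iota 0 17).
Proof.
have mem_in (r : seq nat) x : x \in r -> mem x r.
  by elim: r => //= y r IH; rewrite inE => /orP[/eqP->|/IH]; [left | right].
by apply: mem_in; rewrite mem_iota ltn_ord.
Qed.

Lemma points_indep L i j k : arcb L -> i != j -> j != k -> i != k ->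
  forall x y z, x \in points L i -> y \in points L j -> z \in points L k -> x + y + z = 0 ->
  [/\ x = 0, y = 0 & z = 0].
Proof.
move=> a nij njk nik x y z; have [li l1 l2] := lam_bij.
have d : detM (nth 0 L i, nth 0 L j, nth 0 L k) != 0.
  have := allsP (allsP (allsP a (mem_iota17 i)) (mem_iota17 j)) (mem_iota17 k).
  rewrite /= !eqnE -![_ == _ :> nat]/(_ == _ :> 'I_17) (negPf nij) (negPf njk) (negPf nik).
  by case: qeqP => // /eqP.
move=> /vlineP[a1 ->] /vlineP[a2 ->] /vlineP[a3 ->].
rewrite -(l2 a1) -(l2 a2) -(l2 a3) -!vecZ -!vecD => /eqP; rewrite vec_eq0 => /eqP e.
(* With exponent 0 there is no Frobenius: this is the matrix whose rows are the three points, and a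
   dependency between them is a vector of its kernel. *)
have [_ gi] := iso_gmap 0 d.
have e0 : gmap 0 (nth 0 L i, nth 0 L j, nth 0 L k) (li a1, li a2, li a3) = 0.
  move: e; rewrite /gmap /apM /frobp /=; case: (nth 0 L i) => [[? ?] ?]; case: (nth 0 L j) => [[? ?] ?].
  by case: (nth 0 L k) => [[? ?] ?] <-; rewrite -[RHS]addrA.
have [-> -> ->] : (li a1, li a2, li a3) = 0 by apply: gi; rewrite e0 (iso0 (iso_gmap 0 d)).
by split; rewrite -[X in vec X = _]/((0 * _, 0 * _, 0 * _)) vecZ lam0 scale0r.
Qed.

Lemma points_oval L : arcb L -> (forall i : 'I_17, nth 0 L i != 0) -> is_oval (points L).
Proof.
move=> a nz; have d1 i : \dim (points L i) = 1%N by rewrite dim_vline vec_eq0 nz.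
have ind := @points_indep L _ _ _ a; split=> // [i j e|i j k nij njk nik]; last first.
  apply/eqP; rewrite eqEdim subvf dimF3 indep_sum3 ?d1 //; exact: ind.
apply/eqP; apply: contraT => nij; have [k /andP[nki nkj]] := third_index i j.
have xi : vec (nth 0 L i) \in points L i by apply/vlineP; exists 1; rewrite scale1r.
have xj : - vec (nth 0 L i) \in points L j by rewrite memvN -e.
have njk : j != k by rewrite eq_sym.
have nik : i != k by rewrite eq_sym.
have s0 : vec (nth 0 L i) - vec (nth 0 L i) + 0 = 0 by rewrite subrr addr0.
have [/eqP] := points_indep a nij njk nik xi xj (mem0v _) s0.
by rewrite vec_eq0 (negPf (nz i)).
Qed.

Lemma members_points L (phi : 'rV[F]_3 -> V2) : additive_map phi -> bijective phi ->
  (forall w, phi (vec w) = delta w) ->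
  members (fun i => vimg phi (points L i)) = [set line (nth 0 L i) | i : 'I_17].
Proof.
move=> pD pb pv; apply: eq_imset => i; apply/setP => x; rewrite inE -pv mem_vimg //; last exact: bij_inj pb.
exact: mem_vec_line.
Qed.
End Coordinates.
End Points.

(** * The three representative ovals as lists of points *)

Definition opts (w0 : pt) (f : tb q) : seq pt := w0 :: [seq (q1, c, ap f c) | c <- qs].
(** Position 0 holds the extra point w0, so the affine point with parameter c is shifted by one. *)
Definition ix (c : q) : 'I_17 := inord (q2n c).+1.

Lemma q2n_lt c : (q2n c < 16)%N. Proof. by case: c. Qed.
Lemma ixE c : ix c = (q2n c).+1 :> nat. Proof. by rewrite inordK // ltnS q2n_lt. Qed.
Lemma ix_inj : injective ix.
Proof. by move=> c d /(congr1 val); rewrite /= !ixE => -[] /(can_inj q2nK). Qed.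
Lemma nth_ix w0 f c : nth 0 (opts w0 f) (ix c) = (1, c, ap f c).
Proof. by rewrite ixE -[LHS]/(nth 0 [seq (q1, c, ap f c) | c <- qs] (q2n c)) (nth_map q0) ?q2n_lt // q2nK. Qed.
Lemma ixP (i : 'I_17) : i = ord0 \/ exists c, i = ix c.
Proof.
case: i => -[|m] lm; [by left; apply: val_inj | right; exists (nth q0 qs m)].
apply: val_inj; rewrite /= ixE; congr _.+1.
by move: lm; do 16![case: m => [//|m]].
Qed.

Lemma opts_nz w0 f (i : 'I_17) : w0 != 0 -> nth 0 (opts w0 f) i != 0.
Proof. by move=> n; case: (ixP i) => [->//|[c ->]]; rewrite nth_ix. Qed.

Lemma std_opts2 f : std f :\ E2 = [set line (nth 0 (opts (0, 0, 1) f) i) | i : 'I_17].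
Proof.
apply/setP => E; rewrite !inE; apply/idP/imsetP => [|[i _ ->]].
  case/andP=> n /orP[/orP[|]|]; [by rewrite (negPf n) | by move/eqP->; exists ord0; rewrite //= line_E3 |].
  by case/imsetP=> c _ ->; exists (ix c); rewrite // nth_ix line_gr.
case: (ixP i) => [->|[c ->]]; first by rewrite /= -line_E3 eqxx orbT eq_sym E2_nE3.
by rewrite nth_ix -line_gr gr_nE2; apply/orP; right; apply: imset_f.
Qed.
Lemma std_opts3 f : std f :\ E3 = [set line (nth 0 (opts (0, 1, 0) f) i) | i : 'I_17].
Proof.
apply/setP => E; rewrite !inE; apply/idP/imsetP => [|[i _ ->]].
  case/andP=> n /orP[/orP[|]|]; [by move/eqP->; exists ord0; rewrite //= line_E2 | by rewrite (negPf n) |].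
  by case/imsetP=> c _ ->; exists (ix c); rewrite // nth_ix line_gr.
case: (ixP i) => [->|[c ->]]; first by rewrite /= -line_E2 eqxx E2_nE3.
by rewrite nth_ix -line_gr gr_nE3; apply/orP; right; apply: imset_f.
Qed.

Lemma arc1 : arcb (opts (0, 0, 1) freg).
Proof. by vm_compute. Qed.
Lemma arc2 : arcb (opts (0, 1, 0) freg).
Proof. by vm_compute. Qed.
Lemma arc3 : arcb (opts (0, 1, 0) fls).
Proof. by vm_compute. Qed.

(** * Additive maps between ovals *)

Section Semilinear.
Variables (F : finFieldType) (hF : #|F| = 16%N).
Notation V := 'rV[F]_3.
Implicit Types (O : 'I_17 -> {vspace V}) (U : {vspace V}).

Lemma dim1P U : \dim U = 1%N -> exists2 v, v != 0 & U = <[v]>%VS.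
Proof.
move=> d; have n : vpick U != 0 by rewrite vpick0 -dimv_eq0 d.
exists (vpick U) => //; apply/eqP; rewrite eq_sym eqEdim d dim_vline n.
by rewrite -memvE memv_pick.
Qed.

Lemma dim1_line U v : \dim U = 1%N -> v \in U -> v != 0 -> U = <[v]>%VS.
Proof.
move=> d vU n; apply/eqP; rewrite eq_sym eqEdim d dim_vline n.
by rewrite -memvE vU.
Qed.

(** A translate by t outside G would be disjoint from G, and the two together would exceed 16
    elements. *)
Lemma big_subgroup (G : {set F}) : (forall x y, x \in G -> y \in G -> x + y \in G) -> (8 < #|G|)%N ->
  forall t, t \in G.
Proof.
move=> GD c t; apply: contraT => nt.
have dj : [disjoint G & [set t + x | x in G]].
  apply/pred0P => y; apply/negP => /andP[/= yG /imsetP[x xG e]]; case/negP: nt.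
  have -> : t = y + x by rewrite e -addrA F16_addxx // addr0.
  exact: GD.
have : (#|G :|: [set (t + x)%R | x in G]| <= 16)%N by rewrite -hF max_card.
rewrite cardsU disjoint_setI0 // cards0 subn0 card_imset; last exact: addrI.
by rewrite leqNgt; case/negP; apply: leq_trans (leq_add c c).
Qed.

Section Additive.
Variables (O O' : 'I_17 -> {vspace V}) (h : V -> V) (s : {perm 'I_17}).
Hypotheses (hO : is_oval O) (hO' : is_oval O') (hD : additive_map h) (hi : injective h).
Hypothesis hs : forall i x, (h x \in O' (s i)) = (x \in O i).
Let dO i : \dim (O i) = 1%N. Proof. by case: hO. Qed.
Let dO' i : \dim (O' i) = 1%N. Proof. by case: hO'. Qed.
Let h0 : h 0 = 0. Proof. by apply: (addrI (h 0)); rewrite -hD !addr0. Qed.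
Let h_eq0 x : (h x == 0) = (x == 0). Proof. by rewrite -{1}h0 (inj_eq hi). Qed.
Let ind (P : 'I_17 -> {vspace V}) i j k : is_oval P -> i != j -> j != k -> i != k ->
  forall x y z, x \in P i -> y \in P j -> z \in P k -> x + y + z = 0 -> [/\ x = 0, y = 0 & z = 0].
Proof.
move=> [_ Od Os] nij njk nik; apply: sum3_indep.
by rewrite Os // dimvf !Od.
Qed.
Let sn i j : i != j -> s i != s j. Proof. by rewrite (inj_eq perm_inj). Qed.

Lemma scal_ex i x c : x \in O i -> x != 0 -> exists k, h (c *: x) == k *: h x.
Proof.
move=> xO xn; have hx : h x \in O' (s i) by rewrite hs.
have hxn : h x != 0 by rewrite h_eq0.
have : h (c *: x) \in O' (s i) by rewrite hs memvZ.
by rewrite (dim1_line (dO' _) hx hxn) => /vlineP[k ->]; exists k.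
Qed.

(** Since v spans a point of the oval, h (c v) is a multiple t of h v. Comparing components in three
    independent image points shows that x, y and z are all scaled by t. *)
Lemma scal_same i j k l x y z v c a : i != j -> j != k -> i != k -> l != i -> l != j -> l != k ->
  x \in O i -> y \in O j -> z \in O k -> v \in O l -> v != 0 -> v = x + y + z ->
  h (c *: x) = a *: h x -> x != 0 ->
  h (c *: y) = a *: h y /\ h (c *: z) = a *: h z.
Proof.
move=> nij njk nik nli nlj nlk xO yO zO vO vn e hx xn.
have ex j' y' : y' \in O j' -> exists b, h (c *: y') = b *: h y'.
  have [->|yn yO'] := eqVneq y' 0; first by exists 0; rewrite scaler0 h0 scaler0.
  by have [b /eqP] := scal_ex c yO' yn; exists b.
have [b hy] := ex _ _ yO; have [d hz] := ex _ _ zO; have [t hv] := ex _ _ vO.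
have mem i' x' k' : x' \in O i' -> k' *: h x' \in O' (s i') by move=> m; rewrite memvZ ?hs.
have [] := ind hO' (sn nij) (sn njk) (sn nik) (mem _ _ (a - t) xO) (mem _ _ (b - t) yO) (mem _ _ (d - t) zO).
  have := hv; rewrite e !scalerDr !hD hx hy hz => /eqP; rewrite -subr_eq0 => /eqP <-.
  by rewrite !scalerBl !scalerDr !opprD; rewrite [RHS]addrACA [X in X + _ = _]addrACA.
move=> /eqP; rewrite scaler_eq0 h_eq0 (negPf xn) orbF subr_eq0 => /eqP at_.
move=> /eqP; rewrite scalerBl subr_eq0 => /eqP h1 /eqP; rewrite scalerBl subr_eq0 => /eqP h2.
by rewrite hy hz h1 h2 at_.
Qed.

Lemma oval_map_semilinear : exists sg : {rmorphism F -> F}, forall c x, h (c *: x) = sg c *: h x.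
Proof.
pose i0 : 'I_17 := inord 0; pose i1 : 'I_17 := inord 1; pose i2 : 'I_17 := inord 2.
have n01 : i0 != i1 by rewrite -val_eqE /= !inordK.
have n12 : i1 != i2 by rewrite -val_eqE /= !inordK.
have n02 : i0 != i2 by rewrite -val_eqE /= !inordK.
have dec v : exists x y z, [/\ x \in O i0, y \in O i1, z \in O i2 & v = x + y + z].
  have : v \in (O i0 + O i1 + O i2)%VS by case: hO => _ _ ->; rewrite ?memvf.
  by case/memv_addP=> _ /memv_addP[x xO [y yO ->]] [z zO ->]; exists x, y, z.
have nz l v x y z : l != i0 -> l != i1 -> l != i2 -> v \in O l -> v != 0 ->
    x \in O i0 -> y \in O i1 -> z \in O i2 -> v = x + y + z -> [/\ x != 0, y != 0 & z != 0].
  move=> n0 n1 n2 vO vn xO yO zO e; have nvO : - v \in O l by rewrite memvN.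
  have e0 : x + y + z - v = 0 by rewrite e subrr.
  split; apply: contraNneq vn => w0; rewrite w0 ?add0r ?addr0 in e0; rewrite -oppr_eq0; apply/eqP.
  - by have [] := ind hO n12 (_ : i2 != l) (_ : i1 != l) yO zO nvO e0; rewrite 1?eq_sym.
  - by have [] := ind hO n02 (_ : i2 != l) (_ : i0 != l) xO zO nvO e0; rewrite 1?eq_sym.
  by have [] := ind hO n01 (_ : i1 != l) (_ : i0 != l) xO yO nvO e0; rewrite 1?eq_sym.
pose i3 : 'I_17 := inord 3.
have n30 : i3 != i0 by rewrite -val_eqE /= !inordK.
have n31 : i3 != i1 by rewrite -val_eqE /= !inordK.
have n32 : i3 != i2 by rewrite -val_eqE /= !inordK.
(* Decomposing a vector of a fourth point gives a basis e1, e2, e3 with e1 + e2 + e3 on the oval, so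
   all three share the character [chi]. *)
have [v vn eO3] := dim1P (dO i3).
have vO : v \in O i3 by rewrite eO3 memv_line.
have [e1 [e2 [e3 [m1 m2 m3 ev]]]] := dec v.
have [z1 z2 z3] := nz _ _ _ _ _ n30 n31 n32 vO vn m1 m2 m3 ev.
pose chi c := xchoose (scal_ex c m1 z1).
have chi1 c : h (c *: e1) = chi c *: h e1 by apply/eqP; exact: (xchooseP (scal_ex c m1 z1)).
have chi23 c := scal_same n01 n12 n02 n30 n31 n32 m1 m2 m3 vO vn ev (chi1 c) z1.
have chi2 c : h (c *: e2) = chi c *: h e2 by case: (chi23 c).
have chi3 c : h (c *: e3) = chi c *: h e3 by case: (chi23 c).
have he1 : h e1 != 0 by rewrite h_eq0.
have he2 : h e2 != 0 by rewrite h_eq0.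
have canc (w : V) (a b : F) : w != 0 -> a *: w = b *: w -> a = b.
  by move=> wn /eqP; rewrite -subr_eq0 -scalerBl scaler_eq0 (negPf wn) orbF subr_eq0 => /eqP.
have chiD a b : chi (a + b) = chi a + chi b.
  by apply: (canc _ _ _ he1); rewrite -chi1 scalerDl hD !chi1 scalerDl.
have chi_1 : chi 1 = 1 by apply: (canc _ _ _ he1); rewrite -chi1 !scale1r.
(* If e1 + b e2 + d e3 is on the oval, [scal_same] applied with b e2 instead of e2 gives chi (c b) =
   chi c chi b, so b lies in G. *)
pose G := [set a | [forall c, chi (c * a) == chi c * chi a]].
have GP a : reflect (forall c, chi (c * a) = chi c * chi a) (a \in G).
  by rewrite inE; apply: (iffP forallP) => k c; apply/eqP; apply: k.
have coord l : l != i0 -> l != i1 -> l != i2 -> exists b, (b \in G) && [exists d, e1 + b *: e2 + d *: e3 \in O l].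
  move=> n0 n1 n2; have [w wn eOl] := dim1P (dO l).
  have wO : w \in O l by rewrite eOl memv_line.
  have [x [y [z [xO yO zO ew]]]] := dec w.
  have [xn yn zn] := nz _ _ _ _ _ n0 n1 n2 wO wn xO yO zO ew.
  have [a ea] : exists a, x = a *: e1 by apply/vlineP; rewrite -(dim1_line (dO i0) m1 z1).
  have [b eb] : exists b, y = b *: e2 by apply/vlineP; rewrite -(dim1_line (dO i1) m2 z2).
  have [d ed] : exists d, z = d *: e3 by apply/vlineP; rewrite -(dim1_line (dO i2) m3 z3).
  have an : a != 0 by apply: contraNneq xn => a0; rewrite ea a0 scale0r.
  have ew' : a^-1 *: w = e1 + (a^-1 * b) *: e2 + (a^-1 * d) *: e3.
    by rewrite ew ea eb ed !scalerDr !scalerA mulVf // scale1r.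
  have w'O : a^-1 *: w \in O l by rewrite memvZ.
  have w'n : a^-1 *: w != 0 by rewrite scaler_eq0 invr_eq0 (negPf an) (negPf wn).
  exists (a^-1 * b); apply/andP; split; last by apply/existsP; exists (a^-1 * d); rewrite -ew'.
  apply/GP => c.
  have [hh _] := scal_same n01 n12 n02 n0 n1 n2 m1 (memvZ (a^-1 * b) m2) (memvZ (a^-1 * d) m3) w'O w'n ew'
     (chi1 c) z1.
  by apply: (canc _ _ _ he2); move: hh; rewrite scalerA !chi2 scalerA.
have GD x y : x \in G -> y \in G -> x + y \in G.
  by move=> /GP gx /GP gy; apply/GP => c; rewrite mulrDr !chiD gx gy mulrDr.
pose I := [set l : 'I_17 | [&& l != i0, l != i1 & l != i2]].
pose bb (l : 'I_17) : F := odflt 0 [pick b | (b \in G) && [exists d, e1 + b *: e2 + d *: e3 \in O l]].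
have bbP l : l \in I -> (bb l \in G) /\ exists d, e1 + bb l *: e2 + d *: e3 \in O l.
  rewrite inE => /and3P[n0 n1 n2]; rewrite /bb; case: pickP => [b /andP[bG /existsP]//|k].
  by have [b] := coord l n0 n1 n2; rewrite k.
(* Two points with the same coordinate b would differ by a multiple of e3 and be collinear with
   [O i2]. So G has at least 14 elements, more than half of F. *)
have bbi : {in I &, injective bb}.
  move=> l m lI mI e; apply/eqP; apply: contraT => nlm.
  have [_ [d dl]] := bbP l lI; have [_ [d' dm]] := bbP m mI; rewrite -e in dm.
  move: lI mI; rewrite !inE => /and3P[_ _ l2] /and3P[_ _ m2'].
  have dmn : - (e1 + bb l *: e2 + d' *: e3) \in O m by rewrite memvN.
  have d3 : (d' - d) *: e3 \in O i2 by rewrite memvZ.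
  have [|w0 _ _] := ind hO nlm m2' l2 dl dmn d3.
    by rewrite opprD (addrACA (e1 + bb l *: e2)) subrr add0r scalerBl -[d' *: e3 - _]opprB subrr.
  have x3 : d *: e3 \in O i2 by rewrite memvZ.
  have x2 : bb l *: e2 \in O i1 by rewrite memvZ.
  have [w1] := ind hO n01 n12 n02 m1 x2 x3 w0.
  by move: (z1); rewrite w1 eqxx.
have cI : #|I| = 14%N.
  have eI : I = ~: [set i0; i1; i2].
    by apply/setP => l; rewrite !inE !negb_or andbA.
  have := cardsC [set i0; i1; i2]; rewrite card_ord -eI -setUA cardsU1 cards2 !inE (negPf n01) (negPf n02) n12 /=.
  by move=> /eqP; rewrite -[17%N]/(3 + 14)%N eqn_add2l => /eqP.
have cG : (8 < #|G|)%N.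
  apply: (@leq_trans #|bb @: I|); first by rewrite card_in_imset // cI.
  by apply: subset_leq_card; apply/subsetP => _ /imsetP[l lI ->]; case: (bbP l lI).
have chiM a b : chi (a * b) = chi a * chi b by apply/GP; exact: big_subgroup GD cG b.
have chiB : GRing.zmod_morphism chi.
  by move=> a b; apply/eqP; rewrite eq_sym subr_eq -chiD subrK.
pose sg1 := GRing.isZmodMorphism.Build _ _ chi chiB.
pose sg2 := GRing.isMonoidMorphism.Build _ _ chi (chi_1, chiM).
pose sg : {rmorphism F -> F} := HB.pack chi sg1 sg2.
exists sg => c x; have -> : sg c = chi c by [].
have [a [b [d [aO bO dO_ ->]]]] := dec x.
have [a' ea] : exists a', a = a' *: e1 by apply/vlineP; rewrite -(dim1_line (dO i0) m1 z1).
have [b' eb] : exists b', b = b' *: e2 by apply/vlineP; rewrite -(dim1_line (dO i1) m2 z2).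
have [d' ed] : exists d', d = d' *: e3 by apply/vlineP; rewrite -(dim1_line (dO i2) m3 z3).
by rewrite ea eb ed !scalerDr !hD !scalerA !chi1 !chi2 !chi3 !chiM !scalerDr !scalerA.
Qed.
End Additive.

Section Transfer.
Variables (sg : {rmorphism F -> F}) (h k : V -> V).
Hypotheses (hD : additive_map h) (hZ : forall c x, h (c *: x) = sg c *: h x).
Hypotheses (hk : cancel h k) (kh : cancel k h).

Let kD : additive_map k. Proof. by move=> x y; apply: (can_inj hk); rewrite hD !kh. Qed.
Let k0 : k 0 = 0. Proof. by apply: (addrI (k 0)); rewrite -kD !addr0. Qed.
Let h0 : h 0 = 0. Proof. by apply: (addrI (h 0)); rewrite -hD !addr0. Qed.
Let sgb : bijective sg. Proof. by apply: injF_bij; apply: fmorph_inj. Qed.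
Let kZ c x : k (sg c *: x) = c *: k x.
Proof. by apply: (can_inj hk); rewrite hZ !kh. Qed.

(** Semilinearity makes the filtered sets subspaces, so the spans are exactly the image and the
    preimage of U under h. *)
Definition himg U : {vspace V} := <<[seq y <- enum V | k y \in U]>>%VS.
Definition hpre U : {vspace V} := <<[seq y <- enum V | h y \in U]>>%VS.

Lemma mem_himg U y : (y \in himg U) = (k y \in U).
Proof.
apply/idP/idP => [m|kU]; last by apply: memv_span; rewrite mem_filter kU mem_enum.
have fE x : (x \in [seq y <- enum V | k y \in U]) = (k x \in U) by rewrite mem_filter mem_enum andbT.
have : y \in [seq y <- enum V | k y \in U].
  have [si s1 s2] := sgb.
  apply: mem_span_closed m => [x z|c x|]; rewrite !fE ?k0 ?mem0v //.
    by move=> a b; rewrite kD memvD.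
  by move=> a; rewrite -(s2 c) kZ memvZ.
by rewrite fE.
Qed.
Lemma mem_hpre U y : (y \in hpre U) = (h y \in U).
Proof.
apply/idP/idP => [m|kU]; last by apply: memv_span; rewrite mem_filter kU mem_enum.
have fE x : (x \in [seq y <- enum V | h y \in U]) = (h x \in U) by rewrite mem_filter mem_enum andbT.
have : y \in [seq y <- enum V | h y \in U].
  apply: mem_span_closed m => [x z|c x|]; rewrite !fE ?h0 ?mem0v //.
    by move=> a b; rewrite hD memvD.
  by move=> a; rewrite hZ memvZ.
by rewrite fE.
Qed.
Lemma hpreK U : himg (hpre U) = U.
Proof. by apply/vspaceP => y; rewrite mem_himg mem_hpre kh. Qed.
Lemma himgK U : hpre (himg U) = U.
Proof. by apply/vspaceP => y; rewrite mem_hpre mem_himg hk. Qed.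
Lemma dim_himg U : \dim (himg U) = \dim U.
Proof.
apply: (@expnI 16) => //; rewrite -hF -!card_vspace -[RHS](card_imset _ (can_inj hk)).
apply: eq_card => y; rewrite mem_himg; apply/idP/imsetP => [m|[x xU ->]]; last by rewrite hk.
by exists (k y); rewrite ?kh.
Qed.
Lemma dim_hpre U : \dim (hpre U) = \dim U.
Proof. by rewrite -{2}(hpreK U) dim_himg. Qed.
Lemma sub_himg U W : (himg U <= W)%VS = (U <= hpre W)%VS.
Proof.
apply/subvP/subvP => l x m; first by rewrite mem_hpre; apply: l; rewrite mem_himg hk.
by rewrite -(kh x) -mem_hpre; apply: l; rewrite -mem_himg.
Qed.

Lemma conic_image O O' : (forall U, in_range O' U <-> in_range O (hpre U)) -> is_conic O -> is_conic O'.
Proof.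
move=> r [M [ns rM]]; have [si s1 s2] := sgb.
(* The map k is semilinear for the inverse of sg. Applying sg to the entries of k y therefore gives
   a linear map of y, and sg of the old form at k y is a quadratic form with matrix M'. *)
pose N := \matrix_(i < 3) k 'e_i.
have eN y : map_mx sg (k y) = y *m map_mx sg N.
  have ky : k y = \sum_(j < 3) si (y 0 j) *: k 'e_j.
    rewrite {1}(row_sum_delta y).
    have kS : forall f : 'I_3 -> V, k (\sum_j f j) = \sum_j k (f j).
      by move=> f; apply: (big_morph k) => //; exact: kD.
    by rewrite kS; apply: eq_bigr => j _; rewrite -{1}(s2 (y 0 j)) kZ.
  rewrite ky; apply/rowP => j; rewrite !mxE summxE rmorph_sum /=.
  by apply: eq_bigr => i _; rewrite !mxE rmorphM /= s2.
pose M' := map_mx sg (N *m M *m N^T).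
have qM y : qform M' y = sg (qform M (k y)).
  rewrite /qform; transitivity ((map_mx sg (k y *m M *m (k y)^T)) 0 0); last by rewrite mxE.
  by rewrite !map_mxM -map_trmx eN /M' !map_mxM -map_trmx trmx_mul !mulmxA.
have pM x y : polar M' x y = sg (polar M (k x) (k y)).
  by rewrite /polar !qM kD !rmorphB.
exists M'; split=> [x xn|U dU].
  rewrite qM => /eqP; rewrite fmorph_eq0 => /eqP q0_.
  have kn : k x != 0 by rewrite -k0 (inj_eq (can_inj kh)).
  have [y ny] := ns _ kn q0_; exists (h y).
  by rewrite pM hk fmorph_eq0.
rewrite r rM ?dim_hpre //; split=> H x m.
  by rewrite qM H ?rmorph0 // mem_hpre kh.
by have /eqP := H (h x) (etrans (esym (mem_hpre U x)) m); rewrite qM hk fmorph_eq0 => /eqP.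
Qed.

Lemma in_range_himg C U : in_range (fun i => himg (C i)) U <-> in_range C (hpre U).
Proof.
by split=> -[i e]; exists i; [rewrite -e himgK | rewrite e hpreK].
Qed.

Lemma pointed_conic_image O O' : (forall U, in_range O' U <-> in_range O (hpre U)) ->
  is_pointed_conic O -> is_pointed_conic O'.
Proof.
move=> r [C [cC [i0 [N [[dN nN tN] rN]]]]].
exists (fun i => himg (C i)); split; first by apply: conic_image cC => U; apply: in_range_himg.
exists i0, (himg N); split.
  split; first by rewrite dim_himg.
    by move=> /in_range_himg; rewrite himgK.
  move=> i L dL iL uL; rewrite sub_himg; apply: (tN i); rewrite ?dim_hpre -?sub_himg // => j jL.
  by apply: uL; rewrite sub_himg.
move=> U; rewrite r rN in_range_himg; split=> -[[a b]|a].
- by left; split=> // e; apply: b; rewrite e himgK.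
- by right; rewrite -a hpreK.
- by left; split=> // e; apply: b; rewrite -e hpreK.
by right; rewrite a himgK.
Qed.
End Transfer.

Lemma oval_transfer (O O' : 'I_17 -> {vspace V}) (h : V -> V) (s : {perm 'I_17}) :
  is_oval O -> is_oval O' -> additive_map h -> bijective h ->
  (forall i x, (h x \in O' (s i)) = (x \in O i)) ->
  [/\ is_conic O -> is_conic O', is_pointed_conic O -> is_pointed_conic O',
      is_conic O' -> is_conic O & is_pointed_conic O' -> is_pointed_conic O].
Proof.
have half (P P' : 'I_17 -> {vspace V}) (g : V -> V) (t : {perm 'I_17}) : is_oval P -> is_oval P' ->
    additive_map g -> bijective g -> (forall i x, (g x \in P' (t i)) = (x \in P i)) ->
    (is_conic P -> is_conic P') /\ (is_pointed_conic P -> is_pointed_conic P').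
  move=> hP hP' gD gb gt; have [sg gZ] := oval_map_semilinear hP hP' gD (bij_inj gb) gt.
  have [g' gg' g'g] := gb.
  have r U : in_range P' U <-> in_range P (hpre g U).
    split=> -[i e].
      exists ((t^-1)%g i); apply/vspaceP => x.
      by rewrite (mem_hpre gD gZ) -e -gt permKV.
    exists (t i); apply/vspaceP => x; rewrite -(g'g x) gt e.
    by rewrite (mem_hpre gD gZ).
  by split; [apply: (conic_image gD gZ gg' g'g r) | apply: (pointed_conic_image gD gZ gg' g'g r)].
move=> hP hP' gD gb gt; have [a b] := half _ _ _ _ hP hP' gD gb gt.
have [g' gg' g'g] := gb.
have g'D : additive_map g' by move=> x y; apply: (can_inj gg'); rewrite gD !g'g.
have g'b : bijective g' by exists h.
have [|c d] := half _ _ g' (s^-1)%g hP' hP g'D g'b; last by [].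
by move=> i x; rewrite -gt permKV g'g.
Qed.
End Semilinear.

(** * Quadratic forms *)

Definition mons (w : pt) : seq q :=
  let: (x, y, z) := w in [:: x * x; y * y; z * z; x * y; x * z; y * z].
Fixpoint dot (u v : seq q) : q :=
  match u, v with a :: u', b :: v' => a * b + dot u' v' | _, _ => 0 end.
Fixpoint addl (u v : seq q) : seq q :=
  match u, v with a :: u', b :: v' => a + b :: addl u' v' | _, _ => [::] end.
Fixpoint comb6 (ks : seq q) (ws : seq pt) : seq q :=
  match ks, ws with
  | k :: ks', w :: ws' => addl [seq k * a | a <- mons w] (comb6 ks' ws')
  | _, _ => nseq 6 q0
  end.

Lemma dot_addl c u v : size u = size v -> dot c (addl u v) = dot c u + dot c v.
Proof.
elim: c u v => [|a c IH] [|b u] [|d v] //= [e]; rewrite ?addr0 // IH // mulrDr.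
by rewrite addrACA.
Qed.
Lemma dot_scale c k u : dot c [seq k * a | a <- u] = k * dot c u.
Proof.
elim: c u => [|a c IH] [|b u] //=; rewrite ?mulr0 // IH mulrDr.
by congr (_ + _); rewrite mulrCA.
Qed.
Lemma size_addl u v : size u = size v -> size (addl u v) = size u.
Proof. by elim: u v => [|a u IH] [|b v] //= [/IH->]. Qed.
Lemma size_comb6 ks ws : size (comb6 ks ws) = 6%N.
Proof.
elim: ks ws => [|k ks IH] [|w ws] //=; rewrite size_addl ?size_map; case: w => [[x y] z] //.
Qed.
Lemma dot_comb6 c ks ws : (forall w, w \in ws -> dot c (mons w) = 0) -> dot c (comb6 ks ws) = 0.
Proof.
have z m : dot c (nseq m q0) = 0.
  by elim: (c) m => [|a d IH] [|m] //=; rewrite IH -[q0]/(0 : q) mulr0 addr0.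
elim: ks ws => [|k ks IH] [|w ws] h; rewrite ?z //=.
rewrite dot_addl; last by rewrite size_comb6 size_map; case: (w) => [[x y] t'].
rewrite dot_scale h ?inE ?eqxx // mulr0 add0r IH // => v vw.
by apply: h; rewrite inE vw orbT.
Qed.

(* A linear combination of evaluations at the points of index [ns] that extracts each of the
   functionals [T] on quadratic forms. *)
Definition cert_ok (L : seq pt) (ns : seq nat) (K T : seq (seq q)) : bool :=
  [seq comb6 ks [seq nth 0 L n | n <- ns] | ks <- K] == T.

Lemma cert_okP L ns K T c u : cert_ok L ns K T -> u \in T ->
  (forall n, n \in ns -> dot c (mons (nth 0 L n)) = 0) -> dot c u = 0.
Proof.
move=> /eqP <- /mapP[ks _ ->] h; apply: dot_comb6 => w /mapP[n nn ->]; exact: h.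
Qed.

Definition unit6 : seq (seq q) := [seq [seq (if i == j then q1 else q0) | i <- iota 0 6] | j <- iota 0 6].
(** These functionals are the coefficients of x^2, z^2, x y and y z, and the sum of those of y^2 and
    x z. Forms on which they vanish are the multiples of y^2 + x z. *)
Definition conic5 : seq (seq q) :=
  [:: [:: q1; q0; q0; q0; q0; q0]; [:: q0; q0; q1; q0; q0; q0]; [:: q0; q0; q0; q1; q0; q0];
      [:: q0; q0; q0; q0; q0; q1]; [:: q0; q1; q0; q0; q1; q0]].

Lemma unit6_zero c : size c = 6%N -> (forall u, u \in unit6 -> dot c u = 0) ->
  forall w, dot c (mons w) = 0.
Proof.
case: c => [|a [|b [|d [|e [|f [|g [|]]]]]]] // _ h [[x y] z].
have h1 : a = 0 by have := h [:: q1; q0; q0; q0; q0; q0] isT; rewrite /= -[q0]/(0 : q) -[q1]/(1 : q) !mulr0 !mulr1 ?addr0 ?add0r.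
have h2 : b = 0 by have := h [:: q0; q1; q0; q0; q0; q0] isT; rewrite /= -[q0]/(0 : q) -[q1]/(1 : q) !mulr0 !mulr1 ?addr0 ?add0r.
have h3 : d = 0 by have := h [:: q0; q0; q1; q0; q0; q0] isT; rewrite /= -[q0]/(0 : q) -[q1]/(1 : q) !mulr0 !mulr1 ?addr0 ?add0r.
have h4 : e = 0 by have := h [:: q0; q0; q0; q1; q0; q0] isT; rewrite /= -[q0]/(0 : q) -[q1]/(1 : q) !mulr0 !mulr1 ?addr0 ?add0r.
have h5 : f = 0 by have := h [:: q0; q0; q0; q0; q1; q0] isT; rewrite /= -[q0]/(0 : q) -[q1]/(1 : q) !mulr0 !mulr1 ?addr0 ?add0r.
have h6 : g = 0 by have := h [:: q0; q0; q0; q0; q0; q1] isT; rewrite /= -[q0]/(0 : q) -[q1]/(1 : q) !mulr0 !mulr1 ?addr0 ?add0r.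
by rewrite h1 h2 h3 h4 h5 h6 /= !mul0r !addr0.
Qed.

Lemma conic5_form c : size c = 6%N -> (forall u, u \in conic5 -> dot c u = 0) ->
  exists b, forall x y z, dot c (mons (x, y, z)) = b * (y * y + x * z).
Proof.
case: c => [|a [|b [|d [|e [|f [|g [|]]]]]]] // _ h.
have h1 : a = 0 by have := h [:: q1; q0; q0; q0; q0; q0] isT; rewrite /= -[q0]/(0 : q) -[q1]/(1 : q) !mulr0 !mulr1 ?addr0 ?add0r.
have h3 : d = 0 by have := h [:: q0; q0; q1; q0; q0; q0] isT; rewrite /= -[q0]/(0 : q) -[q1]/(1 : q) !mulr0 !mulr1 ?addr0 ?add0r.
have h4 : e = 0 by have := h [:: q0; q0; q0; q1; q0; q0] isT; rewrite /= -[q0]/(0 : q) -[q1]/(1 : q) !mulr0 !mulr1 ?addr0 ?add0r.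
have h6 : g = 0 by have := h [:: q0; q0; q0; q0; q0; q1] isT; rewrite /= -[q0]/(0 : q) -[q1]/(1 : q) !mulr0 !mulr1 ?addr0 ?add0r.
have h5 : b + f = 0 by have := h [:: q0; q1; q0; q0; q1; q0] isT; rewrite /= -[q0]/(0 : q) -[q1]/(1 : q) !mulr0 !mulr1 ?addr0 ?add0r.
have bf : f = b by apply/eqP; rewrite -addq_eq0 addrC h5.
exists b => x y z; rewrite h1 h3 h4 h6 bf /= !mul0r !addr0 !add0r.
by rewrite mulrDr.
Qed.

Definition L1 := opts (0, 0, 1) freg.
Definition L2 := opts (0, 1, 0) freg.
Definition L3 := opts (0, 1, 0) fls.

(** Five points determine the conic. Two disjoint sets of points are certified because a form coming
    from a pointed conic vanishes at all points but one, and that point spoils at most one of the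
    sets. *)
Lemma cert1A : cert_ok L1 (iota 0 5) [:: [:: q0; q1; q0; q0; q0];
    [:: q1; q0; q0; q0; q0];
    [:: q6; q6; q1; q9; q14];
    [:: q0; q7; q7; q7; q7];
    [:: q7; q0; q7; q14; q9]] conic5.
Proof. by vm_compute. Qed.
Lemma cert1B : cert_ok L1 (iota 5 5) [:: [:: q1; q4; q11; q2; q13];
    [:: q3; q15; q9; q13; q8];
    [:: q5; q12; q3; q15; q5];
    [:: q7; q7; q7; q7; q0];
    [:: q6; q3; q11; q3; q13]] conic5.
Proof. by vm_compute. Qed.
(** Six points of the Lunelli-Sce oval impose independent conditions on the six coefficients, so
    only the zero form vanishes on them. Again there are two disjoint choices. *)
Definition idA : seq nat := [:: 0; 1; 2; 3; 4; 5]%N.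
Definition idB : seq nat := [:: 6; 7; 8; 9; 10; 11]%N.
Lemma cert3A : cert_ok L3 idA [:: [:: q0; q1; q0; q0; q0; q0];
    [:: q1; q0; q0; q0; q0; q0];
    [:: q4; q12; q5; q11; q5; q7];
    [:: q10; q14; q2; q12; q5; q5];
    [:: q7; q7; q8; q3; q15; q3];
    [:: q8; q4; q14; q4; q15; q1]] unit6.
Proof. by vm_compute. Qed.
Lemma cert3B : cert_ok L3 idB [:: [:: q7; q13; q0; q5; q9; q7];
    [:: q4; q13; q7; q3; q7; q10];
    [:: q9; q3; q11; q15; q15; q1];
    [:: q9; q4; q13; q5; q11; q14];
    [:: q11; q10; q14; q7; q2; q10];
    [:: q4; q0; q4; q4; q0; q4]] unit6.
Proof. by vm_compute. Qed.

Lemma fregE t : ap freg t = t * t. Proof. by case: t. Qed.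
Lemma L1_conic (i : 'I_17) : exists x y z, nth 0 L1 i = (x, y, z) /\ y * y + x * z = 0.
Proof.
case: (ixP i) => [->|[c ->]]; first by exists 0, 0, 1; split; rewrite // mulr0 mul0r addr0.
by rewrite /L1 nth_ix; exists 1, c, (ap freg c); split; rewrite // fregE mul1r addqq.
Qed.

(** * Conics, nuclei and pointed conics over GF(16) *)

Section Forms.
Variables (F : finFieldType) (hF : #|F| = 16%N) (al : F) (hal : al ^+ 4 = al + 1).
Notation V := 'rV[F]_3.
Notation vec := (vec al).
Notation points := (points al).
Let lamD := lamD hF al.
Let lam0 := lam0 al.
Let lam1 := lam1 al.
Let lamM := lamM hF hal.
Let lam_bij := lam_bij hF hal.
Let lam_eq0 x : lam al x = 0 -> x = 0. Proof. exact: lam_eq0 hF _ hal x. Qed.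
Let lamn x : x != 0 -> lam al x != 0. Proof. by apply: contra_neq => /lam_eq0. Qed.

Definition co0 : 'I_3 := @Ordinal 3 0 isT.
Definition co1 : 'I_3 := @Ordinal 3 1 isT.
Definition co2 : 'I_3 := @Ordinal 3 2 isT.
Lemma sum3E (f : 'I_3 -> F) : \sum_i f i = f co0 + f co1 + f co2.
Proof.
rewrite !big_ord_recl big_ord0 addr0 addrA; congr (f _ + f _ + f _); exact: val_inj.
Qed.

Lemma qformE (M : 'M[F]_3) x : qform M x = \sum_j (\sum_i x 0 i * M i j) * x 0 j.
Proof. by rewrite /qform mxE; apply: eq_bigr => j _; rewrite !mxE. Qed.
Lemma qformZ (M : 'M[F]_3) c x : qform M (c *: x) = c ^+ 2 * qform M x.
Proof. by rewrite !qformE !sum3E !mxE; ring. Qed.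

Lemma vecE0 w : vec w 0 co0 = lam al w.1.1. Proof. by rewrite mxE. Qed.
Lemma vecE1 w : vec w 0 co1 = lam al w.1.2. Proof. by rewrite mxE. Qed.
Lemma vecE2 w : vec w 0 co2 = lam al w.2. Proof. by rewrite mxE. Qed.
Lemma vec_surj (v : V) : exists w, v = vec w.
Proof. by have [g _ vg] := vec_bij hF hal; exists (g v). Qed.

Lemma qform_coefs (M : 'M[F]_3) : exists2 c, size c = 6%N &
  forall w, qform M (vec w) = lam al (dot c (mons w)).
Proof.
have [li l1 l2] := lam_bij.
exists [:: li (M co0 co0); li (M co1 co1); li (M co2 co2); li (M co0 co1 + M co1 co0);
  li (M co0 co2 + M co2 co0); li (M co1 co2 + M co2 co1)] => // -[[x y] z].
rewrite qformE !sum3E !vecE0 !vecE1 !vecE2 /= !lamD !lamM !l2 lam0.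
by ring.
Qed.

Lemma nonsingular_nonzero (M : 'M[F]_3) c : nonsingular_qf M ->
  (forall w, qform M (vec w) = lam al (dot c (mons w))) -> ~ forall w, dot c (mons w) = 0.
Proof.
move=> ns e z.
have q0_ v : qform M v = 0 by have [w ->] := vec_surj v; rewrite e z lam0.
have [||y] := ns (vec (1, 0, 0)); rewrite ?vec_eq0 // /polar !q0_.
by rewrite !subr0 eqxx.
Qed.

Lemma conic_vanish L : (forall i : 'I_17, nth 0 L i != 0) -> is_conic (points L) ->
  exists c, [/\ size c = 6%N, forall i : 'I_17, dot c (mons (nth 0 L i)) = 0
    & ~ forall w, dot c (mons w) = 0].
Proof.
move=> nz [M [ns r]]; have [c sc e] := qform_coefs M; exists c; split=> // [i|]; last exact: nonsingular_nonzero e.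
apply: lam_eq0; rewrite -e; have d : \dim (points L i) = 1%N by rewrite dim_vline vec_eq0 // nz.
have [h _] := r _ d.
by apply: h; [exists i | rewrite memv_line].
Qed.

(** The form of the underlying conic vanishes at every point except the added nucleus, which is not
    on the conic. *)
Lemma pointed_vanish L : is_oval (points L) -> is_pointed_conic (points L) ->
  exists c, size c = 6%N /\ exists2 i0 : 'I_17,
    forall i : 'I_17, i != i0 -> dot c (mons (nth 0 L i)) = 0 & dot c (mons (nth 0 L i0)) <> 0.
Proof.
move=> [Oi Od _] [C [[M [ns r]] [j0 [N [[dN nN _] rN]]]]]; have [c sc e] := qform_coefs M; exists c; split=> //.
have [i0 ei0] : in_range (points L) N by apply/rN; right.
exists i0 => [i ni|z]; last first.
  apply: nN; apply/r => // x; rewrite -ei0 => /vlineP[k ->].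
  by rewrite qformZ e z lam0 mulr0.
have [[ic _]|eN] : (in_range C (points L i) /\ points L i <> C j0) \/ points L i = N by apply/rN; exists i.
  apply: lam_eq0; rewrite -e; move/r: ic; apply; [exact: Od | exact: memv_line].
by case/negP: ni; apply/eqP; apply: Oi; rewrite ei0.
Qed.

Lemma in_iota_ord (n : nat) (P : nat -> Prop) : (forall i : 'I_17, P i) -> (n < 17)%N -> P n.
Proof. by move=> h l; exact: (h (Ordinal l)). Qed.

Let oval1 : is_oval (points L1). Proof. by apply: points_oval arc1 _ => // i; apply: opts_nz. Qed.
Let oval2 : is_oval (points L2). Proof. by apply: points_oval arc2 _ => // i; apply: opts_nz. Qed.
Let oval3 : is_oval (points L3). Proof. by apply: points_oval arc3 _ => // i; apply: opts_nz. Qed.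

Lemma two_sets L A B (c : seq q) (i0 : 'I_17) : (forall i : 'I_17, i != i0 -> dot c (mons (nth 0 L i)) = 0) ->
  all (fun n => (n < 17)%N) (A ++ B) -> ~~ has (fun n => n \in B) A ->
  (forall n, n \in A -> dot c (mons (nth 0 L n)) = 0) \/ (forall n, n \in B -> dot c (mons (nth 0 L n)) = 0).
Proof.
rewrite all_cat => v /andP[/allP lA /allP lB] /hasPn dj.
have v' n : (n < 17)%N -> n != i0 -> dot c (mons (nth 0 L n)) = 0.
  by move=> l n0; apply: (v (Ordinal l)).
have [iA|niA] := boolP (nat_of_ord i0 \in A); [right | left] => n nn.
  by apply: v'; [exact: lB | apply: contraTneq nn => ->; exact: dj].
by apply: v'; [exact: lA | apply: contraNneq niA => <-].
Qed.

(** One of the two certified sets avoids the exceptional point and forces a multiple of y^2 + x z,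
    which then vanishes at the exceptional point as well. *)
Lemma L1_not_pointed : ~ is_pointed_conic (points L1).
Proof.
move=> /(pointed_vanish oval1)[c [sc [i0 v n0]]].
have h5 u : u \in conic5 -> dot c u = 0.
  move=> uT; have [h|h] := two_sets (A := iota 0 5) (B := iota 5 5) v isT isT.
    exact: cert_okP cert1A uT h.
  exact: cert_okP cert1B uT h.
have [b eb] := conic5_form sc h5; apply: n0; have [x [y [z [-> e]]]] := L1_conic i0.
by rewrite eb e mulr0.
Qed.

Lemma L2_not_conic : ~ is_conic (points L2).
Proof.
have nz2 (i : 'I_17) : nth 0 L2 i != 0 by apply: opts_nz.
move=> /(conic_vanish nz2)[c [sc v n0]].
have h5 u : u \in conic5 -> dot c u = 0.
  (* The lists [L1] and [L2] differ only at position 0, which the indices 5 to 9 avoid, so the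
     certificate for [L1] applies. The point (0,1,0) then annihilates the remaining coefficient. *)
  move=> uT; apply: (cert_okP cert1B uT) => n nn.
  have l : (n < 17)%N by move: nn; rewrite mem_iota => /andP[_ /leq_trans]; apply.
  have := in_iota_ord (P := fun n => dot c (mons (nth 0 L2 n)) = 0) v l.
  by case: n nn l => [|n].
have [b eb] := conic5_form sc h5; apply: n0 => -[[x y] z]; rewrite eb.
have := v ord0; rewrite -[nth 0 L2 ord0]/((0, 1, 0) : pt) eb mul0r addr0 !mulr1 => ->.
by rewrite mul0r.
Qed.

Lemma L3_not_conic : ~ is_conic (points L3).
Proof.
have nz3 (i : 'I_17) : nth 0 L3 i != 0 by apply: opts_nz.
move=> /(conic_vanish nz3)[c [sc v n0]]; apply: n0; apply: unit6_zero => // u uT.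
apply: (cert_okP cert3A uT) => n nn; apply: (in_iota_ord (P := fun n => dot c (mons (nth 0 L3 n)) = 0)) => //.
by have /allP := (isT : all (fun n => (n < 17)%N) idA); apply.
Qed.

Lemma L3_not_pointed : ~ is_pointed_conic (points L3).
Proof.
move=> /(pointed_vanish oval3)[c [sc [i0 v n0]]]; apply: n0; apply: unit6_zero => // u uT.
have [h|h] := two_sets (A := idA) (B := idB) v isT isT.
  exact: cert_okP cert3A uT h.
exact: cert_okP cert3B uT h.
Qed.

Definition M0 : 'M[F]_3 :=
  \matrix_(i, j) (nth 0 (nth [::] [:: [:: 0; 0; 1]; [:: 0; 1; 0]; [:: 0; 0; 0]] i) j).
Lemma qM0 x : qform M0 x = x 0 co1 ^+ 2 + x 0 co0 * x 0 co2.
Proof. by rewrite qformE !sum3E !mxE /=; ring. Qed.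
Lemma qM0_vec x y z : qform M0 (vec (x, y, z)) = lam al (y * y + x * z).
Proof. by rewrite qM0 vecE0 vecE1 vecE2 /= lamD !lamM. Qed.

(** The polar form is x z' + z x', whose radical is spanned by (0,1,0), and the form y^2 + x z is
    nonzero there. *)
Lemma M0_nonsingular : nonsingular_qf M0.
Proof.
move=> v; have [[[x y] z] ->] := vec_surj v; rewrite vec_eq0 // qM0_vec => n /lam_eq0 e.
have pol u w : polar M0 u w = qform M0 (u + w) - qform M0 u - qform M0 w by [].
have [x0|xn] := eqVneq x 0; last first.
  exists (vec (0, 0, 1)); rewrite pol !qM0 ![(_ + _ : V) 0 _]mxE !vecE0 !vecE1 !vecE2 /= lam0 lam1.
  rewrite (_ : _ - _ = lam al x); first exact: lamn.
  by ring.
have [z0|zn] := eqVneq z 0; last first.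
  exists (vec (1, 0, 0)); rewrite pol !qM0 ![(_ + _ : V) 0 _]mxE !vecE0 !vecE1 !vecE2 /= lam0 lam1.
  rewrite (_ : _ - _ = lam al z); first exact: lamn.
  by ring.
move/eqP: e; rewrite x0 mul0r addr0 qmul_eq0 orbb => /eqP y0.
by rewrite x0 y0 z0 eqxx in n.
Qed.

Lemma unscale (L : {vspace V}) x w : x != 0 -> vec (x * w.1.1, x * w.1.2, x * w.2) \in L -> vec w \in L.
Proof.
move=> xn; rewrite vecZ // => m; have := memvZ (lam al x)^-1 m.
by rewrite scalerA mulVf ?scale1r // lamn.
Qed.

Lemma L1_range (U : {vspace V}) : \dim U = 1%N ->
  (in_range (points L1) U <-> forall x, x \in U -> qform M0 x = 0).
Proof.
move=> dU; split=> [[i <-] x /vlineP[k ->]|h].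
  have [a [b [c [-> e]]]] := L1_conic i; by rewrite qformZ qM0_vec e lam0 mulr0.
have [u un eU] := dim1P dU; have uU : u \in U by rewrite eU memv_line.
have [[[x y] z] eu] := vec_surj u; move: un uU {h}(h u uU); rewrite eu qM0_vec vec_eq0 // => n uU /lam_eq0 e.
have fin (i : 'I_17) : vec (nth 0 L1 i) \in U -> in_range (points L1) U.
  move=> m; exists i; apply/esym/dim1_line => //; rewrite vec_eq0 //; exact: opts_nz.
have [x0|xn] := eqVneq x 0.
  move/eqP: e; rewrite x0 mul0r addr0 qmul_eq0 orbb => /eqP y0.
  have zn : z != 0 by apply: contraNneq n => z0; rewrite x0 y0 z0.
  rewrite x0 y0 in uU; apply: (fin ord0); apply: (unscale zn).
  by rewrite /= !mulr0 mulr1.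
pose t := qdiv y x; have xt : x * t = y by exact: qdivK.
apply: (fin (ix t)); rewrite /L1 nth_ix fregE; apply: (unscale xn); rewrite /= mulr1 xt.
suff -> : x * (t * t) = z by [].
apply: (qmulI xn); apply/eqP; rewrite -addq_eq0 -e; apply/eqP.
by rewrite -xt; congr (_ + _); ring.
Qed.

Lemma L1_is_conic : is_conic (points L1).
Proof. by exists M0; split; [exact: M0_nonsingular | exact: L1_range]. Qed.

(** Otherwise the coordinate would be injective on the 256 vectors of L, with values in a field of
    16 elements. *)
Lemma plane_vanish (L : {vspace V}) o : \dim L = 2%N -> exists l, [/\ l \in L, l != 0 & l 0 o = 0].
Proof.
move=> d; case: (pickP [pred l : V | [&& l \in L, l != 0 & l 0 o == 0]]) => [l /and3P[a b /eqP c]|k].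
  by exists l.
have inj : {in L &, injective (fun l : V => l 0 o)}.
  move=> x y xL yL e; apply/eqP; rewrite -subr_eq0; apply: contraT => n.
  by have := k (x - y); rewrite /= n memvB // !mxE e subrr eqxx.
have := max_card [in [seq (l : V) 0 o | l in L]]; rewrite (card_in_image inj) card_vspace d hF.
by [].
Qed.

(** A line through (0,0,1) and (1,t,0) contains the conic point (1,t,t^2); a line through (1,t,t^2)
    and (0,1,s) with s nonzero contains (1,t+s,(t+s)^2). So a line with a single conic point passes
    through (0,1,0). *)
Lemma L1_nucleus : is_nucleus (points L1) <[vec (0%R, 1%R, 0%R)]>%VS.
Proof.
have d1 : \dim <[vec (0%R, 1%R, 0%R)]>%VS = 1%N by rewrite dim_vline vec_eq0.
split=> // [/(L1_range d1)/(_ _ (memv_line _))|i L dL iL uL].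
  by rewrite qM0_vec mul0r addr0 mulr1 lam1 => /eqP; rewrite oner_eq0.
rewrite -memvE; rewrite -memvE in iL.
have inj (j : 'I_17) : vec (nth 0 L1 j) \in L -> j = i by move=> m; apply: uL; rewrite -memvE.
have on t : vec (1, t, t * t) \in L -> ix t = i.
  by move=> m; apply: inj; rewrite /L1 nth_ix fregE.
have n0 t : ix t <> ord0 by move/(congr1 val); rewrite /= ixE.
case: (ixP i) => [i0|[t it]].
  have e3 : vec (0, 0, 1) \in L by move: iL; rewrite i0.
  have [l [lL ln l2]] := plane_vanish co2 dL; have [[[x y] z] el] := vec_surj l.
  move: lL ln l2; rewrite el vec_eq0 // vecE2 /= => lL ln /lam_eq0 z0; rewrite z0 in lL ln.
  have [x0|xn] := eqVneq x 0.
    have yn : y != 0 by apply: contraNneq ln => y0; rewrite x0 y0.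
    by apply: (unscale yn); rewrite /= mulr0 mulr1 -{1}x0.
  pose t := qdiv y x; have xt : x * t = y by exact: qdivK.
  have m : vec (1, t, 0) \in L by apply: (unscale xn); rewrite /= mulr1 mulr0 xt.
  have m' : vec (0, 0, t * t) \in L.
    have := memvZ (lam al (t * t)) e3; by rewrite -vecZ //= !mulr0 mulr1.
  case: (n0 t); rewrite -i0; apply: on.
  by have := memvD m m'; rewrite -vecD // -[_ + _]/((1 + 0, t + 0, 0 + t * t) : pt) !addr0 add0r.
have wt : vec (1, t, t * t) \in L by move: iL; rewrite it /L1 nth_ix fregE.
have [l [lL ln l0]] := plane_vanish co0 dL; have [[[x y] z] el] := vec_surj l.
move: lL ln l0; rewrite el vec_eq0 // vecE0 /= => lL ln /lam_eq0 x0; rewrite x0 in lL ln.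
have [y0|yn] := eqVneq y 0.
  have zn : z != 0 by apply: contraNneq ln => z0; rewrite y0 z0.
  case: (n0 t); rewrite -it; apply/esym; apply: inj; apply: (unscale zn).
  by rewrite /= !mulr0 mulr1 -{2}y0.
pose s := qdiv z y; have ys : y * s = z by exact: qdivK.
have m : vec (0, 1, s) \in L by apply: (unscale yn); rewrite /= mulr1 mulr0 ys.
have [s0|sn] := eqVneq s 0; first by move: m; rewrite s0.
have m' : vec (0, s, s * s) \in L.
  have := memvZ (lam al s) m; by rewrite -vecZ //= mulr0 mulr1.
have /on : vec (1, t + s, (t + s) * (t + s)) \in L.
  have := memvD wt m'; rewrite -vecD // -[_ + _]/((1 + 0, t + s, t * t + s * s) : pt) addr0.
  suff -> : (t + s) * (t + s) = t * t + s * s by [].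
  by rewrite mulrDl !mulrDr addrA -(addrA (t * t)) (mulrC s t) addqq addr0.
rewrite it => /ix_inj/eqP; rewrite -subr_eq0 addrC addKr => /eqP s0.
by rewrite s0 eqxx in sn.
Qed.

Lemma L2_is_pointed : is_pointed_conic (points L2).
Proof.
exists (points L1); split; first exact: L1_is_conic.
exists ord0, <[vec (0%R, 1%R, 0%R)]>%VS; split; first exact: L1_nucleus.
have n0 t : ix t <> ord0 by move/(congr1 val); rewrite /= ixE.
have e12 c : points L1 (ix c) = points L2 (ix c).
  rewrite -[LHS]/(<[vec (nth 0%R (opts (0, 0, 1)%R freg) (ix c))]>%VS).
  by rewrite -[RHS]/(<[vec (nth 0%R (opts (0, 1, 0)%R freg) (ix c))]>%VS) !nth_ix.
have inj : injective (points L1) by case: oval1.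
move=> U; split=> [[i <-]|[[[i <-] ni]|->]].
- case: (ixP i) => [->|[c ->]]; [by right | left].
  by rewrite -e12; split; [exists (ix c) | move/inj/n0].
- case: (ixP i) ni => [->//|[c ->] _]; exists (ix c); exact/esym/e12.
by exists ord0.
Qed.
End Forms.

Theorem theorem6 (F : finFieldType) (hF : #|F| = 16%N) :
  (exists P1 P2 P3 : 'I_17 -> {vspace V2},
    [/\ [/\ is_pseudo_oval P1, is_pseudo_oval P2 & is_pseudo_oval P3],
        [/\ ~ pequiv P1 P2, ~ pequiv P1 P3 & ~ pequiv P2 P3],
        [/\ exists O : 'I_17 -> {vspace 'rV[F]_3}, is_conic O /\ arises_from P1 O,
            exists O : 'I_17 -> {vspace 'rV[F]_3}, is_pointed_conic O /\ arises_from P2 O &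
            exists O : 'I_17 -> {vspace 'rV[F]_3}, is_LS_oval O /\ arises_from P3 O],
        (forall P, is_pseudo_oval P -> [\/ pequiv P P1, pequiv P P2 | pequiv P P3])
      & (forall (O : 'I_17 -> {vspace 'rV[F]_3}) P, is_oval O -> arises_from P O ->
          [/\ is_conic O -> pequiv P P1,
              is_pointed_conic O -> pequiv P P2 &
              is_LS_oval O -> pequiv P P3])])
  /\ (forall P, is_pseudo_oval P -> elementary F P).
Proof.
have [al hal] := F16_root hF; have [phi [pD pb pv]] := identification hF hal.
pose PP L i := vimg phi (points al L i).
have arL L : arises_from (PP L) (points al L).
  by exists phi; split=> //; exists 1%g => i; rewrite perm1.
have ov1 : is_oval (points al L1) by apply: points_oval arc1 _ => // i; apply: opts_nz.
have ov2 : is_oval (points al L2) by apply: points_oval arc2 _ => // i; apply: opts_nz.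
have ov3 : is_oval (points al L3) by apply: points_oval arc3 _ => // i; apply: opts_nz.
have mP L := members_points hF hal L pD pb pv.
have cls P : is_pseudo_oval P -> [\/ pequiv P (PP L1), pequiv P (PP L2) | pequiv P (PP L3)].
  move=> hP; have [g [ig c]] := members_classification hP; have [Pi _ _] := hP.
  case: c => c; [constructor 1 | constructor 2 | constructor 3]; apply: (pequivI Pi ig); rewrite c mP.
  - exact: std_opts2.
  - exact: std_opts3.
  exact: std_opts3.
(* The type of an oval is an invariant of the pseudo-oval up to equivalence, whichever oval and
   identification it arises from. *)
have tr P Q (O O' : 'I_17 -> {vspace 'rV[F]_3}) : is_oval O -> is_oval O' -> arises_from P O -> arises_from Q O' -> pequiv P Q ->
    [/\ is_conic O -> is_conic O', is_pointed_conic O -> is_pointed_conic O',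
        is_conic O' -> is_conic O & is_pointed_conic O' -> is_pointed_conic O].
  move=> hO hO' aP aQ e; have [h [hD hb [s hs]]] := equiv_additive e aP aQ.
  exact: (oval_transfer hF hO hO' hD hb hs).
have c1 := L1_is_conic hF hal; have p2 := L2_is_pointed hF hal.
have nc2 := @L2_not_conic F hF al hal; have nc3 := @L3_not_conic F hF al hal.
have np1 := @L1_not_pointed F hF al hal; have np3 := @L3_not_pointed F hF al hal.
split.
  exists (PP L1), (PP L2), (PP L3); split=> //.
  - by split; apply: arises_pseudo_oval (arL _).
  - split=> e.
    + by have [h _ _ _] := tr _ _ _ _ ov1 ov2 (arL L1) (arL L2) e; apply: nc2; apply: h.
    + by have [h _ _ _] := tr _ _ _ _ ov1 ov3 (arL L1) (arL L3) e; apply: nc3; apply: h.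
    by have [_ h _ _] := tr _ _ _ _ ov2 ov3 (arL L2) (arL L3) e; apply: np3; apply: h.
  - by split; [exists (points al L1) | exists (points al L2) | exists (points al L3)].
  move=> O P hO aP; have hP := arises_pseudo_oval hF hO aP.
  (* The representative equivalent to P fixes the type of O through [tr]; the hypotheses of the two
     other types are then contradictory. *)
  case: (cls P hP) => e; [have [a b c d] := tr _ _ _ _ hO ov1 aP (arL L1) e
    | have [a b c d] := tr _ _ _ _ hO ov2 aP (arL L2) e | have [a b c d] := tr _ _ _ _ hO ov3 aP (arL L3) e].
  - by split=> // [/b/np1|[_ /(_ (c c1))]].
  - by split=> // [/a/nc2|[_ _ /(_ (d p2))]].
  by split=> // [/a/nc3|/b/np3].
move=> P hP; case: (cls P hP) => e.
- by exists (points al L1); split=> //; apply: arises_pequiv e (arL _).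
- by exists (points al L2); split=> //; apply: arises_pequiv e (arL _).
by exists (points al L3); split=> //; apply: arises_pequiv e (arL _).
Qed.
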